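(* Let $n\ge2$ and let $\mathcal{S}=\mathcal{S}_{\mathbf r}$ be the standard (dyadic) non-self-similar collection of slits in $(0,1)^n\subset\mathbb{R}^n$ corresponding to a sequence $\mathbf{r}=\{r_i\}_{i\ge0}$, $0\le r_i<1$, such that $\mathbf{r}\notin\ell^n$ (i.e. $\sum_i r_i^n=\infty$). Then for every $p\ge1$ $$\mathrm{mod}_p\,\Gamma_{\mathcal{S}}=\mathrm{mod}_p(\hat\Gamma_{\mathcal{S}})=\mathrm{mod}_p(\Gamma_{nv})=0,$$ where $\Gamma_{nv}$ is the family of non-vertical curves in $M(\mathcal{S})$ or in $DM(\mathcal{S})$ (the equality holds in both cases).
   Context: Dyadic slits. For $\mathbf{r}=\{r_i\}_{i\ge0}$ with $0\le r_i<1$ and each dyadic cube $Q\subset[0,1]^n$ of generation $i\ge0$ (side length $l(Q)=2^{-i}$), let $s(Q)$ be the slit $\{x\}\times[c_2,d_2]\times\cdots\times[c_n,d_n]$ with the same center as $Q$ and with $d_k-c_k=r_i\,l(Q)=r_i/2^i$ for all $k$ ($s(Q)=\emptyset$ if $r_i=0$). $\mathcal{S}_{\mathbf r}$ is the collection of all nonempty $s(Q)$, enumerated as a sequence $\{s_i\}$. The box is $I=(0,1)^n$. Standing assumptions on slits: they are pairwise disjoint and uniformly relatively separated in $I$, i.e. there is $\sigma>0$ with $\Delta(s_i,s_j)\ge\sigma$ and $\Delta(s_i,\partial I)\ge\sigma$ for $i\ne j$, where $\Delta(E,F)=\mathrm{dist}(E,F)/\min(\mathrm{diam}\,E,\mathrm{diam}\,F)$;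 $\mathrm{diam}(s_i)\to0$; and $\bigcup_i s_i$ is dense in $I$. Slit Sierpi\'nski space. Put $S_0=I$, $S_i=I\setminus\bigcup_{j\le i}s_j$, and let $(\overline{M}_i,d_{\overline{M}_i})$ be the completion of $S_i$ in its inner (path) metric (infimum of Euclidean lengths of curves in $S_i$), $\overline{M}_0=\overline I$. For $i\le j$ let $\tau_{i,j}:\overline{M}_j\to\overline{M}_i$ be the $1$-Lipschitz extension of the inclusion $S_j\subset S_i$. $M(\mathcal{S})=\varprojlim(\overline{M}_i,\tau_{i,j})$ with metric $d_{\mathcal{S}}(p,q)=\lim_i d_{\overline{M}_i}(p_i,q_i)$; $\tau_0:M(\mathcal{S})\to\overline I$, $p\mapsto p_0$. The outer boundary is $\tau_0^{-1}(\partial I)$. The double $DM(\mathcal{S})$ is obtained by gluing two copies of $M(\mathcal{S})$ along their outer boundaries by the identity, with the induced gluing path metric (equal to $d_{\mathcal{S}}$ on each copy, and to $\inf_z(d_{\mathcal{S}}(p,z)+d_{\mathcal{S}}(z,q))$ over $z$ in the outer boundary if $p,q$ are in different copies); $\tau_0$ extends to $DM(\mathcal{S})$ in the obvious way. Both are equipped with the Hausdorff measure $\mathcal{H}^n$. Curve families. Let $L=\{0\}\times(0,1)^{n-1}$, $R=\{1\}\times(0,1)^{n-1}$, $\mathcal{L}=\tau_0^{-1}(L)$, $\mathcal{R}=\tau_0^{-1}(R)$. A curve $\gamma:(0,1)\to X$ connects $E$ and $F$ if $E\cup F\cup\overline\gamma$ is connected. $\Gamma_{\mathcal{S}}$ is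 the family of curves in $I\setminus\bigcup_i s_i$ connecting $L$ and $R$ in $\overline I$. $\hat\Gamma_{\mathcal{S}}=\{\tau_0(\gamma):\gamma\subset M(\mathcal{S}),\ \gamma\text{ connects }\mathcal{L}\text{ and }\mathcal{R}\}$. A curve $\gamma$ in $M(\mathcal{S})$ or $DM(\mathcal{S})$ is vertical if $\pi_1(\tau_0(\gamma))$ is a single point, where $\pi_1$ is the first coordinate, and non-vertical otherwise. Modulus. $\mathrm{mod}_p\Gamma=\inf_\rho\int_X\rho^p\,d\mu$ over all Borel $\rho:X\to[0,\infty)$ with $\int_\gamma\rho\,ds\ge1$ for every locally rectifiable $\gamma\in\Gamma$; here $\mu=\mathcal{H}^n$, with $X=\mathbb{R}^n$ for $\Gamma_{\mathcal{S}}$ and $\hat\Gamma_{\mathcal{S}}$ and $X=M(\mathcal{S})$ or $DM(\mathcal{S})$ for $\Gamma_{nv}$. *)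

(* Defs.v *)
From HB Require Import structures.
From mathcomp Require Import all_boot all_order all_algebra.
From mathcomp Require Import all_classical all_reals all_analysis.

Import Order.TTheory GRing.Theory Num.Theory.
Import numFieldNormedType.Exports.

Local Open Scope classical_set_scope.
Local Open Scope ring_scope.

(* [mspace d] is [T] with the topology of the open [d]-balls.  Distances take
   values in [\bar R] because an inner metric is [+oo] between points that no
   rectifiable curve joins. *)
Definition mspace {R : realType} {T : Type} (d : T -> T -> \bar R) : Type := T.

Definition mopen {R : realType} {T : Type} (d : T -> T -> \bar R)
    : set (set T) :=
  [set A | forall x, A x ->
     exists2 e : R, 0 < e & forall y, (d x y < e%:E)%E -> A y].

Lemma mopenT {R : realType} {T : Type} (d : T -> T -> \bar R) : mopen d setT.
Proof. by move=> x _; exists 1. Qed.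

Lemma mopenI {R : realType} {T : Type} (d : T -> T -> \bar R) :
  setI_closed (mopen d).
Proof.
move=> A B oA oB x [/oA[e e0 eA] /oB[f f0 fB]].
exists (Num.min e f); first by rewrite lt_min e0.
move=> y; rewrite EFin_min lt_min => /andP[/eA ? /fB ?]; by split.
Qed.

Lemma mopen_bigU {R : realType} {T : Type} (d : T -> T -> \bar R)
    (I : Type) (F : I -> set T) :
  (forall i, mopen d (F i)) -> mopen d (\bigcup_i F i).
Proof.
move=> oF x [i _ /oF[e e0 eF]]; exists e => // y /eF ?; by exists i.
Qed.

HB.instance Definition _ {R : realType} {T : Type} (d : T -> T -> \bar R) :=
  gen_eqMixin (mspace d).
HB.instance Definition _ {R : realType} {T : Type} (d : T -> T -> \bar R) :=
  gen_choiceMixin (mspace d).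
HB.instance Definition _ {R : realType} {T : Type} (d : T -> T -> \bar R) :=
  @isOpenTopological.Build (mspace d) (mopen d)
    (mopenT d) (mopenI d) (mopen_bigU d).

Definition set_diam {R : realType} {T : Type} (d : T -> T -> \bar R)
    (A : set T) : \bar R :=
  ereal_sup (0%E |` [set d x y | x in A & y in A]).

Definition set_dist {R : realType} {T : Type} (d : T -> T -> \bar R)
    (A B : set T) : \bar R :=
  ereal_inf [set d x y | x in A & y in B].

(* No normalizing constant: for the Euclidean distance on R^m this is a
   constant multiple of Lebesgue measure. *)
Definition hausdorff_measure {R : realType} {T : Type} (d : T -> T -> \bar R)
    (m : nat) (A : set T) : \bar R :=
  ereal_sup [set ereal_inf
      [set (\sum_(k <oo) (set_diam d (F k)) ^+ m)%E | F in
        [set F : nat -> set T | A `<=` \bigcup_k F k /\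
           forall k, (set_diam d (F k) <= delta%:E)%E]]
    | delta in [set delta : R | 0 < delta]].

Definition borel {R : realType} {T : Type} (d : T -> T -> \bar R)
    : set (set T) := <<s (@open (mspace d)) >>.

Definition borel_fun {R : realType} {T : Type} (d : T -> T -> \bar R)
    (f : T -> R) : Prop :=
  forall B : set R, measurable B -> borel d (f @^-1` B).

(* The measurable types of the library are pointed, hence the base point [x0]
   and the case distinction in [mintegral]. *)
Definition mspace_at {R : realType} {T : Type} (d : T -> T -> \bar R) (x0 : T)
  : Type := mspace d.

HB.instance Definition _ {R : realType} {T : Type} (d : T -> T -> \bar R)
  (x0 : T) := Topological.on (mspace_at d x0).
HB.instance Definition _ {R : realType} {T : Type} (d : T -> T -> \bar R)
  (x0 : T) := isPointed.Build (mspace_at d x0) x0.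

Definition mintegral {R : realType} {T : Type} (d : T -> T -> \bar R)
    (mu : set T -> \bar R) (f : T -> \bar R) : \bar R :=
  if pselect (exists x : T, True) is left T_inhabited then
    integral (T := g_sigma_algebraType
                     (@open (mspace_at d (sval (cid T_inhabited)))))
             mu setT f
  else 0%E.

Definition curve_length {R : realType} {T : Type} (d : T -> T -> \bar R)
    (gamma : R -> T) (a b : R) : \bar R :=
  ereal_sup
    [set (\sum_(i < size t)
            d (gamma (nth b (a :: t) i)) (gamma (nth b (a :: t) i.+1)))%E
    | t in itv_partition a b].

(* A curve is a continuous map on the open interval ]0, 1[; the values of
   [gamma] outside ]0, 1[ are irrelevant. *)
Definition is_curve {R : realType} {T : Type} (d : T -> T -> \bar R)
    (gamma : R -> T) : Prop :=
  {in `]0, 1[, continuous (gamma : R -> mspace d)}.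

Definition trace {R : realType} {T : Type} (gamma : R -> T) : set T :=
  gamma @` `]0, 1[.

Definition locally_rectifiable {R : realType} {T : Type}
    (d : T -> T -> \bar R) (gamma : R -> T) : Prop :=
  forall a b : R, 0 < a -> a < b -> b < 1 ->
    (curve_length d gamma a b < +oo)%E.

(* [arc_point d gamma a b u] is the point at arc length [u] from [gamma a]
   along [gamma] restricted to [a, b]. *)
Definition arc_point {R : realType} {T : Type} (d : T -> T -> \bar R)
    (gamma : R -> T) (a b u : R) : T :=
  gamma (inf [set t | a <= t <= b /\ (u%:E <= curve_length d gamma a t)%E]).

Definition line_integral {R : realType} {T : Type} (d : T -> T -> \bar R)
    (rho : T -> R) (gamma : R -> T) : \bar R :=
  ereal_sup
    [set (\int[lebesgue_measure]_(u in `[0%R, fine (curve_length d gamma ab.1 ab.2)])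
            (rho (arc_point d gamma ab.1 ab.2 u))%:E)%E
    | ab in [set ab : R * R | [/\ 0 < ab.1, ab.1 < ab.2 & ab.2 < 1]]].

Definition connects {R : realType} {T : Type} (d : T -> T -> \bar R)
    (E F : set T) (gamma : R -> T) : Prop :=
  @connected (mspace d) (E `|` F `|` @closure (mspace d) (trace gamma)).

Definition admissible {R : realType} {T : Type} (d : T -> T -> \bar R)
    (Gamma : set (R -> T)) : set (T -> R) :=
  [set rho | [/\ borel_fun d rho, (forall x, 0 <= rho x) &
     forall gamma, Gamma gamma -> locally_rectifiable d gamma ->
       (1 <= line_integral d rho gamma)%E]].

Definition modulus {R : realType} {T : Type} (d : T -> T -> \bar R)
    (mu : set T -> \bar R) (p : R) (Gamma : set (R -> T)) : \bar R :=
  ereal_inf [set mintegral d mu (fun x => (rho x `^ p)%:E)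
            | rho in admissible d Gamma].

Definition cauchy_in {R : realType} {T : Type} (d : T -> T -> \bar R)
    (A : set T) : set (nat -> T) :=
  [set u | (forall k, A (u k)) /\
     forall e : R, 0 < e -> exists N, forall k l, (N <= k)%N -> (N <= l)%N ->
       (d (u k) (u l) < e%:E)%E].

Definition cauchy_class {R : realType} {T : Type} (d : T -> T -> \bar R)
    (A : set T) (u : nat -> T) : set (nat -> T) :=
  [set v | cauchy_in d A v /\
     (fun k => d (u k) (v k)) @ \oo --> (0%E : \bar R)].

Definition completion {R : realType} {T : Type} (d : T -> T -> \bar R)
    (A : set T) : Type :=
  {P : set (nat -> T) | exists2 u, cauchy_in d A u & P = cauchy_class d A u}.

Definition completion_point {R : realType} {T : Type} {d : T -> T -> \bar R}
    {A : set T} {u : nat -> T} (hu : cauchy_in d A u) : completion d A :=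
  exist _ (cauchy_class d A u) (ex_intro2 _ _ u hu erefl).

Definition completion_rep {R : realType} {T : Type} {d : T -> T -> \bar R}
    {A : set T} (P : completion d A) : nat -> T :=
  s2val (cid2 (svalP P)).

Lemma completion_repP {R : realType} {T : Type} {d : T -> T -> \bar R}
    {A : set T} (P : completion d A) : cauchy_in d A (completion_rep P).
Proof. exact: s2valP (cid2 (svalP P)). Qed.

Definition completion_dist {R : realType} {T : Type} {d : T -> T -> \bar R}
    {A : set T} (P Q : completion d A) : \bar R :=
  limn (fun k => d (completion_rep P k) (completion_rep Q k)).

(* Where the first coordinate [ord0] is singled out, the ambient space is R^n
   with n := m.+1. *)

Definition eucl {R : realType} {n : nat} (x y : 'rV[R]_n) : \bar R :=
  (Num.sqrt (\sum_i (x 0 i - y 0 i) ^+ 2))%:E.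

Definition box (R : realType) (n : nat) : set 'rV[R]_n :=
  [set x | forall i, 0 < x 0 i < 1].

Definition box_boundary (R : realType) (n : nat) : set 'rV[R]_n :=
  [set x | (forall i, 0 <= x 0 i <= 1) /\ exists i, x 0 i = 0 \/ x 0 i = 1].

Definition box_left (R : realType) (m : nat) : set 'rV[R]_m.+1 :=
  [set x | x 0 0 = 0 /\ forall i, i != 0 -> 0 < x 0 i < 1].

Definition box_right (R : realType) (m : nat) : set 'rV[R]_m.+1 :=
  [set x | x 0 0 = 1 /\ forall i, i != 0 -> 0 < x 0 i < 1].

(* The dyadic cube of generation [i] with index [k] is the product of the
   intervals [k_j / 2^i, (k_j + 1) / 2^i]. *)
Definition dyadic_center {R : realType} {n : nat} {i : nat}
    (k : 'I_(2 ^ i) ^ n) : 'rV[R]_n :=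
  \row_j (((k j)%:R + 2^-1) / 2 ^+ i).

Definition dyadic_slit {R : realType} {m : nat} (r : nat -> R) {i : nat}
    (k : 'I_(2 ^ i) ^ m.+1) : set 'rV[R]_m.+1 :=
  [set x | [/\ 0 < r i, x 0 0 = dyadic_center k 0 0 &
     forall j, j != 0 ->
       `|x 0 j - dyadic_center k 0 j| <= r i / 2 ^+ i / 2]].

Definition dyadic_slits {R : realType} (m : nat) (r : nat -> R)
    : set (set 'rV[R]_m.+1) :=
  [set A | A !=set0 /\
     exists (i : nat) (k : 'I_(2 ^ i) ^ m.+1), A = dyadic_slit r k].

Definition relative_dist {R : realType} {n : nat} (E F : set 'rV[R]_n) : R :=
  fine (set_dist eucl E F) /
  Num.min (fine (set_diam eucl E)) (fine (set_diam eucl F)).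

Definition uniformly_relatively_separated {R : realType} {n : nat}
    (s : nat -> set 'rV[R]_n) : Prop :=
  exists2 sigma : R, 0 < sigma &
    (forall i j, i <> j -> sigma <= relative_dist (s i) (s j)) /\
    (forall i, sigma <= relative_dist (s i) (box_boundary R n)).

Definition slit_assumptions {R : realType} {n : nat}
    (s : nat -> set 'rV[R]_n) : Prop :=
  [/\ trivIset setT s,
      uniformly_relatively_separated s,
      (fun i => set_diam eucl (s i)) @ \oo --> (0%E : \bar R) &
      box R n `<=`
        @closure (mspace eucl) (\bigcup_i s i)].

Definition inner_dist {R : realType} {n : nat} (A : set 'rV[R]_n)
    (x y : 'rV[R]_n) : \bar R :=
  ereal_inf [set curve_length eucl gamma 0 1 | gamma in
    [set gamma : R -> 'rV[R]_n |
      [/\ {within `[0, 1], continuous (gamma : R -> mspace eucl)},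
          gamma 0 = x, gamma 1 = y & gamma @` `[0, 1] `<=` A]]].

Lemma inner_dist_subset {R : realType} {n : nat} {A B : set 'rV[R]_n}
    (x y : 'rV[R]_n) :
  A `<=` B -> (inner_dist B x y <= inner_dist A x y)%E.
Proof.
move=> AB; apply: ereal_inf_le_tmp => _ [g [gc g0 g1 gA] <-].
by exists g => //; split => // z /gA/AB.
Qed.

Lemma inner_cauchy_subset {R : realType} {n : nat} {A B : set 'rV[R]_n}
    {u : nat -> 'rV[R]_n} :
  A `<=` B -> cauchy_in (inner_dist A) A u -> cauchy_in (inner_dist B) B u.
Proof.
move=> AB [uA uC]; split=> [k|e /uC[N uN]]; first exact/AB.
exists N => k l Nk Nl; exact: le_lt_trans (inner_dist_subset _ _ AB) (uN k l Nk Nl).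
Qed.

(* Slits are numbered from 0, so that [slit_domain s 0] is the box. *)
Definition slit_domain {R : realType} {n : nat} (s : nat -> set 'rV[R]_n)
    (i : nat) : set 'rV[R]_n :=
  box R n `\` \bigcup_(j in [set j | (j < i)%N]) s j.

Lemma slit_domain_subset {R : realType} {n : nat} (s : nat -> set 'rV[R]_n)
    {i j : nat} : (i <= j)%N -> slit_domain s j `<=` slit_domain s i.
Proof.
move=> ij x [Ix sx]; split=> // -[k /= ki sk]; apply: sx; exists k => //=.
exact: leq_trans ki ij.
Qed.

Definition Mbar {R : realType} {n : nat} (s : nat -> set 'rV[R]_n) (i : nat)
    : Type :=
  completion (inner_dist (slit_domain s i)) (slit_domain s i).

Definition tau {R : realType} {n : nat} (s : nat -> set 'rV[R]_n) {i j : nat}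
    (ij : (i <= j)%N) (P : Mbar s j) : Mbar s i :=
  completion_point
    (inner_cauchy_subset (slit_domain_subset s ij) (completion_repP P)).

Definition slit_space {R : realType} {n : nat} (s : nat -> set 'rV[R]_n)
    : Type :=
  {p : forall i, Mbar s i | forall i j (ij : (i <= j)%N), tau s ij (p j) = p i}.

Definition slit_dist {R : realType} {n : nat} (s : nat -> set 'rV[R]_n)
    (p q : slit_space s) : \bar R :=
  limn (fun i => completion_dist (sval p i) (sval q i)).

(* The inner metric of the (convex) box is Euclidean: a point of [Mbar s 0] is
   identified with the limit in R^n of a Cauchy sequence representing it. *)
Definition tau0 {R : realType} {n : nat} (s : nat -> set 'rV[R]_n.+1)
    (p : slit_space s) : 'rV[R]_n.+1 :=
  limn (completion_rep (sval p 0%N)).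

Definition outer_boundary {R : realType} {m : nat}
    (s : nat -> set 'rV[R]_m.+1) : set (slit_space s) :=
  tau0 s @^-1` box_boundary R m.+1.

(* Two copies of [slit_space s], labelled [false] and [true]; a point of the
   outer boundary, which belongs to both, is counted in the copy [false]. *)
Definition slit_double {R : realType} {m : nat} (s : nat -> set 'rV[R]_m.+1)
    : Type :=
  {x : bool * slit_space s | x.1 = true -> ~ outer_boundary s x.2}.

Definition double_dist {R : realType} {m : nat} (s : nat -> set 'rV[R]_m.+1)
    (x y : slit_double s) : \bar R :=
  if (sval x).1 == (sval y).1 then slit_dist s (sval x).2 (sval y).2
  else ereal_inf [set (slit_dist s (sval x).2 z + slit_dist s z (sval y).2)%E
                 | z in outer_boundary s].

Definition double_tau0 {R : realType} {m : nat} (s : nat -> set 'rV[R]_m.+1)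
    (x : slit_double s) : 'rV[R]_m.+1 :=
  tau0 s (sval x).2.

Definition slit_avoiding_curves {R : realType} {m : nat}
    (s : nat -> set 'rV[R]_m.+1) : set (R -> 'rV[R]_m.+1) :=
  [set gamma | [/\ is_curve eucl gamma,
     trace gamma `<=` box R m.+1 `\` \bigcup_i s i &
     connects eucl (box_left R m) (box_right R m) gamma]].

Definition projected_curves {R : realType} {m : nat}
    (s : nat -> set 'rV[R]_m.+1) : set (R -> 'rV[R]_m.+1) :=
  [set tau0 s \o gamma | gamma in
    [set gamma : R -> slit_space s | is_curve (slit_dist s) gamma /\
       connects (slit_dist s) (tau0 s @^-1` box_left R m)
         (tau0 s @^-1` box_right R m) gamma]].

Definition vertical {R : realType} {m : nat} {T : Type}
    (t0 : T -> 'rV[R]_m.+1) (gamma : R -> T) : Prop :=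
  exists c : R, forall t, t \in `]0, 1[ -> t0 (gamma t) 0 0 = c.

Definition nonvertical_curves {R : realType} {m : nat} {T : Type}
    (d : T -> T -> \bar R) (t0 : T -> 'rV[R]_m.+1) : set (R -> T) :=
  [set gamma | is_curve d gamma /\ ~ vertical t0 gamma].

(* Main.v *)
Require Import Defs.
From HB Require Import structures.
From mathcomp Require Import all_boot all_order all_algebra.
From mathcomp Require Import all_classical all_reals all_analysis measurable_realfun.
From mathcomp Require Import ring lra zify.

Import Order.TTheory GRing.Theory Num.Theory.
Import numFieldNormedType.Exports.

Local Open Scope classical_set_scope.
Local Open Scope ring_scope.

(** One density serves for every exponent and for all four families: on the points
    over a null set [A] of the cube it is a function of the first coordinate, and it
    vanishes elsewhere, so that all its powers have integral zero. The function
    ([wild]) is finite, Borel and so large that its integral over every interval is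
    infinite. What has to be shown is that every non-vertical curve spends, in the
    sense of arc length, enough time over [A].

    The set [A]. Since the [r_i] are not in l^n, for every [k] there are finitely
    many disjoint flat boxes, each around a flat plate contained in a slit, of
    height at most [4^-k], that cover the cube up to the proportion [4^-k]
    ([packing]): for boxes of a fixed relative height, a generation whose slits have
    relative size [r] can cover a proportion of order [r^n] of what is still free.
    [A] is the upper limit of the uncovered sets; by the Borel-Cantelli argument it
    is null ([limsup_uncovered_null]).

    The curves. For such a family of boxes, the folded coordinate is the first
    coordinate moved away from the plate by the height that is missing to leave the
    box. It differs from the first coordinate by at most [4^-k], it is continuous
    off the plates, and in each box (up to a narrow margin) it takes only two
    values, one above and one below the plate. As a curve cannot cross the slits,
    its folded coordinate is continuous, has speed at most 2 ([selection_speed]) and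
    stands still while the curve is in the covered part. Hence it changes at most by
    twice the length of the curve in the uncovered part, and letting [k] tend to
    infinity the first coordinate changes at most by twice the length of the curve
    over [A] ([lim_sup_variation]). So the values of the first coordinate in a closed
    set [K] cost at least half the measure of [K] in length spent over [A]
    ([image_measure_le]), and for a set [K] where [wild] is large compared with
    [1 / |K|] this bounds the line integral below by 1 ([detected_integral_ge1]).

    The slit space. As soon as the slits under a finite family of plates have been
    removed, the folded coordinate is Lipschitz for the inner distance
    ([folded_inner_dist]); it therefore extends to the completions, to the slit space
    and to the double, with the same properties ([lifted_folded_dist],
    [lifted_folded_core]). For the Borel-Cantelli argument the part of the slit space
    over a dyadic cell of side [2^-G] must have diameter of order [2^-G]: any two
    points of the cell off the slits are joined inside the cell by five segments
    that avoid the slits ([cell_inner_dist]). *)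

Set Implicit Arguments.
Unset Strict Implicit.
Unset Printing Implicit Defensive.

(** * Measure of continuous images on the line *)

Lemma le_lebesgue (R : realType) (A B : set R) :
  measurable A -> measurable B -> A `<=` B ->
  (lebesgue_measure A <= lebesgue_measure B)%E.
Proof. by move=> mA mB AB; apply: le_measure; rewrite ?inE. Qed.

(** The thickenings of a closed set decrease to it, so that continuity from above
    applies. *)
Lemma measure_thickening_small (R : realType) (S G : set R) (eps : R) :
  measurable S -> (lebesgue_measure S < +oo)%E -> closed G -> 0 < eps ->
  exists2 delta : R, 0 < delta &
    (lebesgue_measure (S `&` \bigcup_(g in G) ball g delta) <=
     lebesgue_measure (S `&` G) + eps%:E)%E.
Proof.
move=> mS fS cG e0.
pose F (n : nat) := S `&` \bigcup_(g in G) ball g n.+1%:R^-1.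
have oF n : open (\bigcup_(g in G) ball g (n.+1%:R^-1 : R)).
  by apply: bigcup_open => g _; exact: ball_open.
have mF n : measurable (F n).
  by apply: measurableI => //; exact: open_measurable.
have FE : \bigcap_n F n = S `&` G.
  apply/seteqP; split=> x; last first.
    move=> [Sx Gx] n _; split => //; exists x => //; apply: ballxx.
    by rewrite invr_gt0.
  move=> Fx; have [Sx _] := Fx 0%N I; split => //.
  apply: cG => B /nbhs_ballP[d /= d0 dB].
  have [n nd] : exists n : nat, n.+1%:R^-1 < d.
    by have [n] := ltr_add_invr d0; rewrite add0r => ?; exists n.
  have [_ [g Gg xg]] := Fx n I; exists g; split => //; apply: dB.
  by apply: ball_sym; apply: le_ball xg; exact: ltW.
have mSG : measurable (S `&` G) by apply: measurableI => //; exact: closed_measurable.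
have cv : lebesgue_measure \o F @ \oo --> lebesgue_measure (S `&` G).
  rewrite -FE; apply: nonincreasing_cvg_mu => //.
  - by apply: le_lt_trans fS; apply: le_lebesgue => // x [].
  - by rewrite FE.
  - move=> i j ij; apply/subsetPset => x [Sx [g Gg xg]]; split => //.
    exists g => //; apply: le_ball xg; rewrite lef_pV2 ?posrE// ler_nat//.
have fSG : lebesgue_measure (S `&` G) \is a fin_num.
  by rewrite ge0_fin_numE//; apply: le_lt_trans fS; apply: le_lebesgue => // x [].
have /cv : nbhs (lebesgue_measure (S `&` G))
    [set x | (x < lebesgue_measure (S `&` G) + eps%:E)%E].
  rewrite -(fineK fSG) -EFinD.
  apply: (open_nbhs_nbhs (p := (fine (lebesgue_measure (S `&` G)))%:E)).
  split; first exact: open_ereal_lt_ereal.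
  by rewrite /= lte_fin ltrDl.
move=> [n _ /(_ n (leqnn n))/= Fn].
exists n.+1%:R^-1; first by rewrite invr_gt0.
exact: ltW.
Qed.

Definition gridpt {R : realType} (a b : R) (N i : nat) : R :=
  a + (b - a) / N%:R * i%:R.

Definition touches {R : realType} (G : set R) (a b : R) : bool :=
  `[< exists2 g, G g & a <= g <= b >].

Lemma gridpt0 (R : realType) (a b : R) N : gridpt a b N 0 = a.
Proof. by rewrite /gridpt mulr0 addr0. Qed.

Lemma gridptN (R : realType) (a b : R) N : (0 < N)%N -> gridpt a b N N = b.
Proof.
by move=> N0; rewrite /gridpt divfK ?pnatr_eq0 -?lt0n// addrC subrK.
Qed.

Lemma gridpt_mono (R : realType) (a b : R) N i j : a <= b -> (i <= j)%N ->
  gridpt a b N i <= gridpt a b N j.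
Proof.
move=> ab ij; rewrite /gridpt lerD2l ler_wpM2l ?ler_nat//.
by rewrite divr_ge0 ?subr_ge0.
Qed.

Lemma gridptS (R : realType) (a b : R) N i :
  gridpt a b N i.+1 - gridpt a b N i = (b - a) / N%:R.
Proof. by rewrite /gridpt -natr1; ring. Qed.

Lemma gridpt_itv (R : realType) (a b : R) N i : (0 < N)%N -> a <= b ->
  (i <= N)%N -> a <= gridpt a b N i <= b.
Proof.
move=> N0 ab iN; have := gridpt_mono N ab (leq0n i).
by have := gridpt_mono N ab iN; rewrite gridpt0 gridptN// => -> ->.
Qed.

(** A cell shorter than [delta] that meets [G] lies in the [delta]-thickening of
    [G]. *)
Lemma touched_cells_measure (R : realType) (S G : set R) (a b eps : R) :
  measurable S -> closed G -> a <= b -> 0 < eps ->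
  exists2 N : nat, (0 < N)%N &
    (\sum_(i < N | touches G (gridpt a b N i) (gridpt a b N i.+1))
       lebesgue_measure (S `&` `]gridpt a b N i, gridpt a b N i.+1]) <=
     lebesgue_measure (S `&` `]a, b] `&` G) + eps%:E)%E.
Proof.
move=> mS cG ab e0.
have mSab : measurable (S `&` `]a, b]) by exact: measurableI.
have fSab : (lebesgue_measure (S `&` `]a, b]) < +oo)%E.
  apply: (@le_lt_trans _ _ (lebesgue_measure (`]a, b] : set R))).
    by apply: le_lebesgue => // x [].
  by rewrite lebesgue_measure_itv/=; case: ifP => _; rewrite ?ltry// ltry.
have [d d0 dle] := measure_thickening_small mSab fSab cG e0.
pose N := (Num.truncn ((b - a) / d)).+1.
have N0 : (0 < N)%N by [].
have Nd : (b - a) / N%:R < d.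
  rewrite ltr_pdivrMr ?ltr0n// mulrC -ltr_pdivrMr//.
  by rewrite /N truncnS_gt.
exists N => //; apply: le_trans dle.
pose t := gridpt a b N.
pose F (i : nat) := if (i < N)%N && touches G (t i) (t i.+1)
  then S `&` `]t i, t i.+1] else set0.
have mF i : measurable (F i) by rewrite /F; case: ifP => // _; exact: measurableI.
have tF : trivIset setT F.
  apply/trivIsetP => i j _ _; wlog ij : i j / (i < j)%N.
    move=> H; rewrite neq_ltn => /orP[ij|ji]; first by apply: H => //; rewrite neq_ltn ij.
    by rewrite setIC; apply: H => //; rewrite neq_ltn ji.
  move=> _; rewrite /F; case: ifP => _; last by rewrite set0I.
  case: ifP => _; last by rewrite setI0.
  apply/seteqP; split => // x [[_ /=]]; rewrite in_itv/= => /andP[_ xi].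
  move=> [_ /=]; rewrite in_itv/= => /andP[xj _].
  have := gridpt_mono N ab ij; rewrite -/(t _) -/(t _) => tt.
  by have := lt_le_trans xj (le_trans xi tt); rewrite ltxx.
have -> : (\sum_(i < N | touches G (gridpt a b N i) (gridpt a b N i.+1))
       lebesgue_measure (S `&` `]gridpt a b N i, gridpt a b N i.+1]) =
   lebesgue_measure (\big[setU/set0]_(i < N) F i))%E.
  rewrite (measure_bigsetU lebesgue_measure mF tF) big_mkcond/=.
  apply: eq_bigr => i _; rewrite /F ltn_ord/= -/(t _) -/(t _).
  by case: ifP => // _; rewrite measure0.
apply: le_lebesgue.
- by rewrite -bigcup_mkord; apply: bigcup_measurable => i _.
- apply: measurableI => //; apply: open_measurable.
  by apply: bigcup_open => g _; exact: ball_open.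
rewrite -bigcup_mkord => x [i /= iN]; rewrite /F iN/=.
case: ifP => // /asboolP[g Gg /andP[ig gi]] [Sx /=].
rewrite in_itv/= => /andP[ix xi].
have /andP[ai _] := gridpt_itv N0 ab (ltnW iN).
have /andP[_ ib] := gridpt_itv N0 ab iN.
split; first split => //=.
  by rewrite in_itv/= (le_lt_trans ai ix) (le_trans xi ib).
exists g => //; rewrite /ball/= ltr_norml.
have tS := gridptS a b N i; rewrite -/(t i) -/(t i.+1) in tS.
by move: Nd; rewrite -tS; lra.
Qed.

(** Only the grid cells that meet [e] contribute to the increment of [V], and
    together they are little longer than [e]. *)
Lemma variation_le_closed (R : realType) (V : R -> R) (L a b : R) (e : set R) :
  closed e -> a <= b -> 0 <= L ->
  (forall x y, a <= x -> x <= y -> y <= b -> `|V y - V x| <= L * (y - x)) ->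
  (forall x y, a <= x -> x <= y -> y <= b ->
     (forall z, x <= z <= y -> ~ e z) -> V x = V y) ->
  (`|V b - V a|%:E <= L%:E * lebesgue_measure (`]a, b] `&` e))%E.
Proof.
move=> ce ab L0 VL Vc; apply/lee_addgt0Pr => eps e0.
have e1 : 0 < eps / (L + 1) by rewrite divr_gt0// ltr_wpDl.
have [N N0 HN] := touched_cells_measure (@measurableT _ R) ce ab e1.
pose t := gridpt a b N.
have -> : V b - V a = \sum_(0 <= i < N) (V (t i.+1) - V (t i)).
  by rewrite (telescope_sumr (fun i => V (t i)))// /t gridpt0 gridptN.
apply: (@le_trans _ _ (\sum_(i < N | touches e (t i) (t i.+1))
   (L%:E * lebesgue_measure ([set: R] `&` `]t i, t i.+1])))%E).
  rewrite big_mkord.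
  apply: (@le_trans _ _ (\sum_(i < N) `|V (t i.+1) - V (t i)|)%:E).
    by rewrite lee_fin; exact: ler_norm_sum.
  rewrite -sumEFin [leRHS]big_mkcond/=; apply: lee_sum => i _.
  have tt : t i <= t i.+1 by exact: gridpt_mono.
  have /andP[ai _] := gridpt_itv N0 ab (ltnW (ltn_ord i)).
  have /andP[_ ib] := gridpt_itv N0 ab (ltn_ord i).
  case: ifPn => [_|/asboolPn nt].
    rewrite setTI lebesgue_measure_itv/= lte_fin; case: ltP => [_|tt'].
      by rewrite -EFinB -EFinM lee_fin VL.
    by have -> : t i.+1 = t i; [apply/eqP; rewrite eq_le tt tt'|rewrite subrr normr0 mule0].
  rewrite (Vc (t i) (t i.+1))// ?subrr ?normr0// => z tz ez.
  by apply: nt; exists z.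
rewrite -ge0_sume_distrr//.
apply: le_trans (_ : _ <= L%:E * (lebesgue_measure (`]a, b] `&` e) + (eps / (L + 1))%:E))%E _.
  by apply: lee_wpmul2l; rewrite ?lee_fin// -[X in lebesgue_measure (X `&` _)]setTI.
rewrite ge0_muleDr//; last by rewrite lee_fin ltW.
rewrite leeD2l// -EFinM lee_fin.
rewrite mulrCA -[leRHS]mulr1 ler_wpM2l ?(ltW e0)//.
by rewrite ler_pdivrMr ?ltr_wpDl// mul1r lerDl.
Qed.

(** The image of a grid cell is an interval no longer than the mass of [e] in
    that cell, so the image covers no more than the mass of [e] over [K]. *)
Lemma image_measure_le (R : realType) (f : R -> R) (L l : R) (e K : set R) :
  0 <= l -> 0 <= L -> continuous f -> measurable e ->
  (forall a b, 0 <= a -> a <= b -> b <= l ->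
    (`|f b - f a|%:E <= L%:E * lebesgue_measure (`]a, b] `&` e))%E) ->
  closed K -> K `<=` f @` `[0, l] ->
  (lebesgue_measure K <=
   L%:E * lebesgue_measure (e `&` `]0%R, l] `&` f @^-1` K))%E.
Proof.
move=> l0 L0 cf me fe cK Kf; apply/lee_addgt0Pr => eps e0.
have e1 : 0 < eps / (L + 1) by rewrite divr_gt0// ltr_wpDl.
have cG : closed (f @^-1` K) by apply: preimage_closed => // x _; exact: cf.
have [N N0 HN] := touched_cells_measure me cG l0 e1.
pose t := gridpt 0 l N.
have tt i : t i <= t i.+1 by exact: gridpt_mono.
have fcell (i : 'I_N) : exists m M : R, [/\ m <= M,
    f @` `[t i, t i.+1] `<=` `[m, M] &
    ((M - m)%:E <= L%:E * lebesgue_measure (e `&` `]t i, t i.+1]))%E].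
  have cw : {within `[t i, t i.+1], continuous f} by exact: continuous_subspaceT.
  have [x xt fx] := EVT_min (tt i) cw.
  have [y yt fy] := EVT_max (tt i) cw.
  exists (f x), (f y); split; first exact: fx.
    by move=> _ [z zt <-]; rewrite /= in_itv/= fx// fy.
  have /andP[ti0 _] := gridpt_itv N0 l0 (ltnW (ltn_ord i)).
  have /andP[_ til] := gridpt_itv N0 l0 (ltn_ord i).
  move: xt yt; rewrite !in_itv/= -/(t _) => /andP[x1 x2] /andP[y1 y2].
  rewrite -/(t _) in ti0; rewrite -/(t _) in til.
  have H a b : t i <= a -> a <= b -> b <= t i.+1 -> (`|f b - f a|%:E <=
      L%:E * lebesgue_measure (e `&` `]t i, t i.+1]))%E.
    move=> ta ab bt; apply: (le_trans (fe a b (le_trans ti0 ta) ab (le_trans bt til))).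
    apply: lee_wpmul2l; rewrite ?lee_fin//; apply: le_lebesgue.
    - exact: measurableI.
    - exact: measurableI.
    - move=> z [/=]; rewrite in_itv/= => /andP[az zb] ez; split => //=.
      by rewrite in_itv/= (le_lt_trans ta az) (le_trans zb bt).
  apply: (@le_trans _ _ `|f y - f x|%:E); first by rewrite lee_fin ler_norm.
  by case: (leP x y) => [xy|/ltW yx]; [|rewrite distrC]; exact: H.
have [m Hm] := choice fcell.
have {Hm} [M HM] := choice Hm.
pose F (i : nat) : set R := if insub i is Some j then
   (if touches (f @^-1` K) (t i) (t i.+1) then `[m j, M j]%classic else set0) else set0.
have mF i : measurable (F i) by rewrite /F; case: insubP => // j _ _; case: ifP.
apply: (@le_trans _ _ (\sum_(i < N) lebesgue_measure (F i))%E).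
  apply: (content_subadditive lebesgue_measure (fun k _ => mF k) (closed_measurable cK)).
  move=> y Ky; have [x xl fx] := Kf _ Ky; move: xl => /=; rewrite in_itv/= => /andP[x0 xl].
  rewrite -bigcup_mkord.
  have [i iN xi] : exists2 i : nat, (i < N)%N & t i <= x <= t i.+1.
    have : exists i, (i < N)%N && (x <= t i.+1).
      exists N.-1; rewrite prednK// leqnn/= /t gridptN//.
    move=> /ex_minnP[i /andP[iN xi] imin]; exists i => //; rewrite xi andbT.
    case: i iN xi imin => [_ _ _|i iN xi imin]; first by rewrite /t gridpt0.
    rewrite leNgt; apply/negP => xt.
    by have := imin i; rewrite (ltW xt) (ltnW iN)/= ltnn => /(_ isT).
  exists i => //; rewrite /F insubT/=.
  case: ifPn => [_|/asboolPn]; last first.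
    by case; exists x => //=; rewrite fx.
  have [_ + _] := HM (Ordinal iN); apply; exists x => //=.
apply: (@le_trans _ _ (\sum_(i < N | touches (f @^-1` K) (t i) (t i.+1))
  (L%:E * lebesgue_measure (e `&` `]t i, t i.+1])))%E).
  rewrite [leRHS]big_mkcond/=; apply: lee_sum => i _.
  have [mM _ Mm] := HM i.
  rewrite /F insubT//= => ?; rewrite (_ : Sub _ _ = i); last exact/val_inj.
  case: ifP => _; last by rewrite measure0.
  rewrite lebesgue_measure_itv/= lte_fin; case: ltP => [_|]; first exact: Mm.
  by rewrite mule_ge0// lee_fin.
rewrite -ge0_sume_distrr//.
apply: le_trans (lee_wpmul2l _ HN) _; rewrite ?lee_fin//.
rewrite ge0_muleDr//; last by rewrite lee_fin ltW.
rewrite leeD2l// -EFinM lee_fin.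
rewrite mulrCA -[leRHS]mulr1 ler_wpM2l ?(ltW e0)//.
by rewrite ler_pdivrMr ?ltr_wpDl// mul1r lerDl.
Qed.

(** [f] is the uniform limit of the [V k], each of which varies only on [e k]; the
    bounds pass to the limit by continuity of the measure along the decreasing
    unions of the [e k]. *)
Lemma lim_sup_variation (R : realType) (f : R -> R) (V : nat -> R -> R)
    (h : nat -> R) (L a b : R) (e : nat -> set R) :
  a <= b -> 0 <= L -> h @ \oo --> (0 : R) ->
  (forall k, closed (e k)) ->
  (forall k x, `|V k x - f x| <= h k) ->
  (forall k x y, x <= y -> `|V k y - V k x| <= L * (y - x)) ->
  (forall k x y, x <= y -> (forall z, x <= z <= y -> ~ e k z) -> V k x = V k y) ->
  (`|f b - f a|%:E <= L%:E * lebesgue_measure (`]a, b] `&` lim_sup_set e))%E.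
Proof.
move=> ab L0 h0 ce Vf VL Vc.
pose F k := `]a, b]%classic `&` e k.
have mF k : measurable (F k) by apply: measurableI => //; exact: closed_measurable.
have FE : `]a, b] `&` lim_sup_set e = lim_sup_set F.
  apply/seteqP; split => x.
    by move=> [xab xe] n _; have [k nk ek] := xe n I; exists k.
  move=> xF; split; first by have [k _ [+ _]] := xF 0%N I.
  by move=> n _; have [k nk [_ ek]] := xF n I; exists k.
have mU n : measurable (\bigcup_(k >= n) F k) by exact: bigcup_measurable.
have Ufin : (lebesgue_measure (\bigcup_(k >= 0) F k) < +oo)%E.
  apply: (@le_lt_trans _ _ (lebesgue_measure (`]a, b] : set R))).
    by apply: le_lebesgue => // x [k _ []].
  by rewrite lebesgue_measure_itv/=; case: ifP => _; rewrite ?ltry// ltry.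
have cv := lim_sup_set_cvg lebesgue_measure F mF Ufin.
rewrite FE.
have cv2 : (fun n => L%:E * lebesgue_measure (\bigcup_(k >= n) F k) +
    (h n + h n)%:E)%E @ \oo --> (L%:E * lebesgue_measure (lim_sup_set F) + 0%:E)%E.
  apply: cvgeD.
  - by rewrite fin_num_adde_defl.
  - by apply: cvgeZl => //.
  - apply: cvg_EFin; first by near=> n.
    by rewrite -[0 in X in _ --> X]addr0; apply: cvgD.
rewrite -[leRHS]adde0 -(cvg_lim _ cv2)//.
apply: lime_ge; first by apply/cvg_ex; eexists; exact: cv2.
apply: nearW => n.
have H1 := variation_le_closed (ce n) ab L0 (fun x y _ xy _ => VL n x y xy)
  (fun x y _ xy _ => Vc n x y xy).
apply: (@le_trans _ _ (`|V n b - V n a|%:E + (h n + h n)%:E)%E).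
  rewrite -EFinD lee_fin; move: (Vf n a) (Vf n b) => Ha Hb.
  rewrite [leLHS](_ : _ = `|(V n b - V n a) + ((V n a - f a) - (V n b - f b))|).
    apply: le_trans (ler_normD _ _) _; rewrite lerD2l.
    by apply: le_trans (ler_normB _ _) _; exact: lerD.
  by congr (`| _ |); ring.
apply: leeD2r; apply: le_trans H1 _.
apply: lee_wpmul2l; rewrite ?lee_fin//; apply: le_lebesgue => //; first exact: mF.
by move=> x Fx; exists n => /=.
Unshelve. all: by end_near. Qed.

(** * A finite function that is nowhere integrable *)

(** Every interval of the line contains some of these intervals with rational ends. *)
Definition rat_gap {R : realType} (k : nat) : R * R :=
  if unpickle k is Some pq then (ratr (pq : rat * rat).1, ratr pq.2) else (0, 0).

Definition gap_width {R : realType} (k : nat) : R :=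
  Num.max 0 (Num.min ((@rat_gap R k).2 - (@rat_gap R k).1) 1) / (2 ^ k.+1)%:R.

Definition gap_set {R : realType} (k : nat) : set R :=
  `](rat_gap k).1, (rat_gap k).1 + gap_width k[%classic.

(** Each interval [gap_set k] carries a height inversely proportional to its width,
    hence a mass that does not depend on the width. The widths are summable, so
    that almost every point lies in finitely many of these intervals; at the other
    points the series may diverge, and [fine] gives the value [0]. *)
Definition wild {R : realType} (x : R) : R :=
  fine (\sum_(k <oo) (8 / gap_width k * \1_(gap_set k) x)%:E)%E.

Lemma gap_width_ge0 (R : realType) k : 0 <= gap_width k :> R.
Proof. by rewrite divr_ge0// le_max lexx. Qed.

Lemma gap_width_le (R : realType) k : gap_width k <= 1 / (2 ^ k.+1)%:R :> R.
Proof. by rewrite ler_wpM2r// ge_max ler01 ge_min lexx orbT. Qed.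

Lemma gap_set_measure (R : realType) k :
  lebesgue_measure (gap_set k : set R) = (gap_width k)%:E.
Proof.
rewrite /gap_set lebesgue_measure_itv/= lte_fin ltrDl.
case: ltP => [_|w0]; first by rewrite -EFinB addrC addKr.
by have := gap_width_ge0 R k; move=> /(conj w0)/andP/le_anti->.
Qed.

Lemma wild_term_ge0 (R : realType) (x : R) k :
  (0 <= (8 / (gap_width k : R) * \1_(gap_set k) x)%:E)%E.
Proof. by rewrite lee_fin mulr_ge0// divr_ge0// gap_width_ge0. Qed.

Lemma wild_ge0 (R : realType) (x : R) : 0 <= wild x.
Proof. by rewrite fine_ge0// nneseries_ge0// => k _ _; exact: wild_term_ge0. Qed.

Lemma measurable_wild (R : realType) : measurable_fun setT (@wild R).
Proof.
apply: (measurableT_comp (f := fine)); first exact: fine_measurable.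
apply: ge0_emeasurable_sum => [k x _ _|k _]; first exact: wild_term_ge0.
apply/measurable_EFinP; apply: measurable_funM; first exact: measurable_cst.
apply: measurable_indic; exact: measurable_itv.
Qed.

Lemma wild_ge (R : realType) (x : R) k :
  ~ lim_sup_set gap_set x -> gap_set k x -> 8 / gap_width k <= wild x.
Proof.
move=> nx kx.
have [n Hn] : exists n, forall j, (n <= j)%N -> ~ gap_set j x.
  apply/not_existsP => H; apply: nx => n _; apply: contrapT => nn.
  by apply: (H n) => j nj jx; apply: nn; exists j.
have t0 j (_ : (0 <= j)%N) : xpredT j ->
  (0 <= (8 / (gap_width j : R) * \1_(gap_set j) x)%:E)%E by move=> _; exact: wild_term_ge0.
have Sf : (\sum_(k <oo) (8 / (gap_width k : R) * \1_(gap_set k) x)%:E < +oo)%E.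
  rewrite (nneseries_split 0 n)//; last by move=> j _; exact: wild_term_ge0.
  rewrite add0n sumEFin eseries0 ?adde0 ?ltry// => j nj _.
  by rewrite indicE memNset ?mulr0//; exact: Hn.
rewrite -[leLHS]/(fine (8 / gap_width k)%:E) fine_le//.
  by rewrite ge0_fin_numE// nneseries_ge0.
apply: le_trans (nneseries_lim_ge k.+1 t0).
rewrite big_nat_recr//= indicE mem_set// mulr1 leeDr// sume_ge0// => j _.
exact: wild_term_ge0.
Qed.

Lemma gap_lim_sup_null (R : realType) :
  lebesgue_measure (lim_sup_set (@gap_set R)) = 0%E.
Proof.
apply: lim_sup_set_cvg0 => [k|]; first exact: measurable_itv.
apply: (@le_lt_trans _ _ (\sum_(k <oo) (1 / (2 ^ k.+1)%:R)%:E)%E).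
  apply: lee_nneseries => // k _.
  by rewrite -[leLHS]/(lebesgue_measure (gap_set k)) gap_set_measure lee_fin gap_width_le.
by apply: le_lt_trans (epsilon_trick0 xpredT ler01) _; rewrite ltry.
Qed.

(** Choose a gap inside the interval. Without the null set of points that lie in
    infinitely many gaps, it contains by inner regularity a closed set of half its
    measure. That [wild] is at least [c] on a set of measure of order [1 / c]
    is the form of non-integrability that the line integrals need. *)
Lemma wild_large (R : realType) (a b : R) : a < b ->
  exists (c : R) (K : set R), [/\ 0 < c, closed K, K `<=` `]a, b[,
    (forall x, K x -> c <= wild x) & (4%:E <= c%:E * lebesgue_measure K)%E].
Proof.
move=> ab.
have [p pab] := rat_in_itvoo ab.
have pb : ratr p < b by move: pab; rewrite in_itv/= => /andP[].
have [q qpb] := rat_in_itvoo pb.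
move: pab qpb; rewrite !in_itv/= => /andP[ap _] /andP[pq qb].
pose k := pickle (p, q).
have gk : @rat_gap R k = (ratr p, ratr q) by rewrite /rat_gap /k pickleK.
pose w : R := gap_width k.
have w0 : 0 < w.
  rewrite /w /gap_width gk/= divr_gt0// ?ltr0n ?expn_gt0//.
  by rewrite lt_max lt_min ltr01 subr_gt0 pq orbT.
have wpq : ratr p + w <= ratr q.
  rewrite addrC -lerBrDr /w /gap_width gk/= ler_pdivrMr ?ltr0n ?expn_gt0//.
  rewrite ge_max; apply/andP; split.
    by rewrite mulr_ge0// subr_ge0 ltW.
  rewrite ge_min ler_peMr// ?subr_ge0 ?(ltW pq)//.
  by rewrite (ler_nat _ 1%N) expn_gt0.
pose Z := lim_sup_set (@gap_set R).
have mZ : measurable Z.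
  by apply: bigcap_measurable => // n _; apply: bigcup_measurable => j _; exact: measurable_itv.
have mD : measurable (gap_set k `\` Z) by apply: measurableD => //; exact: measurable_itv.
have DE : lebesgue_measure (gap_set k `\` Z) = w%:E.
  rewrite -[RHS](gap_set_measure R k); apply/eqP; rewrite eq_le; apply/andP; split.
    by apply: le_measure; rewrite ?inE//; exact: measurable_itv.
  rewrite -[leRHS]adde0 -(gap_lim_sup_null R).
  apply: le_trans (measureU2 lebesgue_measure mD mZ).
  apply: le_measure; rewrite ?inE//; [exact: measurable_itv|exact: measurableU|].
  by move=> x kx; have [xZ|xZ] := pselect (Z x); [right|left].
have Dfin : (lebesgue_measure (gap_set k `\` Z) < +oo)%E by rewrite DE ltry.
have w2 : 0 < w / 2 by rewrite divr_gt0.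
have [K [cK KD Kw]] := lebesgue_regularity_inner mD Dfin w2.
have clK : closed K by apply: compact_closed => //; exact: Rhausdorff.
have mK : measurable K by exact: closed_measurable.
exists (8 / w), K; split => //.
- by rewrite divr_gt0.
- move=> x /KD[]; rewrite /gap_set gk/= in_itv/= => /andP[px xw] _.
  by rewrite in_itv/= (lt_trans ap px) (lt_trans (lt_le_trans xw wpq) qb).
- by move=> x /KD[kx xZ]; exact: wild_ge.
have : (w%:E <= lebesgue_measure K + (w / 2)%:E)%E.
  rewrite -DE; apply: (@le_trans _ _
    (lebesgue_measure K + lebesgue_measure ((gap_set k `\` Z) `\` K))%E).
    apply: le_trans (measureU2 lebesgue_measure mK _); last exact: measurableD.
    apply: le_measure; rewrite ?inE//; first by apply: measurableU => //; exact: measurableD.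
    by move=> x Dx; have [xK|xK] := pselect (K x); [left|right].
  by rewrite leeD2l// ltW.
have Kfin : lebesgue_measure K \is a fin_num.
  rewrite ge0_fin_numE//; apply: le_lt_trans Dfin.
  by apply: le_measure; rewrite ?inE.
rewrite -(fineK Kfin) -EFinD -EFinM !lee_fin => H.
have -> : 4 = 8 / w * (w / 2) :> R by field; rewrite gt_eqF.
apply: ler_wpM2l; first by rewrite divr_ge0 ?(ltW w0).
by rewrite [leLHS](_ : _ = w - w / 2) ?lerBlDr//; field.
Qed.

(** * Arc length *)

Lemma le_ereal_supD (R : realType) (A : set (\bar R)) (c B : \bar R) :
  A !=set0 -> (forall x, A x -> 0 <= x)%E -> (0 <= c)%E ->
  (forall x, A x -> x + c <= B)%E -> (ereal_sup A + c <= B)%E.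
Proof.
move=> [x Ax] A0 c0 AB.
have := AB x Ax; have := A0 x Ax => x0.
case: B AB => [B||] AB; last 2 first.
- by move=> _; rewrite leey.
- by rewrite leeNy_eq => /eqP xc; have := adde_ge0 x0 c0; rewrite xc.
move=> xcB.
have cf : c \is a fin_num.
  rewrite ge0_fin_numE//; apply: (@le_lt_trans _ _ B%:E); last by rewrite ltry.
  by apply: le_trans xcB; rewrite leeDr.
rewrite -leeBrDr//; apply: ge_ereal_sup => y Ay.
by rewrite leeBrDr//; exact: AB.
Qed.

Section curve_length.
Context {R : realType} {T : Type} (d : T -> T -> \bar R) (gamma : R -> T).
Hypothesis d_ge0 : forall x y, (0 <= d x y)%E.

Lemma curve_length_ge0 a b : a <= b -> (0 <= curve_length d gamma a b)%E.
Proof.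
rewrite le_eqVlt => /predU1P[<-|ab]; apply: ereal_sup_ge.
  exists (\sum_(i < size ([::] : seq R)) 0)%E; last by rewrite big_ord0.
  by exists [::]; [split => //=|rewrite !big_ord0].
eexists; first by exists [:: b]; [exact: itv_partition1|reflexivity].
by rewrite sume_ge0.
Qed.

Lemma curve_length_append a t t' : a <= t -> t < t' ->
  (curve_length d gamma a t + d (gamma t) (gamma t') <=
   curve_length d gamma a t')%E.
Proof.
move=> at_ tt; apply: le_ereal_supD => //.
- move: at_; rewrite le_eqVlt => /predU1P[<-|at_].
    by eexists; exists [::] => //; split => //=.
  by eexists; exists [:: t] => //; exact: itv_partition1.
- by move=> _ [s _ <-]; rewrite sume_ge0.
move=> _ [s [ps /eqP ls] <-]; apply: ereal_sup_ubound.
exists (rcons s t'); first by split; rewrite ?rcons_path ?ps ?ls ?last_rcons.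
rewrite size_rcons big_ord_recr/=; congr (_ + _)%E.
  apply: eq_bigr => i _; rewrite -rcons_cons !nth_rcons/= ltnS (ltnW (ltn_ord i)).
  rewrite ltn_ord (set_nth_default t t')//= ?ltnS ?(ltnW (ltn_ord i))//.
  by rewrite (set_nth_default t t' (s := s)).
rewrite -rcons_cons nth_rcons/= ltnSn.
rewrite nth_rcons ltnn eqxx; congr (d (gamma _) _).
by rewrite -ls (last_nth t').
Qed.

Lemma curve_length_le_majorant (s : R -> R) a b : a <= b ->
  (forall x y, a <= x -> x <= y -> y <= b ->
     (d (gamma x) (gamma y) <= (s y - s x)%:E)%E) ->
  (curve_length d gamma a b <= (s b - s a)%:E)%E.
Proof.
move=> ab ds; apply: ge_ereal_sup => _ [t tp <-].
pose F i := nth b (a :: t) i.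
have -> : s b - s a = \sum_(0 <= i < size t) (s (F i.+1) - s (F i)).
  rewrite (telescope_sumr (fun i => s (F i)))//.
  by rewrite /F (itv_partition_nth_size b tp).
rewrite big_mkord -sumEFin; apply: lee_sum => i _; apply: ds.
- by apply: itv_partition_nth_ge tp; rewrite ltnS ltnW.
- have := @nondecreasing_fun_itv_partition _ R a b idfun t.
  move=> /(_ _ tp i (ltn_ord i)); apply; exact: in2W.
- by apply: itv_partition_nth_le tp; rewrite ltnS.
Qed.

End curve_length.

(** The epsilon-delta form avoids the subspace topology of [`[a, b]]. *)
Definition econt {R : realType} (a b : R) (w : R -> R) : Prop :=
  forall t e, a <= t <= b -> 0 < e -> exists2 del, 0 < del &
    forall t', a <= t' <= b -> `|t - t'| < del -> `|w t - w t'| < e.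

Lemma econt_within (R : realType) (a b : R) (w : R -> R) :
  econt a b w -> {within `[a, b], continuous w}.
Proof.
move=> cw; apply/subspace_continuousP => x /=; rewrite in_itv/= => xab.
apply/cvgrPdist_lt => e e0; have [del d0 H] := cw x e xab e0.
apply/nbhs_ballP; exists del => //= t xt; rewrite in_itv/= => tab; exact: H.
Qed.

Lemma econtD (R : realType) (a b : R) (v w : R -> R) :
  econt a b v -> econt a b w -> econt a b (v \+ w).
Proof.
move=> cv cw t e tab e0; have e2 : 0 < e / 2 by rewrite divr_gt0.
have [d1 d10 H1] := cv t _ tab e2; have [d2 d20 H2] := cw t _ tab e2.
exists (Num.min d1 d2); first by rewrite lt_min d10.
move=> t' tab'; rewrite lt_min => /andP[/(H1 _ tab') h1 /(H2 _ tab') h2] /=.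
rewrite (_ : _ - _ = (v t - v t') + (w t - w t')); last by ring.
by apply: le_lt_trans (ler_normD _ _) _; rewrite (splitr e) ltrD.
Qed.

Lemma econtN (R : realType) (a b : R) (w : R -> R) :
  econt a b w -> econt a b (\- w).
Proof.
move=> cw t e tab e0; have [del d0 H] := cw t e tab e0.
by exists del => // t' tab' /(H _ tab'); rewrite /= -opprD normrN.
Qed.

(** A continuous selection [U] of the two branches [X + P] and [X - P] can change
    branch only at a time where they meet, that is where [P] vanishes; before and
    after that time the speeds of [X] and [P] add up. *)
Lemma selection_speed (R : realType) (a b : R) (s X P U : R -> R) :
  econt a b X -> econt a b U ->
  (forall t, a <= t <= b -> `|U t - X t| = P t) ->
  (forall t t', a <= t -> t <= t' -> t' <= b ->
     `|X t' - X t| <= s t' - s t /\ `|P t' - P t| <= s t' - s t) ->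
  forall t t', a <= t -> t <= t' -> t' <= b ->
     `|U t' - U t| <= 2 * (s t' - s t).
Proof.
move=> cX cU UX XP t t' at_ tt t'b.
have br u : a <= u <= b -> U u = X u + P u \/ U u = X u - P u.
  move=> /UX; case: (ler0P (U u - X u)) => _ E; [right|left]; lra.
have tab : a <= t <= b by rewrite at_ (le_trans tt).
have tab' : a <= t' <= b by rewrite t'b (le_trans at_).
have P0 u : a <= u <= b -> 0 <= P u by move=> /UX <-.
have H u v : a <= u -> u <= v -> v <= b ->
    [/\ X v - X u <= s v - s u, X u - X v <= s v - s u,
        P v - P u <= s v - s u & P u - P v <= s v - s u].
  move=> au uv vb; have [+ +] := XP u v au uv vb.
  by rewrite !ler_norml => /andP[? ?] /andP[? ?]; split; lra.
have [X1 X2 P1 P2] := H t t' at_ tt t'b.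
have cross : Num.min (U t - X t) (U t' - X t') <= 0 <= Num.max (U t - X t) (U t' - X t') ->
    exists u, [/\ t <= u, u <= t' & U u = X u].
  move=> H0; have cUX : econt t t' (U \- X).
    have := econtD cU (econtN cX) => c u e /andP[tu ut] e0.
    have [|del d0 Hd] := c u e _ e0; first by rewrite (le_trans at_)// (le_trans ut).
    exists del => // v /andP[tv vt]; apply: Hd.
    by rewrite (le_trans at_)// (le_trans vt).
  have [u] := IVT tt (econt_within cUX) H0.
  by rewrite in_itv/= => /andP[tu ut] /eqP; rewrite subr_eq0 => /eqP ?; exists u.
have close : (exists u, [/\ t <= u, u <= t' & U u = X u]) ->
    `|U t' - U t| <= 2 * (s t' - s t).
  move=> [u [tu ut UXu]].
  have uab : a <= u <= b by rewrite (le_trans at_)// (le_trans ut).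
  have Pu : P u = 0 by rewrite -UX// UXu subrr normr0.
  have au := le_trans at_ tu; have ub := le_trans ut t'b.
  have [A1 A2 A3 A4] := H t u at_ tu ub.
  have [B1 B2 B3 B4] := H u t' au ut t'b.
  rewrite Pu in A3 A4 B3 B4.
  by rewrite ler_norml; case: (br t tab) => ->; case: (br t' tab') => ->; apply/andP; split; lra.
have := P0 t tab; have := P0 t' tab'.
case: (br t tab) => Et; case: (br t' tab') => Et' p' p.
- by rewrite ler_norml Et Et'; apply/andP; split; lra.
- apply: close; apply: cross; rewrite Et Et' ge_min le_max.
  by apply/andP; split; apply/orP; [right|left]; lra.
- apply: close; apply: cross; rewrite Et Et' ge_min le_max.
  by apply/andP; split; apply/orP; [left|right]; lra.
- by rewrite ler_norml Et Et'; apply/andP; split; lra.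
Qed.

Section arc_length.
Context {R : realType} (a b : R) (s : R -> R).
Hypothesis ab : a <= b.
Hypothesis s_nd : forall t t', a <= t -> t <= t' -> t' <= b -> s t <= s t'.
Hypothesis s_a : s a = 0.

(** The first time at which the length function [s] reaches [u]; as [s] is not
    supposed to be continuous, it may exceed [u] there. *)
Definition arc_time (u : R) : R := inf [set t | a <= t <= b /\ u <= s t].

Lemma arc_time_itv u : u <= s b -> a <= arc_time u <= b.
Proof.
move=> ub; have Eb : [set t | a <= t <= b /\ u <= s t] b by split; rewrite ?ab ?lexx.
apply/andP; split; first by apply: lb_le_inf; [exists b|move=> t [/andP[]]].
by apply: ge_inf => //; exists a => t [/andP[]].
Qed.

Lemma arc_time_lt u t : a <= t -> t <= b -> t < arc_time u -> s t < u.
Proof.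
move=> at_ tb lt; rewrite ltNge; apply/negP => ut.
move: lt; rewrite ltNge => /negP; apply.
by apply: ge_inf; [exists a => x [/andP[]]|split => //; rewrite at_ tb].
Qed.

Lemma arc_time_gt u t : u <= s b -> t <= b -> arc_time u < t -> u <= s t.
Proof.
move=> ub tb /inf_lt[|x [/andP[ax xb] ux] xt].
  by exists b; split; rewrite ?ab ?lexx.
exact: le_trans ux (s_nd ax (ltW xt) tb).
Qed.

Lemma arc_time_le u u' : u <= u' -> u' <= s b -> arc_time u <= arc_time u'.
Proof.
move=> uu ub; apply: lb_le_inf; first by exists b; split; rewrite ?ab ?lexx.
move=> t [tab ut]; apply: ge_inf; first by exists a => x [/andP[]].
by split => //; exact: le_trans ut.
Qed.

Lemma arc_time0 : arc_time 0 = a.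
Proof.
apply/eqP; rewrite eq_le; apply/andP; split.
  by apply: ge_inf; [exists a => t [/andP[]]|rewrite /= s_a ab !lexx].
have /arc_time_itv/andP[] // : 0 <= s b by rewrite -s_a s_nd.
Qed.

Variables (w : R -> R) (L : R).
Hypothesis cw : econt a b w.
Hypothesis L0 : 0 <= L.
Hypothesis ws : forall t t', a <= t -> t <= t' -> t' <= b ->
  `|w t' - w t| <= L * (s t' - s t).

(** The value of [s] at [arc_time u] is out of control, but just after that time it is
    at least [u], and just before [arc_time u'] it is less than [u']: the bound is
    taken between such times, and [w] is continuous. *)
Lemma arc_lipschitz u u' : 0 <= u -> u <= u' -> u' <= s b ->
  `|w (arc_time u') - w (arc_time u)| <= L * (u' - u).
Proof.
move=> u0 uu ub.
have := arc_time_le uu ub; rewrite le_eqVlt => /predU1P[->|tt].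
  by rewrite subrr normr0 mulr_ge0// subr_ge0.
have /andP[at1 t1b] := arc_time_itv (le_trans uu ub).
have /andP[at2 t2b] := arc_time_itv ub.
apply/ler_addgt0Pr => e e0; have e2 : 0 < e / 2 by rewrite divr_gt0.
have [|d1 d10 H1] := @cw (arc_time u) _ _ e2; first by rewrite at1.
have [|d2 d20 H2] := @cw (arc_time u') _ _ e2; first by rewrite at2.
pose g := Num.min (Num.min d1 d2) (arc_time u' - arc_time u) / 3.
have g0 : 0 < g by rewrite divr_gt0// !lt_min d10 d20 subr_gt0.
have [g1 g2 g3] : [/\ g * 3 <= d1, g * 3 <= d2 & g * 3 <= arc_time u' - arc_time u].
  by rewrite /g divfK// !ge_min !lexx !orbT.
pose x := arc_time u + g; pose y := arc_time u' - g.
have xab : a <= x <= b by rewrite /x; apply/andP; split; lra.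
have yab : a <= y <= b by rewrite /y; apply/andP; split; lra.
have xy : x <= y by rewrite /x /y; lra.
have {}H1 := H1 x xab _; have {}H2 := H2 y yab _.
have h1 : `|w (arc_time u) - w x| < e / 2.
  by apply: H1; rewrite /x opprD addrA subrr sub0r normrN gtr0_norm//; lra.
have h2 : `|w (arc_time u') - w y| < e / 2.
  by apply: H2; rewrite /y opprB addrCA subrr addr0 gtr0_norm//; lra.
have /andP[ax xb] := xab; have /andP[ay yb] := yab.
have sx : u <= s x by apply: arc_time_gt => //; [exact: le_trans ub|rewrite /x; lra].
have sy : s y < u' by apply: arc_time_lt => //; rewrite /y; lra.
have wxy := ws ax xy yb.
have Lxy : L * (s y - s x) <= L * (u' - u) by apply: ler_wpM2l => //; lra.
move: h1 h2 wxy; rewrite !ltr_norml !ler_norml => /andP[? ?] /andP[? ?] /andP[? ?].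
by apply/andP; split; lra.
Qed.

Lemma arc_end : w (arc_time (s b)) = w b.
Proof.
have /andP[at1 t1b] := arc_time_itv (lexx (s b)).
move: t1b; rewrite le_eqVlt => /predU1P[->//|tb].
apply/eqP; rewrite -subr_eq0 -normr_le0; apply/ler_addgt0Pr => e e0; rewrite add0r.
have [|d1 d10 H1] := @cw (arc_time (s b)) _ _ e0; first by rewrite at1 ltW.
pose g := Num.min d1 (b - arc_time (s b)) / 2.
have g0 : 0 < g by rewrite divr_gt0// !lt_min d10 subr_gt0.
have [g1 g2] : g * 2 <= d1 /\ g * 2 <= b - arc_time (s b).
  by rewrite /g divfK// !ge_min !lexx !orbT.
pose x := arc_time (s b) + g.
have xab : a <= x <= b by rewrite /x; apply/andP; split; lra.
have /andP[ax xb] := xab.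
have h1 : `|w (arc_time (s b)) - w x| < e.
  by apply: H1 => //; rewrite /x opprD addrA subrr sub0r normrN gtr0_norm//; lra.
have sx : s x = s b.
  by apply/eqP; rewrite eq_le s_nd//= arc_time_gt// /x; lra.
have := ws ax xb (lexx b); rewrite sx subrr mulr0 normr_le0 subr_eq0 => /eqP ->.
exact: ltW.
Qed.

End arc_length.

(** * Curves that meet the exceptional sets *)

Lemma integral_ge_indic (R : realType) (D S : set R) (f : R -> \bar R) (c : R) :
  measurable D -> measurable S -> S `<=` D -> 0 <= c ->
  (forall x, D x -> 0 <= f x)%E -> (forall x, S x -> c%:E <= f x)%E ->
  (c%:E * lebesgue_measure S <= \int[lebesgue_measure]_(x in D) f x)%E.
Proof.
move=> mD mS SD c0 f0 fc.
have -> : (c%:E * lebesgue_measure S =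
    \int[lebesgue_measure]_(x in D) (c%:E * (\1_S x)%:E))%E.
  have mI : measurable_fun D (fun x => (\1_S x)%:E : \bar R).
    by apply/measurable_EFinP; exact: measurable_indic.
  have I0 x : D x -> (0 <= (\1_S x)%:E :> \bar R)%E by rewrite lee_fin.
  have EI := ge0_integralZl_EFin lebesgue_measure mD I0 mI c0.
  by apply: etrans (esym EI); rewrite integral_indic// setIidl.
rewrite !ge0_integralE//; last by move=> x _; rewrite mule_ge0// lee_fin.
apply: ge_ereal_sup => _ [h hc <-]; apply: ereal_sup_ubound; exists h => // x; apply: le_trans (hc x) _; rewrite !patchE; case: ifPn => // xD.
have [Sx|nSx] := pselect (S x).
  by rewrite indicE mem_set// mule1; exact: fc.
by rewrite indicE memNset// mule0; apply: f0; rewrite inE in xD.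
Qed.

(** Otherwise there would be too many intermediate values. *)
Lemma finite_range_constant (R : realType) (V : R -> R) (W : seq R) (u v : R) :
  continuous V -> u <= v -> (forall z, u <= z <= v -> V z \in W) -> V u = V v.
Proof.
move=> cV uv VW; apply: contrapT => /eqP Vuv.
pose y i := V u + (V v - V u) * i%:R / (size W).+1%:R.
have yinj : injective y.
  move=> i j /addrI /eqP; rewrite (inj_eq (mulIf _)) ?invr_eq0 ?pnatr_eq0//.
  by rewrite (inj_eq (mulfI _)) ?subr_eq0 1?eq_sym// eqr_nat => /eqP.
have yW i : (i <= size W)%N -> y i \in W.
  move=> iW; have cw : {within `[u, v], continuous V} by exact: continuous_subspaceT.
  have [|z] := @IVT R V u v (y i) uv cw; last first.
    by rewrite in_itv/= => zuv <-; exact: VW.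
  have i0 : 0 <= i%:R / (size W).+1%:R :> R by rewrite divr_ge0.
  have i1 : i%:R / (size W).+1%:R <= 1 :> R.
    by rewrite ler_pdivrMr// mul1r ler_nat (leq_trans iW).
  rewrite /y -mulrA; move: (_ / _) i0 i1 => q q0 q1.
  by case: (leP (V u) (V v)) => VV; apply/andP; split; nra.
have := @uniq_leq_size _ [seq y i | i <- iota 0 (size W).+1] W.
rewrite map_inj_uniq// iota_uniq size_map size_iota ltnn => /(_ isT).
move=> H; suff: false by []; apply: H => _ /mapP[i + ->]; rewrite mem_iota/= add0n ltnS; exact: yW.
Qed.

(** The topology of the sup norm in elementary terms: it pulls back to open sets
    under every map whose coordinates are Lipschitz. *)
Definition coord_near {R : realType} {n : nat} (del : R) (z z' : 'rV[R]_n) : Prop :=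
  forall i, `|z 0 i - z' 0 i| < del.

Definition coordinate_open {R : realType} {n : nat} (A : set 'rV[R]_n) : Prop :=
  forall z, A z -> exists2 del, 0 < del & forall z', coord_near del z z' -> A z'.

Definition sup_lipschitz {R : realType} {n : nat} (f : 'rV[R]_n -> R) : Prop :=
  forall (z z' : 'rV[R]_n) (del : R), (forall i, `|z 0 i - z' 0 i| <= del) -> `|f z - f z'| <= del.

(** Clamping the arc length parameter extends a parametrization to the whole line,
    which makes its continuity global. *)
Definition clamp {R : realType} (l u : R) : R := Num.max 0 (Num.min u l).

Lemma clamp_itv (R : realType) (l u : R) : 0 <= l -> 0 <= clamp l u <= l.
Proof.
move=> l0; rewrite /clamp le_max lexx/= ge_max l0/=.
by rewrite ge_min lexx orbT.
Qed.

Lemma clamp_id (R : realType) (l u : R) : 0 <= u -> u <= l -> clamp l u = u.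
Proof. by move=> u0 ul; rewrite /clamp min_l// max_r. Qed.

Lemma clamp_mono (R : realType) (l u v : R) : u <= v ->
  clamp l u <= clamp l v /\ clamp l v - clamp l u <= v - u.
Proof.
move=> uv; rewrite /clamp; case: (leP u l) => ul; case: (leP v l) => vl;
case: (leP 0 u) => u0; case: (leP 0 v) => v0; case: (leP 0 l) => l0; split; lra.
Qed.

(** The reason why a curve must spend length in [E]: [U] follows its first
    coordinate up to [Psi], but is locally constant while the curve is off [E]. *)
Definition detected {R : realType} {n : nat} (sig : R -> 'rV[R]_n.+1)
    (Psi : 'rV[R]_n.+1 -> R) (E : set 'rV[R]_n.+1) (a b : R) : Prop :=
  exists (U : R -> R) (W : seq R), [/\ econt a b U,
    (forall t, a <= t <= b -> `|U t - sig t 0 0| = Psi (sig t)) &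
    (forall t, a <= t <= b -> ~ E (sig t) -> U t \in W)].

Section detected_curve.
Context {R : realType} {n : nat} {T : Type} (d : T -> T -> \bar R)
  (t0 : T -> 'rV[R]_n.+1).
Hypothesis d_coord : forall x y i, (`|t0 x 0 i - t0 y 0 i|%:E <= d x y)%E.

Lemma dist_ge0 x y : (0 <= d x y)%E.
Proof. by apply: le_trans (d_coord x y 0); rewrite lee_fin. Qed.

Variables (gamma : R -> T) (a b : R).
Hypothesis ab : a <= b.
Hypothesis rect : (curve_length d gamma a b < +oo)%E.

Let s (t : R) : R := fine (curve_length d gamma a t).

Lemma curve_length_le_end t : a <= t -> t <= b ->
  (curve_length d gamma a t <= curve_length d gamma a b)%E.
Proof.
move=> at_; rewrite le_eqVlt => /predU1P[->//|tb].
apply: le_trans (curve_length_append gamma dist_ge0 at_ tb).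
by rewrite leeDl// dist_ge0.
Qed.

Lemma arc_lengthE t : a <= t <= b -> curve_length d gamma a t = (s t)%:E.
Proof.
move=> /andP[at_ tb]; rewrite /s fineK// ge0_fin_numE.
  exact: le_lt_trans (curve_length_le_end at_ tb) rect.
exact: curve_length_ge0 dist_ge0 _ _ at_.
Qed.

Lemma arc_length_dist t t' : a <= t -> t <= t' -> t' <= b ->
  (forall i, `|t0 (gamma t) 0 i - t0 (gamma t') 0 i| <= s t' - s t).
Proof.
move=> at_ tt tb i; move: tt; rewrite le_eqVlt => /predU1P[->|tt].
  by rewrite !subrr normr0.
have := curve_length_append gamma dist_ge0 at_ tt.
rewrite !arc_lengthE ?at_ ?tb ?(le_trans at_ (ltW tt)) ?(le_trans (ltW tt) tb)//.
move=> H; rewrite -lee_fin EFinB leeBrDl//.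
by apply: le_trans H; apply: leeD2l; exact: d_coord.
Qed.

Lemma arc_length_nd t t' : a <= t -> t <= t' -> t' <= b -> s t <= s t'.
Proof.
move=> at_ tt tb; rewrite -subr_ge0.
by apply: le_trans (arc_length_dist at_ tt tb 0).
Qed.

Lemma arc_length_start : s a = 0.
Proof.
suff H : curve_length d gamma a a = 0%E by rewrite /s H.
apply/eqP; rewrite eq_le (curve_length_ge0 gamma dist_ge0)// andbT.
by apply: ge_ereal_sup => _ [t tp <-]; rewrite (itv_partitionxx tp) big_ord0.
Qed.

Lemma arc_pointE u : arc_point d gamma a b u = gamma (arc_time a b s u).
Proof.
rewrite /arc_point /arc_time; congr (gamma (inf _)).
by apply/seteqP; split => t /= [tab]; rewrite (arc_lengthE tab) lee_fin.
Qed.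

Variables (Psi : nat -> 'rV[R]_n.+1 -> R) (h : nat -> R)
  (E : nat -> set 'rV[R]_n.+1).
Hypothesis coord_cont : forall i, econt a b (fun t => t0 (gamma t) 0 i).
Hypothesis Psi_lip : forall k, sup_lipschitz (Psi k).
Hypothesis Psi_le : forall k z, Psi k z <= h k.
Hypothesis h0 : h @ \oo --> (0 : R).
Hypothesis E_closed : forall k, coordinate_open (~` E k).
Hypothesis det : forall k, detected (t0 \o gamma) (Psi k) (E k) a b.
Hypothesis nonvert : t0 (gamma a) 0 0 != t0 (gamma b) 0 0.

(** In arc length the first coordinate [f] varies only while the curve is in the upper
    limit of the [E k]. Hence the values in a set [K] cost at least half the measure
    of [K] in length spent there, and for a suitable [K] this is the place where
    [wild] is large. *)
Lemma detected_integral_ge1 (rho : T -> R) :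
  (forall x, 0 <= rho x) ->
  (forall x, lim_sup_set E (t0 x) -> wild (t0 x 0 0) <= rho x) ->
  (1 <= \int[lebesgue_measure]_(u in `[0%R, fine (curve_length d gamma a b)])
    (rho (arc_point d gamma a b u))%:E)%E.
Proof.
move=> rho0 rhoE; set l := fine _.
have lE : l = s b by [].
have l0 : 0 <= l by rewrite lE -arc_length_start arc_length_nd.
pose tt u := arc_time a b s (clamp l u).
have ttab u : a <= tt u <= b.
  by apply: arc_time_itv => //; have /andP[] := clamp_itv u l0.
have lip (w : R -> R) (L : R) : econt a b w -> 0 <= L ->
  (forall t t', a <= t -> t <= t' -> t' <= b -> `|w t' - w t| <= L * (s t' - s t)) ->
  forall u v, u <= v -> `|w (tt v) - w (tt u)| <= L * (v - u).
  move=> cw L0 ws u v uv; have [c1 c2] := clamp_mono l uv.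
  have /andP[u0 _] := clamp_itv u l0; have /andP[_ vl] := clamp_itv v l0.
  apply: le_trans (arc_lipschitz ab arc_length_nd cw L0 ws u0 c1 vl) _.
  exact: ler_wpM2l.
have lipc (w : R -> R) (L : R) : 0 <= L ->
    (forall u v, u <= v -> `|w v - w u| <= L * (v - u)) -> continuous w.
  move=> L0 H x; apply/cvgrPdist_lt => e e0.
  have L1 : 0 < L + 1 by lra.
  apply/nbhs_ballP; exists (e / (L + 1)); first by rewrite /= divr_gt0.
  move=> y; rewrite /ball/= ltr_pdivlMr// => xy; apply: le_lt_trans xy.
  wlog xy : x y / x <= y.
    move=> HH; have [xy|/ltW yx] := leP x y; first exact: HH.
    by rewrite distrC (distrC x); exact: HH.
  rewrite distrC; apply: (le_trans (H _ _ xy)).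
  by rewrite distrC ger0_norm ?subr_ge0//; nra.
have coordlip i u v : u <= v ->
    `|t0 (gamma (tt v)) 0 i - t0 (gamma (tt u)) 0 i| <= 1 * (v - u).
  apply: (lip (fun t => t0 (gamma t) 0 i)) => //.
  by move=> t t' at_ t_t tb; rewrite mul1r distrC; exact: arc_length_dist.
pose f u := t0 (gamma (tt u)) 0 0.
have cf : continuous f by apply: (lipc f 1) => // u v; exact: coordlip.
(* [e k] is the set of parameters at which [V k] may vary. *)
have [U HU] := choice det.
have {HU} [W HU] := choice HU.
pose V k u := U k (tt u).
have VL k u v : u <= v -> `|V k v - V k u| <= 2 * (v - u).
  have [cU UP UW] := HU k; apply: (lip (U k)) => // t t' at_ t_t tb.
  apply: (@selection_speed R a b s (fun t => t0 (gamma t) 0 0)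
    (fun t => Psi k (t0 (gamma t)))) => //.
  move=> x y ax xy yb; split; first by rewrite distrC; exact: arc_length_dist.
  by rewrite distrC; apply: Psi_lip => i; exact: arc_length_dist.
have cV k : continuous (V k) by apply: (lipc _ 2) => // u v; exact: VL.
pose e k := [set u | E k (t0 (gamma (tt u)))].
have ce k : closed (e k).
  rewrite -(setCK (e k)); apply: open_closedC; rewrite openE => u /= nEu.
  have [del d0 H] := E_closed nEu.
  apply/nbhs_ballP; exists del => //= v; rewrite /ball/= => uv; apply: H => i.
  apply: le_lt_trans uv; have [uv|/ltW vu] := leP u v.
    by rewrite distrC; apply: le_trans (coordlip i _ _ uv) _; rewrite mul1r distrC ler_norm.
  by apply: le_trans (coordlip i _ _ vu) _; rewrite mul1r ler_norm.
have Vc k u v : u <= v -> (forall z, u <= z <= v -> ~ e k z) -> V k u = V k v.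
  move=> uv ne; apply: (finite_range_constant (W := W k)) => // z zuv.
  by have [_ _ UW] := HU k; apply: UW => //; exact: ne.
have Vf k u : `|V k u - f u| <= h k.
  by have [_ UP _] := HU k; rewrite /V /f UP.
have me : measurable (lim_sup_set e).
  by apply: bigcap_measurable => // i _; apply: bigcup_measurable => j _; exact: closed_measurable.
have var x y : 0 <= x -> x <= y -> y <= l ->
  (`|f y - f x|%:E <= 2%:E * lebesgue_measure (`]x, y] `&` lim_sup_set e))%E.
  by move=> _ xy _; apply: (lim_sup_variation xy _ h0 ce Vf VL Vc).
have f0 : f 0 = t0 (gamma a) 0 0.
  by rewrite /f /tt clamp_id// (arc_time0 ab arc_length_nd arc_length_start).
have fl : f l = t0 (gamma b) 0 0.
  rewrite /f /tt clamp_id//.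
  apply: (@arc_end R a b s ab arc_length_nd (fun t => t0 (gamma t) 0 0) 1 _ _) => //.
  by move=> t t' at_ t_t tb; rewrite mul1r distrC; exact: arc_length_dist.
have mM : Num.min (f 0) (f l) < Num.max (f 0) (f l).
  rewrite f0 fl; move: nonvert; rewrite neq_lt => /orP[] xy.
    by rewrite (min_l (ltW xy)) (max_r (ltW xy)).
  by rewrite (min_r (ltW xy)) (max_l (ltW xy)).
have [c [K [c0 clK KJ Kc Kl]]] := wild_large mM.
have Kf : K `<=` f @` `[0, l].
  move=> y /KJ/=; rewrite in_itv/= => /andP[y1 y2].
  have cw : {within `[0, l], continuous f} by exact: continuous_subspaceT.
  have [|x xl fx] := @IVT R f 0 l y l0 cw; first by rewrite !ltW.
  by exists x.
have Kle := image_measure_le l0 (ler0n R 2) cf me var clK Kf.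
pose S := lim_sup_set e `&` `]0%R, l] `&` f @^-1` K.
have mS : measurable S.
  apply: measurableI; first exact: measurableI.
  by apply: closed_measurable; apply: preimage_closed => // x _; exact: cf.
have Sfin : lebesgue_measure S \is a fin_num.
  rewrite ge0_fin_numE//; apply: (@le_lt_trans _ _ (lebesgue_measure (`]0, l] : set R))).
    by apply: le_lebesgue => // x [[]].
  by rewrite lebesgue_measure_itv/=; case: ifP => _; rewrite ?ltry// ltry.
apply: (@le_trans _ _ (c%:E * lebesgue_measure S)%E); last first.
  apply: integral_ge_indic => //.
  - by move=> x [[_ /=]]; rewrite !in_itv/= => /andP[/ltW -> ->].
  - exact: ltW.
  - by move=> x _; rewrite lee_fin.
  move=> u [[eu /=]]; rewrite in_itv/= => /andP[/ltW u0 ul] Ku.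
  have E1 : arc_point d gamma a b u = gamma (tt u) by rewrite arc_pointE /tt clamp_id.
  rewrite lee_fin E1; apply: le_trans (rhoE _ _); first exact: Kc.
  by move=> i _; have [k ik ek] := eu i I; exists k.
have : (4 <= c%:E * (2%:E * lebesgue_measure S))%E.
  by apply: le_trans Kl _; apply: lee_wpmul2l => //; rewrite lee_fin ltW.
by rewrite -(fineK Sfin) -!EFinM !lee_fin; nra.
Qed.

End detected_curve.

(** * Plates and the folded first coordinate *)

(** A plate [(c, rho, h)] stands for the box with centre [c], half-height [h] in
    the first direction and half-width [rho] in the others. *)
Definition plate (R : realType) (m : nat) : Type := ('rV[R]_m.+1 * R * R)%type.

Section plates.
Context {R : realType} {m : nat}.
Implicit Types (b : plate R m) (z : 'rV[R]_m.+1) (P : seq (plate R m)).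

Definition pc b := b.1.1.
Definition prho b := b.1.2.
Definition ph b := b.2.

(** Sup-norm distance to the flat plate of half-width [rho - h] in the
    hyperplane through the centre. *)
Definition plate_dist b z : R :=
  \big[Num.max/`|z 0 0 - pc b 0 0|]_(j < m.+1 | j != 0)
     (`|z 0 j - pc b 0 j| - (prho b - ph b)).

(** The height that is missing to leave the box of a plate. *)
Definition push P z : R := \big[Num.max/0]_(b <- P) (ph b - plate_dist b z).

Definition core_gauge b z : R :=
  \big[Num.max/`|z 0 0 - pc b 0 0| - ph b]_(j < m.+1 | j != 0)
     (`|z 0 j - pc b 0 j| - (prho b - ph b)).

(** The part of the box that faces the plate: there the distance to the plate is the
    distance to its hyperplane. *)
Definition core b z : Prop := core_gauge b z < 0.

Definition uncovered P : set 'rV[R]_m.+1 :=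
  [set z : 'rV[R]_m.+1 | (forall i, 0 <= z 0 i <= 1) /\ forall b, b \in P -> ~ core b z].

Definition above P z : bool :=
  has (fun b => (plate_dist b z < ph b) && (pc b 0 0 < z 0 0)) P.

(** The first coordinate, moved away from the plate by the height that is missing
    to leave the box. On either side of the plate this leads from every point of
    the core to the same level, the top or the bottom of the box; across the plate
    the function jumps, and elsewhere it is continuous. *)
Definition folded P z : R :=
  if above P z then z 0 0 + push P z else z 0 0 - push P z.

Definition plates_disjoint P : Prop := forall b b' z, b \in P -> b' \in P ->
  plate_dist b z < ph b -> plate_dist b' z < ph b' -> b = b'.

Definition off_plates P z : Prop :=
  forall b, b \in P -> plate_dist b z < ph b -> z 0 0 != pc b 0 0.

Lemma plate_dist_leP b z t : reflect (`|z 0 0 - pc b 0 0| <= t /\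
  forall j, j != 0 -> `|z 0 j - pc b 0 j| - (prho b - ph b) <= t)
  (plate_dist b z <= t).
Proof. exact: bigmax_leP. Qed.

Lemma coreP b z : core b z <-> (`|z 0 0 - pc b 0 0| < ph b /\
  forall j, j != 0 -> `|z 0 j - pc b 0 j| < prho b - ph b).
Proof.
rewrite /core /core_gauge; split.
  by move=> /bigmax_ltP[]; rewrite subr_lt0 => -> H; split=> // j /H; rewrite subr_lt0.
by move=> [H0 H]; apply/bigmax_ltP; rewrite subr_lt0; split=> // j /H; rewrite subr_lt0.
Qed.

Lemma distD3 (x y c del t : R) : `|x - y| <= del -> `|x - c| <= t -> `|y - c| <= t + del.
Proof. by rewrite !ler_norml => /andP[? ?] /andP[? ?]; apply/andP; split; lra. Qed.

Lemma plate_dist_lip b z z' (del : R) : (forall i, `|z 0 i - z' 0 i| <= del) ->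
  plate_dist b z' <= plate_dist b z + del.
Proof.
move=> zz; have /plate_dist_leP[H0 H] := lexx (plate_dist b z).
apply/plate_dist_leP; split; first exact: distD3 (zz 0) H0.
move=> j /H; rewrite lerBlDr => Hj; rewrite lerBlDr addrAC.
exact: distD3 (zz j) Hj.
Qed.

Lemma core_open b : coordinate_open (core b).
Proof.
move=> z cz; exists (- core_gauge b z); first by rewrite oppr_gt0.
have H0 : `|z 0 0 - pc b 0 0| - ph b <= core_gauge b z by exact: bigmax_ge_id.
have H j : j != 0 -> `|z 0 j - pc b 0 j| - (prho b - ph b) <= core_gauge b z.
  by move=> j0; apply: (@le_bigmax_seq _ _ _ _ _ j (fun j => j != 0) (fun j => `|z 0 j - pc b 0 j| - (prho b - ph b)) _ j0); rewrite mem_index_enum.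
move=> z' zz; apply/coreP; split.
  have := zz 0; move: H0; rewrite !ltr_norml lerBlDr ler_norml => /andP[? ?] /andP[? ?].
  by apply/andP; split; lra.
move=> j /H; have := zz j; rewrite !ltr_norml lerBlDr ler_norml => /andP[? ?] /andP[? ?].
by apply/andP; split; lra.
Qed.

Lemma push_ge0 P z : 0 <= push P z.
Proof. exact: bigmax_ge_id. Qed.

Lemma push_ge P b z : b \in P -> ph b - plate_dist b z <= push P z.
Proof. by move=> bP; exact: (@le_bigmax_seq _ _ _ _ _ b xpredT (fun b => ph b - plate_dist b z) bP). Qed.

Lemma push_le P z t : 0 <= t ->
  (forall b, b \in P -> ph b - plate_dist b z <= t) -> push P z <= t.
Proof. by move=> t0 H; rewrite /push big_seq; apply: bigmax_le. Qed.

Lemma push_lip P : sup_lipschitz (push P).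
Proof.
have half z z' (del : R) : (forall i, `|z 0 i - z' 0 i| <= del) -> push P z <= push P z' + del.
  move=> zz; have d0 : 0 <= del by apply: le_trans (zz 0).
  apply: push_le => [|b bP]; first by rewrite addr_ge0// push_ge0.
  apply: le_trans (_ : ph b - plate_dist b z' + del <= _); last first.
    by rewrite lerD2r push_ge.
  by have := @plate_dist_lip b _ _ _ zz; lra.
move=> z z' del zz; have := half z z' del zz; have := half z' z del.
move=> H1 H2; rewrite ler_norml; apply/andP; split; last lra.
by have := H1 (fun i => eq_ind _ (fun x => x <= del) (zz i) _ (distrC _ _)); lra.
Qed.

Lemma push_sup_le P z (h : R) : 0 <= h -> (forall b, b \in P -> ph b <= h) ->
  push P z <= h.
Proof.
move=> h0 Ph; apply: push_le => // b bP; apply: le_trans (Ph b bP).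
rewrite lerBlDr lerDl; have /plate_dist_leP[H0 _] := lexx (plate_dist b z).
exact: le_trans H0.
Qed.

Lemma folded_dist P z : `|folded P z - z 0 0| = push P z.
Proof.
rewrite /folded; case: ifP => _; first by rewrite addrC addKr ger0_norm// push_ge0.
by rewrite addrC addKr normrN ger0_norm// push_ge0.
Qed.

Lemma push_active P b z : plates_disjoint P -> b \in P -> plate_dist b z < ph b ->
  push P z = ph b - plate_dist b z.
Proof.
move=> dP bP bz; apply/eqP; rewrite eq_le push_ge// andbT.
apply: push_le => [|b' b'P]; first by rewrite subr_ge0 ltW.
have [b'z|] := ltP (plate_dist b' z) (ph b'); first by rewrite (dP b b' z).
by rewrite -subr_le0 => /le_trans; apply; rewrite subr_ge0 ltW.
Qed.

Lemma above_active P b z : plates_disjoint P -> b \in P -> plate_dist b z < ph b ->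
  above P z = (pc b 0 0 < z 0 0).
Proof.
move=> dP bP bz; apply/hasP/idP => [[b' b'P /andP[b'z]]|H].
  by rewrite (dP b b' z).
by exists b => //; rewrite bz.
Qed.

Lemma folded_core P b z : plates_disjoint P -> b \in P -> core b z ->
  `|folded P z - pc b 0 0| = ph b.
Proof.
move=> dP bP /coreP[z0 zj].
have Db : plate_dist b z = `|z 0 0 - pc b 0 0|.
  apply/eqP; rewrite eq_le; apply/andP; split; last first.
    by have /plate_dist_leP[] := lexx (plate_dist b z).
  apply/plate_dist_leP; split => // j /zj; rewrite -subr_lt0 => /ltW.
  by move/le_trans; apply.
have Dh : plate_dist b z < ph b by rewrite Db.
rewrite /folded (above_active dP bP Dh) (push_active dP bP Dh) Db.
have h0 : 0 <= ph b by apply: le_trans (ltW z0).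
case: ltP => [H|H].
  have E : `|z 0 0 - pc b 0 0| = z 0 0 - pc b 0 0 by rewrite gtr0_norm ?subr_gt0.
  by rewrite E -[RHS]ger0_norm//; congr (`| _ |); ring.
have E : `|z 0 0 - pc b 0 0| = pc b 0 0 - z 0 0 by rewrite ler0_norm ?subr_le0// opprB.
by rewrite E -[RHS]ger0_norm// -[RHS]normrN; congr (`| _ |); ring.
Qed.

(** Near a point off the plate the box that contains the point and its side of the
    plate do not change. *)
Lemma folded_local_lip P z : plates_disjoint P -> off_plates P z ->
  exists2 r, 0 < r & forall z' (del : R), del < r -> (forall i, `|z 0 i - z' 0 i| <= del) ->
    `|folded P z - folded P z'| <= 2 * del.
Proof.
move=> dP oP; have [z0|] := leP (push P z) 0.
  exists 1 => // z' del _ zz; have bz : push P z = 0.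
    by apply/eqP; rewrite eq_le z0 push_ge0.
  have := folded_dist P z; have := folded_dist P z'.
  have := push_lip P zz; rewrite bz => + + /normr0_eq0/eqP; rewrite subr_eq0 => + + /eqP->.
  rewrite sub0r normrN => bz' E; have := zz 0.
  move: E; rewrite (ger0_norm (push_ge0 P z')) in bz' *.
  move=> E; have : `|folded P z' - z' 0 0| <= del by rewrite E.
  by rewrite !ler_norml => /andP[? ?] /andP[? ?]; apply/andP; split; lra.
move=> bz; have [b bP hb] : exists2 b, b \in P & plate_dist b z < ph b.
  apply: contrapT => nb; move: bz; rewrite ltNge => /negP; apply.
  apply: push_le => // b bP; rewrite subr_le0 leNgt; apply/negP => H; apply: nb.
  by exists b.
have z0 := oP b bP hb.
exists (Num.min (ph b - plate_dist b z) `|z 0 0 - pc b 0 0|).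
  by rewrite lt_min subr_gt0 hb normr_gt0 subr_eq0.
move=> z' del; rewrite lt_min => /andP[d1 d2] zz.
have hb' : plate_dist b z' < ph b by have := @plate_dist_lip b _ _ _ zz; lra.
have := push_lip P zz; have := zz 0.
have : (pc b 0 0 < z' 0 0) = (pc b 0 0 < z 0 0).
  move: d2 (zz 0); rewrite ler_norml => + /andP[? ?].
  case: (ltrgtP (z 0 0) (pc b 0 0)) z0 => // H _.
    by move=> ?; apply/negbTE; rewrite -leNgt; lra.
  by move=> ?; lra.
rewrite /folded (above_active dP bP hb) (above_active dP bP hb') => ->.
rewrite !ler_norml => /andP[? ?] /andP[? ?].
by case: ifP => _; apply/andP; split; lra.
Qed.

Lemma uncovered_closed P : coordinate_open (~` uncovered P).
Proof.
move=> z nz; have [[i]|H01] := pselect (exists i, z 0 i < 0 \/ 1 < z 0 i).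
- move=> [zi|zi].
    exists (- z 0 i); first by rewrite oppr_gt0.
    move=> z' /(_ i); rewrite ltr_norml => /andP[? ?] [/(_ i) /andP[+ _] _]; lra.
  exists (z 0 i - 1); first by rewrite subr_gt0.
  move=> z' /(_ i); rewrite ltr_norml => /andP[? ?] [/(_ i) /andP[_ +] _]; lra.
have [b bP bz] : exists2 b, b \in P & core b z.
  apply: contrapT => nb; apply: nz; split.
    move=> i; rewrite !leNgt; apply/andP; split; apply/negP => H; apply: H01; exists i;
    by [left|right].
  by move=> b bP bz; apply: nb; exists b.
have [del d0 H] := core_open bz; exists del => // z' /H cz' [_ /(_ b bP)].
exact.
Qed.

(** The values on the cores are the levels of the tops and bottoms of the boxes, in
    finite number. *)
Lemma detectedI P (a b : R) (sig : R -> 'rV[R]_m.+1) (U : R -> R) :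
  econt a b U ->
  (forall t, a <= t <= b -> forall i, 0 <= sig t 0 i <= 1) ->
  (forall t, a <= t <= b -> `|U t - sig t 0 0| = push P (sig t)) ->
  (forall t p, a <= t <= b -> p \in P -> core p (sig t) -> `|U t - pc p 0 0| = ph p) ->
  detected sig (push P) (uncovered P) a b.
Proof.
move=> cU s01 Ub Uc; exists U.
exists ([seq pc p 0 0 + ph p | p <- P] ++ [seq pc p 0 0 - ph p | p <- P]).
split => // t tab nE.
have [p pP cp] : exists2 p, p \in P & core p (sig t).
  apply: contrapT => np; apply: nE; split; first exact: s01.
  by move=> p pP cp; apply: np; exists p.
have := Uc t p tab pP cp; rewrite mem_cat; case: (ler0P (U t - pc p 0 0)) => _ E; last first.
  apply/orP; left; apply/mapP; exists p => //; rewrite -E; ring.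
apply/orP; right; apply/mapP; exists p => //; rewrite -E; ring.
Qed.

End plates.

Lemma econt_vec (R : realType) (n : nat) (a b : R) (sig : R -> 'rV[R]_n) :
  (forall i, econt a b (fun t => sig t 0 i)) ->
  forall t e, a <= t <= b -> 0 < e -> exists2 del, 0 < del &
    forall t', a <= t' <= b -> `|t - t'| < del -> coord_near e (sig t) (sig t').
Proof.
move=> cs t e tab e0.
have H i : exists del, 0 < del /\ forall t', a <= t' <= b -> `|t - t'| < del ->
    `|sig t 0 i - sig t' 0 i| < e.
  by have [del d0 H] := cs i t e tab e0; exists del.
have {H} [del Hd] := choice H.
exists (\big[Num.min/1]_i del i).
  by apply/bigmin_gtP; split => // i _; have [] := Hd i.
move=> t' tab' tt i; have [_] := Hd i; apply => //.
by apply: lt_le_trans tt _; exact: bigmin_le.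
Qed.

Lemma folded_econt (R : realType) (m : nat) (P : seq (plate R m)) (a b : R)
    (sig : R -> 'rV[R]_m.+1) :
  plates_disjoint P -> (forall i, econt a b (fun t => sig t 0 i)) ->
  (forall t, a <= t <= b -> off_plates P (sig t)) ->
  econt a b (folded P \o sig).
Proof.
move=> dP cs oP t e tab e0; have [r r0 Hr] := folded_local_lip dP (oP t tab).
pose g := Num.min r e / 3.
have g0 : 0 < g by rewrite divr_gt0// lt_min r0.
have [g1 g2] : g * 3 <= r /\ g * 3 <= e by rewrite /g divfK// !ge_min !lexx orbT.
have [del d0 H] := econt_vec cs tab g0.
exists del => // t' tab' tt; apply: le_lt_trans (Hr (sig t') g _ _) _; [lra| |lra].
by move=> i; apply: ltW; exact: H.
Qed.

(** * Null sets and vanishing modulus *)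

Lemma set_diam_ge0 (R : realType) (T : Type) (d : T -> T -> \bar R) (A : set T) :
  (0 <= set_diam d A)%E.
Proof. by apply: ereal_sup_ubound; left. Qed.

Lemma set_diam0 (R : realType) (T : Type) (d : T -> T -> \bar R) :
  set_diam d set0 = 0%E.
Proof.
apply/eqP; rewrite eq_le set_diam_ge0 andbT.
by apply: ge_ereal_sup => _ [->//|[x []]].
Qed.

Lemma set_diam_le (R : realType) (T : Type) (d : T -> T -> \bar R) (A : set T) (r : \bar R) :
  (0 <= r)%E -> (forall x y, A x -> A y -> (d x y <= r)%E) -> (set_diam d A <= r)%E.
Proof. by move=> r0 H; apply: ge_ereal_sup => _ [->//|[x Ax [y Ay <-]]]; exact: H. Qed.

Lemma expe_mono (R : realType) (x y : \bar R) n : (0 <= x)%E -> (x <= y)%E ->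
  (x ^+ n <= y ^+ n)%E.
Proof.
move=> x0 xy; elim: n => [//|n IH]; rewrite !expeS.
by apply: lee_pmul => //; exact: expe_ge0.
Qed.

Lemma exists_small (R : realType) (M eps : R) : 0 <= M -> 0 < eps ->
  exists K : nat, forall k, (K <= k)%N -> M / 2 ^+ k <= eps.
Proof.
move=> M0 e0; exists (Num.truncn (M / eps)).+1 => k Kk.
have := truncnS_gt (M / eps).
move=> H; rewrite ler_pdivrMr ?exprn_gt0// mulrC -ler_pdivrMr//.
apply: le_trans (ltW H) _; rewrite -natrX ler_nat; apply: leq_trans Kk _.
by apply: ltnW; exact: ltn_expl.
Qed.

Section hausdorff_null.
Context {R : realType} {T : Type} (d : T -> T -> \bar R) (n : nat).

Lemma nneseries_seq (s : seq (set T)) :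
  (\sum_(l <oo) set_diam d (nth set0 s l) ^+ n.+1 =
   \sum_(B <- s) set_diam d B ^+ n.+1)%E.
Proof.
have f0 l : (0 <= set_diam d (nth set0 s l) ^+ n.+1)%E.
  by apply: expe_ge0; exact: set_diam_ge0.
rewrite (nneseries_split 0 (size s))// add0n eseries0 ?adde0; last first.
  by move=> i si _; rewrite nth_default// set_diam0 expeS mul0e.
by rewrite [RHS](big_nth set0).
Qed.

(** Countably many finite families are enumerated as one sequence. *)
Lemma flatten_cover (s : nat -> seq (set T)) (e : nat -> \bar R) :
  (forall k, \sum_(B <- s k) set_diam d B ^+ n.+1 <= e k)%E ->
  exists F : nat -> set T, [/\
    forall k l, exists i, F i = nth set0 (s k) l,
    forall i, exists k l, F i = nth set0 (s k) l &
    (\sum_(i <oo) set_diam d (F i) ^+ n.+1 <= \sum_(k <oo) e k)%E].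
Proof.
move=> se; have /card_set_bijP[f fbij] := card_nat2.
have /card_set_bijP[g gbij] : ([set: nat] #= [set: nat * nat])%card.
  by rewrite card_eq_sym; exact: card_nat2.
pose F i := nth set0 (s (g i).1) (g i).2.
exists F; split => [k l|i|].
- have [_ _ gs] := gbij; have [i _ gi] := gs (k, l) I.
  by exists i; rewrite /F gi.
- by exists (g i).1, (g i).2.
have f0 k l : (0 <= set_diam d (nth set0 (s k) l) ^+ n.+1)%E.
  by apply: expe_ge0; exact: set_diam_ge0.
rewrite [leLHS]nneseries_esumT; last by move=> i; exact: f0.
rewrite -(@reindex_esum R _ _ _ _ _ (fun p => set_diam d (nth set0 (s p.1) p.2) ^+ n.+1)%E gbij).
rewrite (_ : [set: nat * nat] = [set: nat] `*`` (fun _ => [set: nat])); last first.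
  by apply/seteqP; split.
rewrite -(esum_esum (a := fun k l => set_diam d (nth set0 (s k) l) ^+ n.+1)%E)//.
rewrite -nneseries_esumT; last by move=> k; exact: esum_ge0.
apply: lee_nneseries => [k _ _|k _]; first exact: esum_ge0.
by rewrite -nneseries_esumT// nneseries_seq.
Qed.

Lemma hausdorff_measure_ge0 (A : set T) : (0 <= hausdorff_measure d n.+1 A)%E.
Proof.
apply: ereal_sup_ge; eexists; first by exists 1 => //=; exact: ltr01.
apply: le_ereal_inf_tmp => _ [F _ <-]; apply: nneseries_ge0 => k _ _.
by apply: (expe_ge0 n.+1); exact: set_diam_ge0.
Qed.

Lemma hausdorff_measure_null (A : set T) :
  (forall delta eps : R, 0 < delta -> 0 < eps -> exists F : nat -> set T,
     [/\ A `<=` \bigcup_k F k, forall k, (set_diam d (F k) <= delta%:E)%E &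
      (\sum_(k <oo) set_diam d (F k) ^+ n.+1 <= eps%:E)%E]) ->
  hausdorff_measure d n.+1 A = 0%E.
Proof.
move=> H; apply/eqP; rewrite eq_le hausdorff_measure_ge0 andbT.
apply: ge_ereal_sup => _ [delta /= d0 <-]; apply/lee_addgt0Pr => eps e0.
rewrite add0e; have [F [AF Fd Fs]] := H _ _ d0 e0.
by apply: le_trans Fs; apply: ereal_inf_lbound; exists F.
Qed.

Lemma hausdorff_measure_sub (A B : set T) : A `<=` B ->
  (hausdorff_measure d n.+1 A <= hausdorff_measure d n.+1 B)%E.
Proof.
move=> AB; apply: ge_ereal_sup => _ [delta /= d0 <-].
apply: ereal_sup_ge; eexists; first by exists delta.
apply: ereal_inf_le_tmp => _ [F [BF Fd] <-]; exists F => //; split => //.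
exact: subset_trans BF.
Qed.

Lemma hausdorff_measure0 : hausdorff_measure d n.+1 set0 = 0%E.
Proof.
apply: hausdorff_measure_null => delta eps d0 e0; exists (fun=> set0); split => //.
  by move=> k; rewrite set_diam0 lee_fin ltW.
rewrite eseries0 ?lee_fin ?(ltW e0)// => i _ _.
by rewrite set_diam0 expeS mul0e.
Qed.

End hausdorff_null.

Section integral_of_set_function.
Context {R : realType} {dd : measure_display} {T : measurableType dd}.
Variable mu : set T -> \bar R.

Lemma sintegral_null (h : T -> R) :
  (forall x, x != 0 -> mu (h @^-1` [set x]) = 0%E) -> sintegral mu h = 0%E.
Proof.
move=> H; rewrite /sintegral fsbig1// => x _.
by have [->|x0] := eqVneq x 0; [rewrite mul0e|rewrite H// mule0].
Qed.

Import HBNNSimple.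

Lemma sup_sintegral_null (g : T -> \bar R) (A : set T) :
  mu set0 = 0%E -> (forall B, B `<=` A -> mu B = 0%E) ->
  (forall x, 0 <= g x)%E -> (forall x, ~ A x -> g x = 0%E) ->
  ereal_sup [set sintegral mu h | h in [set h : {nnsfun T >-> R} |
     forall x, ((h x)%:E <= g x)%E]] = 0%E.
Proof.
move=> mu0 muA g0 gA; apply/eqP; rewrite eq_le; apply/andP; split.
  apply: ge_ereal_sup => _ [h hg <-]; rewrite sintegral_null// => x x0.
  apply: muA => y /= hy; apply: contrapT => nAy.
  have := hg y; rewrite gA// lee_fin => hy0.
  have : h y = 0 by apply/eqP; rewrite eq_le hy0/=; exact: fun_ge0.
  by rewrite hy => xE; rewrite xE eqxx in x0.
apply: ereal_sup_ubound; exists nnsfun0 => //.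
rewrite sintegral_null// => x x0; rewrite (_ : _ @^-1` _ = set0)//.
by apply/seteqP; split => // y /= E; rewrite -E eqxx in x0.
Qed.

(** The set function [mu] may be arbitrary: a simple function below a function that
    lives on [A] takes its nonzero values on subsets of [A], where [mu] vanishes. *)
Lemma integral_null (f : T -> \bar R) (A : set T) :
  mu set0 = 0%E -> (forall B, B `<=` A -> mu B = 0%E) ->
  (forall x, 0 <= f x)%E -> (forall x, ~ A x -> f x = 0%E) ->
  integral mu setT f = 0%E.
Proof.
move=> mu0 muA f0 fA; rewrite /integral !(@sup_sintegral_null _ A) ?sube0//.
- by move=> x nAx; rewrite funenegE patch_setT fA// oppe0 maxxx.
- by move=> x nAx; rewrite funeposE patch_setT fA// maxxx.
Qed.

Lemma integral_set_ge0 (f : T -> \bar R) :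
  mu set0 = 0%E -> (forall B, 0 <= mu B)%E -> (forall x, 0 <= f x)%E ->
  (0 <= integral mu setT f)%E.
Proof.
move=> mu0 mu_ge0 f0; rewrite /integral (@sup_sintegral_null ((f \_ setT)^\-)%E set0)//.
- rewrite sube0; apply: ereal_sup_ubound; exists nnsfun0; first by move=> x /=; exact: funepos_ge0.
  rewrite sintegral_null// => x x0; rewrite (_ : _ @^-1` _ = set0)//.
  by apply/seteqP; split => // y /= E; rewrite -E eqxx in x0.
- by move=> B; rewrite subset0 => ->.
- by move=> x _; rewrite funenegE patch_setT max_r// oppe_le0.
Qed.

End integral_of_set_function.

Section modulus_null.
Context {R : realType} {T : Type} (d : T -> T -> \bar R).

Lemma borel_funT (f : T -> R) :
  (forall x : T, measurable_fun (T := g_sigma_algebraType (@open (mspace_at d x)))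
     setT f) ->
  borel_fun d f.
Proof.
move=> mf B mB; have [[x _]|nT] := pselect (exists x : T, True).
  by have := mf x measurableT B mB; rewrite setTI.
have -> : f @^-1` B = set0 by apply/seteqP; split => // x _; apply: nT; exists x.
by have [] := smallest_sigma_algebra setT (@open (mspace d)).
Qed.

Lemma mintegral_null (mu : set T -> \bar R) (f : T -> \bar R) (A : set T) :
  mu set0 = 0%E -> (forall B, B `<=` A -> mu B = 0%E) ->
  (forall x, 0 <= f x)%E -> (forall x, ~ A x -> f x = 0%E) ->
  mintegral d mu f = 0%E.
Proof.
move=> mu0 muA f0 fA; rewrite /mintegral; case: pselect => // T0.
exact: (@integral_null R _ (g_sigma_algebraType (@open (mspace_at d (sval (cid T0))))) mu f A).
Qed.

Lemma mintegral_ge0 (mu : set T -> \bar R) (f : T -> \bar R) :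
  mu set0 = 0%E -> (forall B, 0 <= mu B)%E -> (forall x, 0 <= f x)%E ->
  (0 <= mintegral d mu f)%E.
Proof.
move=> mu0 muA f0; rewrite /mintegral; case: pselect => // T0.
exact: (@integral_set_ge0 R _ (g_sigma_algebraType (@open (mspace_at d (sval (cid T0))))) mu f).
Qed.

Lemma mspace_open (A : set T) : mopen d A -> @open (mspace d) A.
Proof. by []. Qed.

Lemma lip_open (phi : T -> R) (c e : R) :
  (forall x y, `|phi x - phi y|%:E <= d x y)%E ->
  @open (mspace d) [set y | `|phi y - c| < e].
Proof.
move=> H; apply: mspace_open => x /= xe.
exists (e - `|phi x - c|); first by rewrite subr_gt0.
move=> y; rewrite ltNge => /negP dxy; rewrite ltNge; apply/negP => ye; apply: dxy.
apply: le_trans (H x y); rewrite lee_fin lerBlDr.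
apply: le_trans ye _; rewrite (_ : phi y - c = (phi y - phi x) + (phi x - c)); last by ring.
by rewrite [in leRHS]distrC; exact: ler_normD.
Qed.

Lemma curve_econt (gamma : R -> T) (phi : T -> R) (a b : R) :
  (forall x y, `|phi x - phi y|%:E <= d x y)%E ->
  is_curve d gamma -> 0 < a -> b < 1 -> econt a b (phi \o gamma).
Proof.
move=> H cg a0 b1 t e /andP[at_ tb] e0.
have t01 : t \in `]0, 1[ by rewrite in_itv/= (lt_le_trans a0)// (le_lt_trans tb).
have U : nbhs (gamma t : mspace d) [set y | `|phi y - phi (gamma t)| < e].
  apply: (@open_nbhs_nbhs (mspace d)); split; first exact: lip_open.
  by rewrite /= subrr normr0.
have /nbhs_ballP[del /= d0 Hd] := cg t t01 _ U.
exists del => // t' _ tt; rewrite /= distrC; exact: Hd.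
Qed.

End modulus_null.

Section coordinate_maps.
Context {R : realType} {T : Type} (d : T -> T -> \bar R) {m : nat}
  (t0 : T -> 'rV[R]_m.+1).
Hypothesis d_coord : forall x y i, (`|t0 x 0 i - t0 y 0 i|%:E <= d x y)%E.

Lemma coordinate_open_mspace (A : set 'rV[R]_m.+1) : coordinate_open A ->
  @open (mspace d) (t0 @^-1` A).
Proof.
move=> oA; apply: mspace_open => x /= /oA[del d0 H]; exists del => // y dxy.
by apply: H => i; rewrite -lte_fin; apply: le_lt_trans (d_coord x y i) dxy.
Qed.

Lemma measurable_coordinate (x0 : T) (i : 'I_m.+1) :
  measurable_fun (T := g_sigma_algebraType (@open (mspace_at d x0))) setT
    (fun x => t0 x 0 i).
Proof.
apply: (measurability _ (RGenOpens.measurableE R)) => _ [_ [a [b ->] <-]].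
rewrite setTI; apply: sub_sigma_algebra.
have -> : (fun x => t0 x 0 i) @^-1` `]a, b[ =
    [set y | `|t0 y 0 i - (a + b) / 2| < (b - a) / 2].
  apply/seteqP; split => y /=; rewrite in_itv/= ltr_norml.
    by move=> /andP[? ?]; apply/andP; split; lra.
  by move=> /andP[? ?]; apply/andP; split; lra.
exact: (@lip_open R T d (fun y => t0 y 0 i)).
Qed.

Variables (E : nat -> set 'rV[R]_m.+1).
Hypothesis E_closed : forall k, coordinate_open (~` E k).

Let A : set T := t0 @^-1` (lim_sup_set E).

Definition density (x : T) : R := wild (t0 x 0 0) * \1_A x.

Lemma density_ge0 x : 0 <= density x.
Proof. by rewrite mulr_ge0// wild_ge0. Qed.

Lemma density_borel : borel_fun d density.
Proof.
apply: borel_funT => x0; apply: measurable_funM.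
  apply: (measurableT_comp (f := wild)); first exact: measurable_wild.
  exact: measurable_coordinate.
apply: measurable_indic.
have -> : A = \bigcap_n \bigcup_(k >= n) (t0 @^-1` E k) by [].
apply: bigcap_measurable => // n _; apply: bigcup_measurable => k _.
rewrite -(setCK (t0 @^-1` E k)); apply: measurableC; apply: sub_sigma_algebra.
exact: (coordinate_open_mspace (E_closed (k := k))).
Qed.

Variables (Psi : nat -> 'rV[R]_m.+1 -> R) (h : nat -> R).
Hypothesis Psi_lip : forall k, sup_lipschitz (Psi k).
Hypothesis Psi_le : forall k z, Psi k z <= h k.
Hypothesis h0 : h @ \oo --> (0 : R).
Hypothesis A_null : hausdorff_measure d m.+1 A = 0%E.

(** [density] lives on a null set, so that no power of it has a positive integral. A
    non-vertical curve contains two points with different first coordinates, and the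
    line integral is large already on the arc between them. *)
Lemma modulus_null_of_detected (p : R) (Gamma : set (R -> T)) : 0 < p ->
  (forall gamma, Gamma gamma -> [/\ is_curve d gamma, ~ vertical t0 gamma &
     forall k (a b : R), 0 < a -> a <= b -> b < 1 ->
       detected (t0 \o gamma) (Psi k) (E k) a b]) ->
  modulus d (hausdorff_measure d m.+1) p Gamma = 0%E.
Proof.
move=> p0 HG; apply/eqP; rewrite eq_le; apply/andP; split; last first.
  apply: le_ereal_inf_tmp => _ [rho [_ rho0 _] <-].
  apply: mintegral_ge0 => [|B|x].
  - exact: hausdorff_measure0.
  - exact: hausdorff_measure_ge0.
  - by rewrite lee_fin powR_ge0.
apply: ereal_inf_lbound; exists density; last first.
  apply: (@mintegral_null R T d _ _ A).
  - exact: hausdorff_measure0.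
  - move=> B BA; apply/eqP; rewrite eq_le hausdorff_measure_ge0 andbT -A_null.
    exact: hausdorff_measure_sub.
  - by move=> x; rewrite lee_fin powR_ge0.
  - move=> x nAx; rewrite /density indicE memNset// mulr0 powR0//.
    by rewrite gt_eqF.
split; [exact: density_borel|exact: density_ge0|].
move=> gamma /HG[cg nv det] rg.
have [a [b [a0 ab b1 xab]]] : exists a b : R, [/\ 0 < a, a < b, b < 1 &
    t0 (gamma a) 0 0 != t0 (gamma b) 0 0].
  apply: contrapT => nab; apply: nv; exists (t0 (gamma (1 / 2)) 0 0) => t.
  rewrite in_itv/= => /andP[t_0 t_1]; apply: contrapT => /eqP ne; apply: nab.
  have := ne; case: (ltgtP t (1 / 2)) => [th _|ht _|->]; last by rewrite eqxx.
    by exists t, (1 / 2); split => //; lra.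
  by exists (1 / 2), t; split => //; rewrite eq_sym.
apply: (@le_trans _ _ (\int[lebesgue_measure]_(u in `[0%R, fine (curve_length d gamma a b)])
    (density (arc_point d gamma a b u))%:E)%E); last first.
  by apply: ereal_sup_ubound; exists (a, b).
apply: (detected_integral_ge1 d_coord (ltW ab) (rg a b a0 ab b1) _ Psi_lip Psi_le
  h0 E_closed (fun k => det k a b a0 (ltW ab) b1) xab).
- by move=> i; apply: (curve_econt (phi := fun x => t0 x 0 i)) cg a0 b1.
- exact: density_ge0.
- by move=> x Ax; rewrite /density indicE mem_set// mulr1.
Qed.

End coordinate_maps.

Definition cell {R : realType} {m G : nat} (w : 'I_(2 ^ G) ^ m.+1) : set 'rV[R]_m.+1 :=
  [set z : 'rV[R]_m.+1 | forall i, (w i)%:R / 2 ^+ G <= z 0 i <= ((w i)%:R + 1) / 2 ^+ G].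

Definition bad_cells {R : realType} {m : nat} (P : seq (plate R m)) (G : nat)
    : {set 'I_(2 ^ G) ^ m.+1} :=
  [set w | ~~ `[< exists2 b, b \in P & cell w `<=` core b >] ]%SET.

Lemma sume_le_const (R : realType) (I : eqType) (s : seq I) (f : I -> \bar R) (c : R) :
  (forall x, x \in s -> f x <= c%:E)%E ->
  (\sum_(x <- s) f x <= ((size s)%:R * c)%:E)%E.
Proof.
elim: s => [|x s IH] H; first by rewrite big_nil mul0r.
rewrite big_cons/= -natr1 mulrDl mul1r EFinD [leRHS]addeC; apply: leeD.
  by apply: H; rewrite mem_head.
by apply: IH => y ys; apply: H; rewrite in_cons ys orbT.
Qed.

Section null_limsup.
Context {R : realType} {T : Type} (d : T -> T -> \bar R) {m : nat}
  (t0 : T -> 'rV[R]_m.+1).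
(* [L w] lists the sets that cover the part of the space over the cell [w]: one set,
   or one for each copy in the double. *)
Variables (C : R) (N : nat) (L : forall G, 'I_(2 ^ G) ^ m.+1 -> seq (set T)).
Hypothesis C0 : 0 <= C.
Hypothesis L_size : forall G w, (size (@L G w) <= N)%N.
Hypothesis L_diam : forall G w B, B \in @L G w -> (0 < G)%N ->
  (set_diam d B <= (C / 2 ^+ G)%:E)%E.
Hypothesis L_cover : forall x G, (0 < G)%N -> (forall i, 0 <= t0 x 0 i <= 1) ->
  exists w B, [/\ B \in @L G w, B x & cell w (t0 x)].
Variables (P : nat -> seq (plate R m)) (G : nat -> nat).
Hypothesis G_gt0 : forall k, (0 < G k)%N.
Hypothesis G_small : forall k, 1 / 2 ^+ G k <= 1 / 4 ^+ k :> R.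
Hypothesis bad_small : forall k,
  #|bad_cells (P k) (G k)|%:R <= 1 / 4 ^+ k * (2 ^+ G k) ^+ m.+1 :> R.

(** Borel-Cantelli: the sets over the bad cells of the stages [k >= K] form a cover,
    and their [m.+1]-dimensional sizes add up to a geometric series. Of the factor
    [1 / 4 ^+ k] one half, [1 / 2 ^+ k], absorbs the constants. *)
Lemma limsup_uncovered_null :
  hausdorff_measure d m.+1 (t0 @^-1` lim_sup_set (fun k => uncovered (P k))) = 0%E.
Proof.
apply: hausdorff_measure_null => delta eps d0 e0.
have M0 : 0 <= N%:R * C ^+ m.+1 * 2 by rewrite !mulr_ge0// exprn_ge0.
have [K1 HK1] := exists_small C0 d0.
have [K2 HK2] := exists_small M0 e0.
pose K := maxn K1 K2.
pose s k := if (k < K)%N then [::] else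
  flatten [seq L w | w <- enum (bad_cells (P k) (G k))].
have sL k B : B \in s k -> (K <= k)%N /\ exists2 w, w \in bad_cells (P k) (G k) & B \in L w.
  rewrite /s; case: ltnP => // Kk /flattenP[_ /mapP[w + ->]] BL.
  by rewrite mem_enum => wb; split => //; exists w.
have two_four k : (2 : R) ^+ k * 2 ^+ k = 4 ^+ k by rewrite -exprMn; congr (_ ^+ _); ring.
have [F [F1 F2 F3]] : exists F : nat -> set T, [/\
    forall k l, exists i, F i = nth set0 (s k) l,
    forall i, exists k l, F i = nth set0 (s k) l &
    (\sum_(i <oo) set_diam d (F i) ^+ m.+1 <= \sum_(k <oo) (eps / (2 ^ k.+1)%:R)%:E)%E].
  apply: flatten_cover => k; rewrite /s; case: ltnP => Kk.
    by rewrite big_nil lee_fin divr_ge0// ltW.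
  rewrite big_flatten/= big_map.
  pose c : R := N%:R * (C / 2 ^+ G k) ^+ m.+1.
  have c0 : 0 <= C / 2 ^+ G k by rewrite divr_ge0// exprn_ge0.
  apply: (@le_trans _ _ ((size (enum (bad_cells (P k) (G k))))%:R * c)%:E).
    apply: sume_le_const => w _.
    apply: (@le_trans _ _ ((size (L w))%:R * (C / 2 ^+ G k) ^+ m.+1)%:E).
      apply: sume_le_const => B BL; rewrite (EFin_expe _ m.+1).
      by apply: (@expe_mono _ _ _ m.+1); [exact: set_diam_ge0|exact: (L_diam BL (G_gt0 k))].
    by rewrite lee_fin ler_wpM2r ?exprn_ge0// ler_nat.
  rewrite lee_fin -cardE.
  apply: (@le_trans _ _ (1 / 4 ^+ k * (2 ^+ G k) ^+ m.+1 * c)).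
    by rewrite ler_wpM2r// mulr_ge0// exprn_ge0.
  rewrite /c exprMn exprVn.
  have -> : 1 / 4 ^+ k * (2 ^+ G k) ^+ m.+1 * (N%:R * (C ^+ m.+1 / (2 ^+ G k) ^+ m.+1)) =
     (N%:R * C ^+ m.+1 * 2) / 2 ^+ k / (2 ^ k.+1)%:R.
    rewrite -two_four natrX (exprS _ k).
    have : (2 ^+ G k) ^+ m.+1 != 0 :> R by rewrite !expf_neq0.
    have : 2 ^+ k != 0 :> R by rewrite expf_neq0.
    move: ((2 ^+ G k) ^+ m.+1) (2 ^+ k) (C ^+ m.+1) => X Y Z Y0 X0; field.
    by rewrite Y0 X0.
  rewrite ler_wpM2r//; apply: HK2; apply: leq_trans Kk; exact: leq_maxr.
exists F; split.
- move=> x Ax; have [k Kk Ek] := Ax K I.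
  have [x01 nc] := Ek.
  have [w [B [BL Bx cx]]] := L_cover (G_gt0 k) x01.
  have Bs : B \in s k.
    rewrite /s ltnNge Kk/=; apply/flattenP; exists (L w) => //; apply: map_f.
    rewrite mem_enum inE; apply/negP => /asboolP[b bP wb].
    exact: nc bP (wb _ cx).
  have [i Fi] := F1 k (index B (s k)); exists i => //.
  by rewrite Fi nth_index.
- move=> i; have [k [l ->]] := F2 i.
  have [ls|sl] := ltnP l (size (s k)); last by rewrite nth_default// set_diam0 lee_fin ltW.
  have [Kk [w _ BL]] := sL k _ (mem_nth set0 ls).
  apply: le_trans (L_diam BL (G_gt0 k)) _; rewrite lee_fin.
  apply: le_trans (HK1 k (leq_trans (leq_maxl _ _) Kk)).
  rewrite ler_wpM2l// -[leLHS]mul1r; apply: le_trans (G_small k) _.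
  rewrite mul1r lef_pV2 ?posrE ?exprn_gt0// -two_four ler_peMr ?exprn_ge0//.
  exact: exprn_ege1 (ler1n _ 2).
- by apply: le_trans F3 _; exact: epsilon_trick0 (ltW e0).
Qed.

End null_limsup.

(** * Greedy selection of dyadic boxes *)

(** The cubes are handled as sets of dyadic cells of one fine generation [G], where
    measures are cardinals. Stage [k < N] looks at the dyadic cubes of generation
    [g k] and, if these carry slits ([act k]), places a box in each cube that no
    earlier box meets. The box has the half-width [1 / 2 ^+ (g k + q k)], made
    smaller by the factor [2 ^+ e] in the first direction. For a cell [w], the cube
    around it is given by the quotients [w i %/ side k] and the place of the cell in
    the cube by the remainders [w i %% side k]; the box occupies the places from
    [low k i] to [low k i + 2 * half_width k i]. *)

Section coordinate_surgery.
Local Open Scope nat_scope.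
Context {n V : nat}.
Implicit Types (w : 'I_V ^ n).

Definition upd w (i : 'I_n) (v : 'I_V) : 'I_V ^ n :=
  [ffun j => if j == i then v else w j].

Lemma upd_same w i v : upd w i v i = v.
Proof. by rewrite ffunE eqxx. Qed.

Lemma upd_other w i v j : j != i -> upd w i v j = w j.
Proof. by rewrite ffunE => /negbTE ->. Qed.

(** Changing one coordinate leads from each cell of [S] to [D] cells of [C], from which
    the cell can be recovered up to one bit. *)
Lemma surgery_card (S C : {set 'I_V ^ n}) (i : 'I_n) (D : nat)
    (f : 'I_V -> 'I_D -> 'I_V) (tag : 'I_V -> bool) :
  (forall w j, w \in S -> upd w i (f (w i) j) \in C) ->
  (forall w w' j j', w \in S -> w' \in S -> f (w i) j = f (w' i) j' ->
     tag (w i) = tag (w' i) -> w i = w' i /\ j = j') ->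
  #|S| * D <= #|C| * 2.
Proof.
move=> fC finj.
pose phi (p : 'I_V ^ n * 'I_D) := (upd p.1 i (f (p.1 i) p.2), tag (p.1 i)).
have <- : #|finset.setX S [set: 'I_D]%SET| = #|S| * D by rewrite cardsX cardsT card_ord.
have <- : #|finset.setX C [set: bool]%SET| = #|C| * 2 by rewrite cardsX cardsT card_bool.
rewrite -(card_in_imset (f := phi)); last first.
  move=> [w j] [w' j']; rewrite !inE/= !andbT => wS wS' [E1 E2].
  have Ei : f (w i) j = f (w' i) j'.
    by have := congr1 (fun u : 'I_V ^ n => u i) E1; rewrite !upd_same.
  have [wi jj] := finj w w' j j' wS wS' Ei E2.
  congr (_, _) => //; apply/ffunP => l; have [->//|li] := eqVneq l i.
  by have := congr1 (fun u : 'I_V ^ n => u l) E1; rewrite !upd_other.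
apply: subset_leq_card; apply/fintype.subsetP => _ /imsetP[[w j] + ->].
by rewrite !inE/= !andbT => wS; exact: fC.
Qed.

End coordinate_surgery.

Section greedy.
Local Open Scope nat_scope.
Context {m : nat} (G N e : nat) (g q : nat -> nat) (act : nat -> bool).
Hypothesis g_le : forall k, k < N -> g k <= G.
Hypothesis g_inc : forall j k, j < k -> k < N -> g j < g k.
Hypothesis fits : forall k, k < N -> act k -> g k + q k + e.*2 <= G.
Hypothesis q_ge2 : forall k, k < N -> act k -> 2 <= q k.

Notation Om := ('I_(2 ^ G) ^ m.+1)%type.
Implicit Types (w : Om) (i : 'I_m.+1) (k : nat).

Definition side k := 2 ^ (G - g k).
Definition thin i := if i == ord0 then e else 0.
Definition half_width k i := 2 ^ (G - g k - q k - thin i).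
Definition low k i := 2 ^ (G - g k).-1 - half_width k i.
(** Cells in a shell of relative width [1 / 2 ^+ e] along the faces of a box are given
    up: they may meet the box without lying in its core. *)
Definition shell_width k i := 2 ^ ((G - g k - q k - thin i - e).+1).

Lemma side_gt0 k : 0 < side k. Proof. by rewrite expn_gt0. Qed.

Lemma half_width_le k i : k < N -> act k ->
  half_width k i <= 2 ^ (G - g k).-1.
Proof.
move=> kN ak; rewrite leq_exp2l//; have := fits kN ak; have := q_ge2 kN ak.
by rewrite /thin; case: ifP => _; lia.
Qed.

Lemma side_half k : k < N -> act k -> side k = 2 ^ (G - g k).-1 + 2 ^ (G - g k).-1.
Proof.
move=> kN ak; have := fits kN ak; have := q_ge2 kN ak => h1 h2.
by rewrite /side addnn -mul2n -expnS prednK//; lia.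
Qed.

Lemma high_le k i : k < N -> act k -> low k i + (half_width k i).*2 <= side k.
Proof.
move=> kN ak; have := half_width_le i kN ak; rewrite (side_half kN ak) /low; lia.
Qed.

Lemma shell_widthM k i : k < N -> act k ->
  2 ^ e * shell_width k i = (half_width k i).*2.
Proof.
move=> kN ak; have := fits kN ak; have := q_ge2 kN ak => h1 h2.
rewrite /shell_width /half_width -expnD -mul2n -expnS; congr (_ ^ _).
by rewrite /thin; case: ifP => _; lia.
Qed.

Definition in_box k w : bool :=
  act k && [forall i, low k i <= w i %% side k < low k i + (half_width k i).*2].

Definition same k w w' : bool := [forall i, w i %/ side k == w' i %/ side k].

Fixpoint covered k : {set Om} :=
  if k is k'.+1 then
    (covered k' :|: [set w | [forall w' : Om, same k' w w' ==> (w' \notin covered k')]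
                             && in_box k' w])%SET
  else finset.set0.

Definition free k : {set Om} :=
  [set w | [forall w' : Om, same k w w' ==> (w' \notin covered k)]]%SET.

Definition chosen k : {set Om} := [set w in free k | in_box k w]%SET.

Lemma coveredS k : covered k.+1 = (covered k :|: chosen k)%SET.
Proof. by apply/setP => w; rewrite !inE. Qed.

Lemma same_refl k w : same k w w. Proof. exact/forallP. Qed.

Lemma same_sym k w w' : same k w w' = same k w' w.
Proof. by apply/forallP/forallP => H i; rewrite eq_sym. Qed.

Lemma same_trans k w w' w'' : same k w w' -> same k w' w'' -> same k w w''.
Proof. by move=> /forallP H1 /forallP H2; apply/forallP => i; rewrite (eqP (H1 i)). Qed.

Lemma same_le j k w w' : j <= k -> k < N -> same k w w' -> same j w w'.
Proof.
move=> jk kN /forallP H; apply/forallP => i; have gjk : g j <= g k.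
  by move: jk; rewrite leq_eqVlt => /predU1P[->//|jk]; exact: ltnW (g_inc jk kN).
have E : side j = side k * 2 ^ (g k - g j).
  by rewrite /side -expnD; congr (_ ^ _); have := g_le kN; lia.
by rewrite E !divnMA (eqP (H i)).
Qed.

Lemma free_same k w w' : same k w w' -> w \in free k -> w' \in free k.
Proof.
move=> ww; rewrite !inE => /forallP H; apply/forallP => w''; apply/implyP => w1.
by have := H w''; rewrite (same_trans ww w1).
Qed.

Lemma free_not_covered k w : w \in free k -> w \notin covered k.
Proof. by rewrite inE => /forallP/(_ w); rewrite same_refl. Qed.

Lemma covered_le j k : j <= k -> covered j \subset covered k.
Proof.
move=> /subnK <-; elim: (k - j) => [|d IH]; first by rewrite add0n.
by rewrite addSn coveredS; apply: fintype.subset_trans IH _; exact: finset.subsetUl.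
Qed.

Lemma chosen_uniq j k w : w \in chosen j -> w \in chosen k -> j = k.
Proof.
wlog jk : j k / j < k.
  move=> H wj wk; case: (ltngtP j k) => // jk; first exact: H.
  by apply/esym; exact: H.
move=> wj; rewrite inE => /andP[/free_not_covered/negP[]].
by apply: (fintype.subsetP (covered_le jk)); rewrite coveredS inE wj orbT.
Qed.

Lemma coveredP k w : reflect (exists2 j, j < k & w \in chosen j) (w \in covered k).
Proof.
elim: k => [|k IH]; first by apply: (iffP idP) => [|[]]; rewrite ?inE.
rewrite coveredS inE; apply: (iffP orP) => [[/IH[j jk wj]|wk]|[j]].
- by exists j => //; exact: ltnW.
- by exists k.
rewrite ltnS leq_eqVlt => /predU1P[->|jk] wj; first by right.
by left; apply/IH; exists j.
Qed.

Lemma card_coveredS k : #|covered k.+1| = #|covered k| + #|chosen k|.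
Proof.
rewrite coveredS cardsU (_ : covered k :&: chosen k = finset.set0)%SET ?cards0 ?subn0//.
apply/setP => w; rewrite !inE; apply/negP => /andP[wk /andP[fw _]].
have wf : w \in free k by rewrite inE.
by have := free_not_covered wf; rewrite wk.
Qed.

Lemma modn_shift A B lo p : lo + p < B -> (A * B + (lo + p)) %% B = lo + p /\
  (A * B + (lo + p)) %/ B = A.
Proof.
move=> lt; rewrite modnMDl modn_small// divnMDl ?(leq_ltn_trans _ lt)//.
by rewrite divn_small ?addn0.
Qed.

Lemma block_lt k (v : 'I_(2 ^ G)) x : k < N -> x < side k ->
  v %/ side k * side k + x < 2 ^ G.
Proof.
move=> kN xs; have E : 2 ^ G = 2 ^ g k * side k.
  by rewrite /side -expnD subnKC// g_le.
have vA : v %/ side k < 2 ^ g k by rewrite ltn_divLR ?side_gt0// -E.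
have : (v %/ side k).+1 * side k <= 2 ^ g k * side k by rewrite leq_mul2r vA orbT.
by rewrite -E mulSn; lia.
Qed.

(** A free cube keeps a fixed fraction of its cells inside its box: moving the
    residue of each coordinate into the box forgets only a label. *)
Lemma chosen_card k : k < N -> act k ->
  #|free k| <= #|chosen k| * (2 ^ (q k + e)) ^ m.+1.
Proof.
move=> kN ak.
have h0 i : 0 < (half_width k i).*2 by rewrite double_gt0 expn_gt0.
have in_lt i x : low k i + x %% (half_width k i).*2 < side k.
  by apply: leq_trans (high_le i kN ak); rewrite ltn_add2l ltn_pmod.
have lab_lt (v : 'I_(2 ^ G)) i : v %% side k %/ (half_width k i).*2 < 2 ^ (q k + e).
  rewrite ltn_divLR//; apply: leq_trans (ltn_pmod _ (side_gt0 k)) _.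
  rewrite /side /half_width -mul2n -expnS -expnD leq_exp2l//.
  by have := fits kN ak; rewrite /thin; case: ifP => _; lia.
pose mv w : Om := [ffun i => Ordinal (block_lt (w i) kN (in_lt i (w i %% side k)))].
pose lab w : 'I_(2 ^ (q k + e)) ^ m.+1 := [ffun i => Ordinal (lab_lt (w i) i)].
pose phi w := (mv w, lab w).
have <- : #|finset.setX (chosen k) [set: 'I_(2 ^ (q k + e)) ^ m.+1]%SET| =
    #|chosen k| * (2 ^ (q k + e)) ^ m.+1.
  by rewrite cardsX cardsT card_ffun !card_ord.
rewrite -(card_in_imset (f := phi)); last first.
  move=> w w' _ _ [E1 E2]; apply/ffunP => i; apply: val_inj => /=.
  have := congr1 (fun u : Om => val (u i)) E1.
  have := congr1 (fun u : 'I_(2 ^ (q k + e)) ^ m.+1 => val (u i)) E2.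
  rewrite !ffunE/= => e2 e1.
  have [m1 d1] := modn_shift (w i %/ side k) (in_lt i (w i %% side k)).
  have [m2 d2] := modn_shift (w' i %/ side k) (in_lt i (w' i %% side k)).
  have ed : w i %/ side k = w' i %/ side k by rewrite -d1 -d2 e1.
  have em : w i %% side k %% (half_width k i).*2 = w' i %% side k %% (half_width k i).*2.
    by apply: (@addnI (low k i)); rewrite -m1 -m2 e1.
  rewrite (divn_eq (w i) (side k)) (divn_eq (w' i) (side k)) ed; congr (_ + _).
  by rewrite (divn_eq (w i %% side k) (half_width k i).*2) em e2 -divn_eq.
apply: subset_leq_card; apply/fintype.subsetP => _ /imsetP[w wF ->].
rewrite /phi finset.in_setX/= finset.in_setT andbT inE; apply/andP; split; last first.
  apply/andP; split => //; apply/forallP => i; rewrite ffunE/=.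
  have [-> _] := modn_shift (w i %/ side k) (in_lt i (w i %% side k)).
  by rewrite leq_addr ltn_add2l ltn_pmod.
apply: free_same wF; apply/forallP => i; rewrite ffunE/=.
by have [_ ->] := modn_shift (w i %/ side k) (in_lt i (w i %% side k)).
Qed.

(** The cells whose cube of generation [g k] touches one of the two hyperplanes that
    bound the boxes of stage [j] in the direction [i]. *)
Definition cut j k i : {set Om} :=
  [set w : Om | ((w i %% side j) %/ side k == low j i %/ side k) ||
           ((w i %% side j) %/ side k == (low j i + (half_width j i).*2) %/ side k)]%SET.

Lemma cut_card j k i : j < k -> k < N ->
  #|cut j k i| * 2 ^ (g k - g j) <= #|[set: Om]%SET| * 2.
Proof.
move=> jk kN; have jN := ltn_trans jk kN.
have gjk := ltnW (g_inc jk kN).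
have E : side j = 2 ^ (g k - g j) * side k.
  by rewrite /side -expnD; congr (_ ^ _); have := g_le kN; lia.
have lt (v : nat) (l : 'I_(2 ^ (g k - g j))) : l * side k + v %% side k < side j.
  rewrite E; apply: (@leq_trans (l.+1 * side k)); last by rewrite leq_mul2r ltn_ord orbT.
  by rewrite mulSn addnC ltn_add2r ltn_pmod// side_gt0.
pose f (v : 'I_(2 ^ G)) (l : 'I_(2 ^ (g k - g j))) : 'I_(2 ^ G) :=
  Ordinal (block_lt v jN (lt v l)).
apply: (surgery_card (f := f) (i := i)
  (tag := fun v => (v %% side j) %/ side k == low j i %/ side k)).
  by move=> w l _; rewrite !inE.
move=> w w' l l' wS wS' /(congr1 val)/= fE tE.
have [m1 d1] := modn_shift (w i %/ side j) (lt (w i) l).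
have [m2 d2] := modn_shift (w' i %/ side j) (lt (w' i) l').
have ed : w i %/ side j = w' i %/ side j by rewrite -d1 -d2 fE.
have em : l * side k + w i %% side k = l' * side k + w' i %% side k.
  by rewrite -m1 -m2 fE.
have s0 := side_gt0 k.
have el : l = l'.
  apply: val_inj => /=; have := congr1 (fun x => x %/ side k) em.
  by rewrite !divnMDl// !divn_small ?addn0 ?ltn_pmod.
have er : w i %% side k = w' i %% side k.
  by move: em; rewrite el => /addnI.
split => //; apply: val_inj => /=.
rewrite (divn_eq (w i) (side j)) (divn_eq (w' i) (side j)) ed; congr (_ + _).
rewrite (divn_eq (w i %% side j) (side k)) (divn_eq (w' i %% side j) (side k)).
have dv : side k %| side j by rewrite E dvdn_mull.
rewrite !modn_dvdm// er; congr (_ * _ + _).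
move: wS wS'; rewrite !inE; move: tE.
case: eqP => [-> /esym/eqP ->//|_ /esym/negbT/negbTE ->/=].
by move=> /eqP -> /eqP ->.
Qed.

(** The cube of [w] contains cells inside and outside an earlier box, so that a face of
    the box cuts it. *)
Lemma uncovered_cut k w : k < N -> w \notin covered k -> w \notin free k ->
  exists j i, j < k /\ w \in cut j k i.
Proof.
move=> kN wY; rewrite inE negb_forall => /existsP[w'].
rewrite negb_imply negbK => /andP[ww /coveredP[j jk wj']].
have jN := ltn_trans jk kN.
have wjs : same j w' w by rewrite same_sym; exact: same_le (ltnW jk) kN ww.
move: wj'; rewrite inE => /andP[wj' /andP[aj /forallP bj]].
have wj : w \in free j by exact: free_same wj'.
have : ~~ in_box j w.
  apply: contra wY => bw; apply/coveredP; exists j => //.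
  by rewrite inE wj.
rewrite /in_box aj/= negb_forall => /existsP[i ni]; exists j, i; split => //.
have E : side j = 2 ^ (g k - g j) * side k.
  by rewrite /side -expnD; congr (_ ^ _); have := g_le kN; have := g_inc jk kN; lia.
have dm (v : nat) : (v %% side j) %/ side k = (v %/ side k) %% 2 ^ (g k - g j).
  by rewrite E modn_divl.
have e1 : (w i %% side j) %/ side k = (w' i %% side j) %/ side k.
  by rewrite !dm; move/forallP : ww => /(_ i)/eqP ->.
rewrite inE; have /andP[lo hi] := bj i.
move: ni; rewrite negb_and -ltnNge -leqNgt => /orP[wl|wh].
  apply/orP; left; rewrite eqn_leq leq_div2r ?(ltnW wl)//=.
  by rewrite e1 leq_div2r.
apply/orP; right; rewrite eqn_leq (leq_div2r _ wh) andbT.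
by rewrite e1 leq_div2r// ltnW.
Qed.

Definition shell k i : {set Om} :=
  [set w in chosen k | (w i %% side k < low k i + shell_width k i) ||
    (low k i + (half_width k i).*2 <= w i %% side k + shell_width k i)]%SET.

Lemma shell_card k i : k < N -> act k -> #|shell k i| * 2 ^ e <= #|chosen k| * 2.
Proof.
move=> kN ak; pose sw := shell_width k i.
have sw0 : 0 < sw by rewrite expn_gt0.
have swM : 2 ^ e * sw = (half_width k i).*2 by exact: shell_widthM.
have lt2 (v : nat) (l : 'I_(2 ^ e)) : l * sw + v %% sw < (half_width k i).*2.
  rewrite -swM; apply: (@leq_trans (l.+1 * sw)); last by rewrite leq_mul2r ltn_ord orbT.
  by rewrite mulSn addnC ltn_add2r ltn_pmod.
have lt (v : nat) (l : 'I_(2 ^ e)) : low k i + (l * sw + v %% sw) < side k.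
  by apply: leq_trans (high_le i kN ak); rewrite ltn_add2l.
pose pos (v : nat) := v %% side k - low k i.
pose f (v : 'I_(2 ^ G)) (l : 'I_(2 ^ e)) : 'I_(2 ^ G) :=
  Ordinal (block_lt v kN (lt (pos v) l)).
have posE w : w \in chosen k -> w i %% side k = low k i + pos (w i) /\
    pos (w i) < (half_width k i).*2.
  rewrite !inE => /andP[_ /andP[_ /forallP/(_ i)/andP[lo hi]]].
  rewrite /pos subnKC//; split => //; lia.
apply: (surgery_card (f := f) (i := i) (tag := fun v => v %% side k < low k i + sw)).
  move=> w l; rewrite inE => /andP[+ _]; rewrite !inE => /andP[wF /andP[_ /forallP bx]].
  have [m1 d1] := modn_shift (w i %/ side k) (lt (pos (w i)) l).
  apply/andP; split.
    have wF' : w \in free k by rewrite inE.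
    suff : upd w i (f (w i) l) \in free k by rewrite inE.
    apply: free_same wF'; apply/forallP => i'; have [->|ii] := eqVneq i' i.
      by rewrite upd_same/= d1.
    by rewrite upd_other.
  rewrite /in_box ak/=; apply/forallP => i'; have [->|ii] := eqVneq i' i.
    by rewrite upd_same/= m1 leq_addr ltn_add2l lt2.
  by rewrite upd_other.
move=> w w' l l'; rewrite !inE => /andP[wc ws] /andP[wc' ws'] /(congr1 val)/= fE tE.
have wC : w \in chosen k by rewrite !inE.
have wC' : w' \in chosen k by rewrite !inE.
have [p1 p1l] := posE w wC; have [p2 p2l] := posE w' wC'.
have [m1 d1] := modn_shift (w i %/ side k) (lt (pos (w i)) l).
have [m2 d2] := modn_shift (w' i %/ side k) (lt (pos (w' i)) l').
have ed : w i %/ side k = w' i %/ side k by rewrite -d1 -d2 fE.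
have em : l * sw + pos (w i) %% sw = l' * sw + pos (w' i) %% sw.
  by apply: (@addnI (low k i)); rewrite -m1 -m2 fE.
have el : l = l'.
  apply: val_inj => /=; have := congr1 (fun x => x %/ sw) em.
  by rewrite !divnMDl// !divn_small ?addn0 ?ltn_pmod.
have er : pos (w i) %% sw = pos (w' i) %% sw by move: em; rewrite el => /addnI.
split => //; apply: val_inj => /=.
rewrite (divn_eq (w i) (side k)) (divn_eq (w' i) (side k)) ed p1 p2; congr (_ + (_ + _)).
rewrite (divn_eq (pos (w i)) sw) (divn_eq (pos (w' i)) sw) er; congr (_ * _ + _).
have small (p : nat) : p < sw -> p %/ sw = 0 by exact: divn_small.
have large (p : nat) : p < (half_width k i).*2 -> (half_width k i).*2 <= p + sw ->
    p %/ sw = (2 ^ e).-1.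
  rewrite -swM => pl pg; apply/eqP; rewrite eqn_leq -ltnS prednK ?expn_gt0//.
  rewrite ltn_divLR// pl/= leq_divRL//.
  by rewrite -subn1 mulnBl mul1n leq_subLR addnC.
move: ws ws' tE; rewrite p1 p2 !ltn_add2l -!addnA !leq_add2l.
case: ltnP => [ps _|ps /= pg]; case: ltnP => [ps' _|ps' /= pg'] // _.
  by rewrite !small.
by rewrite !large.
Qed.

Lemma card_bigcup_le (T : finType) (I : Type) (s : seq I) (P : pred I) (A : I -> {set T}) :
  #|\bigcup_(x <- s | P x) A x| <= \sum_(x <- s | P x) #|A x|.
Proof.
elim/big_ind2: _ => [|B b C c Bb Cc|//]; first by rewrite cards0.
by apply: leq_trans (leq_card_setU _ _) _; exact: leq_add.
Qed.

Lemma card_uncovered k : k < N ->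
  #|~: covered k|%SET <= #|free k| + \sum_(j < k) \sum_i #|cut j k i|.
Proof.
move=> kN; apply: (@leq_trans #|(free k :|: \bigcup_(j < k) \bigcup_i cut j k i)%SET|).
  apply: subset_leq_card; apply/fintype.subsetP => w; rewrite finset.in_setC => wY.
  rewrite finset.in_setU; have [//|wF] := boolP (w \in free k).
  have [j [i [jk wc]]] := uncovered_cut kN wY wF.
  apply/finset.bigcupP; exists (Ordinal jk) => //; apply/finset.bigcupP; exists i => //.
apply: leq_trans (leq_card_setU _ _) _; rewrite leq_add2l.
apply: leq_trans (card_bigcup_le _ _ _) _; apply: leq_sum => j _.
exact: card_bigcup_le.
Qed.

Lemma card_chosen_sum k : \sum_(j < k) #|chosen j| = #|covered k|.
Proof.
elim: k => [|k IH]; first by rewrite big_ord0 cards0.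
by rewrite big_ord_recr/= IH card_coveredS.
Qed.

Lemma chosen_act k w : w \in chosen k -> act k.
Proof. by rewrite inE => /andP[_ /andP[]]. Qed.

Local Open Scope ring_scope.
Context {R : realType} (K : nat).
Hypothesis K_gt0 : (0 < K)%N.
Hypothesis g_gap : forall j k, (j < k)%N -> (k < N)%N -> (K * (k - j) <= g k - g j)%N.

Let total : R := #|[set: Om]%SET|%:R.
Let beta : R := m.+1%:R * (4 / 2 ^+ K).
Let theta k : R := if act k then 1 / (2 ^+ (q k + e)) ^+ m.+1 else 0.

Lemma total_ge0 : 0 <= total. Proof. exact: ler0n. Qed.

Lemma geometric_tail (x : R) k : 0 <= x -> x <= 1 / 2 ->
  \sum_(j < k) x ^+ (k - j) <= 2 * x.
Proof.
move=> x0 x1; elim: k => [|k IH]; first by rewrite big_ord0 mulr_ge0.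
rewrite big_ord_recr/= subSnn expr1.
have -> : \sum_(j < k) x ^+ (k.+1 - j) = x * \sum_(j < k) x ^+ (k - j).
  by rewrite mulr_sumr; apply: eq_bigr => j _; rewrite -exprS subSn// ltnW.
nra.
Qed.

(** The proportion of cells in cubes cut by boxes of stage [j] is geometric in [k - j],
    with a ratio that is small if the generations are [K] apart. *)
Lemma free_large k : (k < N)%N ->
  (1 - beta) * total - #|covered k|%:R <= #|free k|%:R :> R.
Proof.
move=> kN; have := card_uncovered kN; rewrite -(ler_nat R) natrD natr_sum => H.
have cs : \sum_(j < k) (\sum_i #|cut j k i|)%:R <= beta * total.
  pose x : R := 1 / 2 ^+ K.
  have x0 : 0 <= x by rewrite divr_ge0// exprn_ge0.
  have x1 : x <= 1 / 2.
    rewrite /x ler_pM2l// lef_pV2 ?posrE ?exprn_gt0// -[leLHS]expr1.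
    by rewrite ler_eXn2l// ltr1n.
  apply: (@le_trans _ _ (\sum_(j < k) (m.+1%:R * (2 * total)) * x ^+ (k - j))).
    apply: ler_sum => j _; rewrite natr_sum.
    apply: (@le_trans _ _ (\sum_(i < m.+1) (2 * total) * x ^+ (k - j))); last first.
      by rewrite sumr_const card_ord -[leLHS]mulr_natl !mulrA.
    apply: ler_sum => i _; have := cut_card i (ltn_ord j) kN.
    rewrite -(ler_nat R) !natrM natrX => c.
    have p0 : 0 < 2 ^+ (g k - g j) :> R by rewrite exprn_gt0.
    rewrite -ler_pdivlMr// in c; apply: le_trans c _.
    rewrite -/total [total * 2]mulrC; apply: ler_wpM2l; first by rewrite mulr_ge0// total_ge0.
    rewrite /x expr_div_n expr1n -exprM div1r lef_pV2 ?posrE ?exprn_gt0//.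
    by rewrite ler_weXn2l ?ler1n// g_gap.
  rewrite -mulr_sumr; have := geometric_tail k x0 x1 => gt.
  have -> : beta * total = m.+1%:R * (2 * total) * (2 * x) by rewrite /beta /x; ring.
  by rewrite ler_wpM2l// mulr_ge0// mulr_ge0// total_ge0.
have -> : (1 - beta) * total = total - beta * total by rewrite mulrBl mul1r.
have : total = #|covered k|%:R + #|~: covered k|%SET%:R by rewrite -natrD cardsC /total cardsT.
by move=> tE; lra.
Qed.

(** The part of the proportion [1 - beta] that is still uncovered loses a proportion
    [theta k] at stage [k], and [(1 - t) * (1 + S + t) <= 1 + S]. *)
Lemma covered_large k : (k <= N)%N ->
  ((1 - beta) * total - #|covered k|%:R) * (1 + \sum_(j < k) theta j) <= total.
Proof.
have th0 j : 0 <= theta j by rewrite /theta; case: ifP => // _; rewrite divr_ge0// exprn_ge0.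
have S0 k' : 0 <= \sum_(j < k') theta j by rewrite sumr_ge0.
have b0 : 0 <= beta by rewrite mulr_ge0// divr_ge0// exprn_ge0.
elim: k => [|k IH] kN.
  rewrite big_ord0 addr0 mulr1 cards0 subr0 mulrBl mul1r lerBlDr lerDl.
  by rewrite mulr_ge0// total_ge0.
have {IH}IH := IH (ltnW kN); have fl := free_large kN.
have T0 := total_ge0.
rewrite big_ord_recr/= card_coveredS natrD.
set x := (1 - beta) * total - #|covered k|%:R in IH fl *.
have cg : theta k * x <= #|chosen k|%:R.
  rewrite /theta; case: ifP => ak; last by rewrite mul0r.
  have := chosen_card kN ak; rewrite -(ler_nat R) natrM !natrX => c.
  have p0 : 0 < (2 ^+ (q k + e)) ^+ m.+1 :> R by rewrite !exprn_gt0.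
  by rewrite mulrAC mul1r ler_pdivrMr//; apply: le_trans c.
have t1 : theta k <= 1.
  rewrite /theta; case: ifP => // _; rewrite ler_pdivrMr ?exprn_gt0// mul1r.
  by rewrite exprn_ege1// exprn_ege1// ler1n.
have -> : (1 - beta) * total - (#|covered k|%:R + #|chosen k|%:R) = x - #|chosen k|%:R.
  by rewrite /x; ring.
have := S0 k; have := th0 k; move: (\sum_(j < k) _) IH => S IH t0 S0'.
have [x0|x0] := leP 0 x.
  apply: (@le_trans _ _ ((1 - theta k) * x * (1 + (S + theta k)))).
    by apply: ler_wpM2r; [lra|lra].
  apply: le_trans IH; rewrite mulrAC [leRHS]mulrC; apply: ler_wpM2r => //.
  nra.
apply: le_trans T0; apply: mulr_le0_ge0; last by lra.
have : 0 <= #|chosen k|%:R :> R by [].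
lra.
Qed.

Lemma final_card (bad : {set Om}) :
  (forall w, w \in bad -> w \in covered N ->
     exists k i, (k < N)%N /\ w \in shell k i) ->
  #|bad|%:R <= total * (1 / (1 + \sum_(j < N) theta j) + beta + m.+1%:R * (2 / 2 ^+ e)).
Proof.
move=> H.
have th0 j : 0 <= theta j by rewrite /theta; case: ifP => // _; rewrite divr_ge0// exprn_ge0.
have S0 : 0 < 1 + \sum_(j < N) theta j by rewrite ltr_pwDl// sumr_ge0.
have le1 : (#|bad| <= #|~: covered N|%SET + \sum_(k < N) \sum_i #|shell k i|)%N.
  apply: (@leq_trans #|(~: covered N :|: \bigcup_(k < N) \bigcup_i shell k i)%SET|).
    apply: subset_leq_card; apply/fintype.subsetP => w wb.
    rewrite finset.in_setU finset.in_setC; have [wc|//] := boolP (w \in covered N).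
    have [k [i [kN ws]]] := H w wb wc.
    apply/finset.bigcupP; exists (Ordinal kN) => //; apply/finset.bigcupP; exists i => //.
  apply: leq_trans (leq_card_setU _ _) _; rewrite leq_add2l.
  apply: leq_trans (card_bigcup_le _ _ _) _; apply: leq_sum => j _.
  exact: card_bigcup_le.
have p0 : 0 < 2 ^+ e :> R by rewrite exprn_gt0.
have le2 : \sum_(k < N) (\sum_i #|shell k i|)%:R <= total * (m.+1%:R * (2 / 2 ^+ e)).
  apply: (@le_trans _ _ (\sum_(k < N) m.+1%:R * (2 / 2 ^+ e) * #|chosen k|%:R)).
    apply: ler_sum => k _; rewrite natr_sum.
    apply: (@le_trans _ _ (\sum_(i < m.+1) (2 / 2 ^+ e) * #|chosen k|%:R)); last first.
      by rewrite sumr_const card_ord -[leLHS]mulr_natl !mulrA.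
    apply: ler_sum => i _; have [ak|nak] := boolP (act k).
      have := shell_card i (ltn_ord k) ak; rewrite -(ler_nat R) !natrM natrX => c.
      by rewrite mulrAC ler_pdivlMr// [leRHS]mulrC.
    rewrite (_ : #|shell k i| = 0%N) ?mulr_ge0// ?divr_ge0 ?ltW//.
    apply/eqP; rewrite cards_eq0; apply/eqP/setP => w; rewrite finset.in_set0 inE.
    by apply/negP => /andP[/chosen_act]; rewrite (negbTE nak).
  rewrite -mulr_sumr -natr_sum card_chosen_sum [leRHS]mulrC ler_wpM2l//.
  by rewrite ler_nat /total cardsT max_card.
move: le1; rewrite -(ler_nat R) natrD natr_sum => le1.
apply: le_trans le1 _; rewrite mulrDr; apply: lerD => //.
have cl := covered_large (leqnn N).
have : total = #|covered N|%:R + #|~: covered N|%SET%:R by rewrite -natrD cardsC /total cardsT.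
move=> tE; rewrite mulrDr -lerBlDr div1r ler_pdivlMr//.
by apply: le_trans cl; rewrite ler_wpM2r ?(ltW S0)//; lra.
Qed.

Definition box_center k w : 'rV[R]_m.+1 :=
  \row_i (((w i %/ side k)%N%:R + 2^-1) / 2 ^+ g k).

Definition item k w : plate R m :=
  (box_center k w, 1 / 2 ^+ (g k + q k), 1 / 2 ^+ (g k + q k + e)).

Lemma side_real k : (k < N)%N -> (side k)%:R = 2 ^+ G / 2 ^+ g k :> R.
Proof.
move=> kN; rewrite /side natrX; apply: (@mulIf _ (2 ^+ g k)); first by rewrite expf_neq0.
by rewrite divfK ?expf_neq0// -exprD subnK// g_le.
Qed.

Lemma half_width_real k i : (k < N)%N -> act k ->
  (half_width k i)%:R = 2 ^+ G * (1 / 2 ^+ (g k + q k + thin i)) :> R.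
Proof.
move=> kN ak; have := fits kN ak => ft.
have tl : (thin i <= e)%N by rewrite /thin; case: ifP.
rewrite /half_width natrX; apply: (@mulIf _ (2 ^+ (g k + q k + thin i))).
  by rewrite expf_neq0.
rewrite -exprD mulrA mulr1 divfK ?expf_neq0//; congr (_ ^+ _); lia.
Qed.

Lemma box_coordinates k w i : (k < N)%N -> act k ->
  2 ^+ G * (box_center k w 0 i - 1 / 2 ^+ (g k + q k + thin i)) =
    (w i %/ side k * side k + low k i)%N%:R /\
  2 ^+ G * (box_center k w 0 i + 1 / 2 ^+ (g k + q k + thin i)) =
    (w i %/ side k * side k + (low k i + (half_width k i).*2))%N%:R.
Proof.
move=> kN ak; have hl := half_width_le i kN ak.
have hw := half_width_real i kN ak; have sr := side_real kN.
have sh : (2 ^ (G - g k).-1)%N%:R = (side k)%:R / 2 :> R.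
  by rewrite (side_half kN ak) natrD; lra.
have lr : (low k i)%:R = (side k)%:R / 2 - (half_width k i)%:R :> R.
  by rewrite /low natrB// sh.
have cE : 2 ^+ G * box_center k w 0 i = (w i %/ side k)%N%:R * (side k)%:R + (side k)%:R / 2.
  by rewrite mxE sr; ring.
split; first by rewrite mulrBr -hw cE natrD natrM lr; lra.
by rewrite mulrDr -hw cE natrD natrM natrD -muln2 natrM lr; lra.
Qed.

Lemma item_near k w z i : plate_dist (item k w) z < ph (item k w) ->
  `|z 0 i - box_center k w 0 i| < 1 / 2 ^+ (g k + q k + thin i).
Proof.
move=> zh; have /plate_dist_leP[H0 H] := lexx (plate_dist (item k w) z).
rewrite /thin; have [->|i0] := eqVneq i ord0; first exact: le_lt_trans H0 zh.
by have := le_lt_trans (H i i0) zh; rewrite addn0 /pc /ph /prho /=; lra.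
Qed.

(** A point of a box lies in a cell of that box, so that boxes are disjoint if their
    sets of cells are. *)
Lemma item_cell k w z : (k < N)%N -> act k ->
  plate_dist (item k w) z < ph (item k w) ->
  exists v : Om, [/\ same k w v, in_box k v &
    forall i, v i = Num.truncn (2 ^+ G * z 0%R i) :> nat].
Proof.
move=> kN ak zh.
have G0 : 0 < 2 ^+ G :> R by rewrite exprn_gt0.
have bd i : (w i %/ side k * side k + low k i <= Num.truncn (2 ^+ G * z 0%R i))%N /\
    (Num.truncn (2 ^+ G * z 0%R i) <
     w i %/ side k * side k + (low k i + (half_width k i).*2))%N.
  have [e1 e2] := box_coordinates w i kN ak.
  have := item_near i zh; rewrite ltr_norml ltrBlDr => /andP[z1 z2].
  have z0 : (w i %/ side k * side k + low k i)%N%:R <= 2 ^+ G * z 0%R i.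
    by rewrite -e1 ler_pM2l//; lra.
  have zz : 0 <= 2 ^+ G * z 0%R i by apply: le_trans z0.
  split; first by rewrite truncn_ge_nat.
  by rewrite truncn_lt_nat// -e2 ltr_pM2l//; lra.
have lt i : (Num.truncn (2 ^+ G * z 0%R i) < 2 ^ G)%N.
  have [b1 b2] := bd i; have hl := high_le i kN ak.
  have hx : ((side k).-1 < side k)%N by rewrite prednK// side_gt0.
  by have := block_lt (w i) kN hx; lia.
exists [ffun i => Ordinal (lt i)].
have ps i : exists2 p, (p < (half_width k i).*2)%N &
    Num.truncn (2 ^+ G * z 0%R i) = (w i %/ side k * side k + (low k i + p))%N.
  have [b1 b2] := bd i.
  exists (Num.truncn (2 ^+ G * z 0%R i) - (w i %/ side k * side k + low k i))%N; lia.
split => [||i]; last by rewrite ffunE.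
- apply/forallP => i; rewrite ffunE/=; have [p pl ->] := ps i.
  have pl' : (low k i + p < side k)%N by apply: leq_trans (high_le i kN ak); rewrite ltn_add2l.
  by have [_ ->] := modn_shift (w i %/ side k) pl'.
- rewrite /in_box ak/=; apply/forallP => i; rewrite ffunE/=; have [p pl ->] := ps i.
  have pl' : (low k i + p < side k)%N by apply: leq_trans (high_le i kN ak); rewrite ltn_add2l.
  by have [-> _] := modn_shift (w i %/ side k) pl'; rewrite leq_addr ltn_add2l.
Qed.

Lemma item_same k w v : same k w v -> item k w = item k v.
Proof.
move=> /forallP H; rewrite /item; congr (_, _, _).
by apply/rowP => i; rewrite !mxE (eqP (H i)).
Qed.

Lemma items_disjoint k k' w w' z : (k < N)%N -> (k' < N)%N -> act k -> act k' ->
  w \in free k -> w' \in free k' ->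
  plate_dist (item k w) z < ph (item k w) ->
  plate_dist (item k' w') z < ph (item k' w') -> item k w = item k' w'.
Proof.
move=> kN kN' ak ak' wf wf' /(item_cell kN ak)[v [wv bv Ev]].
move=> /(item_cell kN' ak')[v' [wv' bv' Ev']].
have vv : v' = v by apply/ffunP => i; apply: val_inj; rewrite /= Ev Ev'.
rewrite {}vv in wv' bv' Ev'.
have vk : v \in chosen k by rewrite inE (free_same wv wf).
have vk' : v \in chosen k' by rewrite inE (free_same wv' wf').
rewrite -(chosen_uniq vk vk') in wv' *.
by rewrite (item_same wv) (item_same wv').
Qed.

(** A cell outside the shell is farther from the side faces of the box than its
    height, by which the core is narrower than the box. *)
Lemma core_of_cell k w : (k < N)%N -> w \in chosen k ->
  (forall i, w \notin shell k i) -> cell w `<=` core (item k w).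
Proof.
move=> kN wc ns z zw; have ak := chosen_act wc.
have G0 : 0 < 2 ^+ G :> R by rewrite exprn_gt0.
have near i : `|z 0 i - box_center k w 0 i| <=
    1 / 2 ^+ (g k + q k + thin i) - 2 / 2 ^+ (g k + q k + thin i + e).
  have [e1 e2] := box_coordinates w i kN ak.
  have : (low k i + shell_width k i <= w i %% side k)%N /\
      (w i %% side k + shell_width k i < low k i + (half_width k i).*2)%N.
    by have := ns i; rewrite inE wc/= negb_or -leqNgt -ltnNge => /andP[].
  have := divn_eq (w i) (side k) => wE [s1 s2].
  have swr : (shell_width k i)%:R = 2 ^+ G * (2 / 2 ^+ (g k + q k + thin i + e)) :> R.
    have := shell_widthM i kN ak => /(congr1 (fun x : nat => x%:R : R)).
    rewrite natrM natrX -muln2 natrM (half_width_real i kN ak) => E.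
    apply: (@mulfI _ (2 ^+ e)); first by rewrite expf_neq0.
    rewrite E (exprD _ (g k + q k + thin i) e).
    have : 2 ^+ (g k + q k + thin i) != 0 :> R by rewrite expf_neq0.
    have : 2 ^+ e != 0 :> R by rewrite expf_neq0.
    move: (2 ^+ (g k + q k + thin i)) (2 ^+ e) (2 ^+ G) => A B C B0 A0; field.
    by rewrite A0 B0.
  have := zw i; rewrite ler_pdivrMr// ler_pdivlMr// => /andP[z1 z2].
  have b1 : (w i %/ side k * side k + low k i)%N%:R + (shell_width k i)%:R <= (w i)%:R :> R.
    by rewrite -natrD ler_nat; lia.
  have b2 : (w i)%:R + 1 + (shell_width k i)%:R <=
      (w i %/ side k * side k + (low k i + (half_width k i).*2))%N%:R :> R.
    by rewrite natr1 -natrD ler_nat; lia.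
  rewrite -e1 swr in b1; rewrite -e2 swr in b2.
  rewrite ler_norml; apply/andP; split.
    rewrite -(ler_pM2l G0); lra.
  rewrite -(ler_pM2l G0); lra.
have p2 n : 0 < 1 / 2 ^+ n :> R by rewrite divr_gt0// exprn_gt0.
apply/coreP; split.
  apply: le_lt_trans (near ord0) _; rewrite /ph/= /thin eqxx.
  by have := p2 (g k + q k + e + e)%N; lra.
move=> j j0; apply: le_lt_trans (near j) _; rewrite /ph /prho/= /thin (negbTE j0) addn0.
by have := p2 (g k + q k + e)%N; lra.
Qed.

Definition items : seq (plate R m) :=
  flatten [seq [seq item k w | w <- enum (free k)] | k <- [seq k <- iota 0 N | act k]].

Lemma itemsP b : b \in items -> exists k w, [/\ (k < N)%N, act k, w \in free k & b = item k w].
Proof.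
move=> /flattenP[_ /mapP[k + ->] /mapP[w + ->]].
rewrite mem_filter mem_iota add0n mem_enum => /andP[ak kN] wf.
by exists k, w.
Qed.

Lemma mem_items k w : (k < N)%N -> act k -> w \in free k -> item k w \in items.
Proof.
move=> kN ak wf; apply/flattenP; exists [seq item k w | w <- enum (free k)].
  by apply/mapP; exists k => //; rewrite mem_filter ak mem_iota.
by apply/mapP; exists w => //; rewrite mem_enum.
Qed.

Lemma items_bad_card :
  #|bad_cells items G|%:R <= total * (1 / (1 + \sum_(j < N) theta j) + beta + m.+1%:R * (2 / 2 ^+ e)).
Proof.
apply: final_card => w; rewrite inE => /asboolPn nb /coveredP[k kN wk].
exists k; have [[i ws]|ns] := pselect (exists i, w \in shell k i); first by exists i.
exfalso; apply: nb; exists (item k w).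
  by apply: mem_items; [|exact: chosen_act wk|move: wk; rewrite inE => /andP[]].
apply: core_of_cell => // i; apply/negP => ws; apply: ns; by exists i.
Qed.

End greedy.

(** * Packing *)

Definition on_slit {R : realType} {m : nat} (r : nat -> R) (b : plate R m) : Prop :=
  exists (i : nat) (k : 'I_(2 ^ i) ^ m.+1), 0 < r i /\
    forall z, plate_dist b z < ph b -> z 0 0 = pc b 0 0 -> dyadic_slit r k z.

Lemma sum_residues (R : realType) (f : nat -> R) (K N : nat) :
  \sum_(0 <= i < K * N) f i = \sum_(a < K) \sum_(j < N) f (a + K * j)%N.
Proof.
elim: N => [|N IH].
  by rewrite muln0 big_geq// big1// => a _; rewrite big_ord0.
rewrite mulnS addnC (@big_cat_nat _ _ _ (K * N))//= ?leq_addr// IH.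
under [RHS]eq_bigr do rewrite big_ord_recr/=.
rewrite big_split/=; congr (_ + _).
by rewrite -[X in \sum_(X <= _ < _) _]add0n big_addn addKn big_mkord.
Qed.

(** Otherwise the sums over all [K] residue classes would be bounded. *)
Lemma unbounded_residue (R : realType) (f : nat -> R) (K : nat) (M : R) :
  (forall i, 0 <= f i) -> (0 < K)%N -> (\sum_(i <oo) (f i)%:E = +oo)%E ->
  exists a N, M <= \sum_(j < N) f (a + K * j)%N.
Proof.
move=> f0 K0 foo.
have unb B : exists n, B <= \sum_(0 <= i < n) f i.
  apply: contrapT => nB.
  suff : (\sum_(i <oo) (f i)%:E <= B%:E)%E by rewrite foo.
  apply: lime_le; first by apply: is_cvg_nneseries => n _ _; rewrite lee_fin.
  apply: nearW => n; rewrite sumEFin lee_fin leNgt; apply/negP => Bn.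
  by apply: nB; exists n; exact: ltW.
apply: contrapT => na.
have [n' nB'] := unb (K%:R * `|M| + 1).
have : \sum_(0 <= i < K * n') f i < K%:R * `|M| + 1.
  rewrite sum_residues; apply: (@le_lt_trans _ _ (\sum_(a < K) `|M|)); last first.
    by rewrite sumr_const card_ord -[ltLHS]mulr_natl ltrDl.
  apply: ler_sum => a _; apply: ltW; apply: lt_le_trans (ler_norm M).
  by rewrite ltNge; apply/negP => Ma; apply: na; exists a, n'.
apply/negP; rewrite -leNgt; apply: le_trans nB' _.
rewrite (@big_cat_nat _ _ _ n' 0 (K * n'))//= ?lerDl ?sumr_ge0//.
by rewrite leq_pmull.
Qed.

Lemma dyadic_size (R : realType) (x : R) : 0 < x < 1 ->
  exists q, [/\ (2 <= q)%N, 1 / 2 ^+ q <= x / 2 & x / 4 <= 1 / 2 ^+ q].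
Proof.
move=> /andP[x0 x1]; have x2 : 0 < x / 2 by rewrite divr_gt0.
have ex : exists q, 1 / 2 ^+ q <= x / 2.
  by have [q Hq] := exists_small ler01 x2; exists q; exact: Hq.
case: (ex_minnP ex) => q qx qmin.
have q2 : (2 <= q)%N.
  case: q qx qmin => [|[|//]]; rewrite ?expr0 ?expr1; lra.
exists q; split => //; rewrite leNgt; apply/negP => xq.
case: q q2 qx qmin xq => // q q2 qx qmin; rewrite exprS => xq.
have : 1 / 2 ^+ q <= x / 2.
  have p0 : 2 ^+ q != 0 :> R by rewrite expf_neq0.
  have -> : 1 / 2 ^+ q = 2 * (1 / (2 * 2 ^+ q)) :> R by field.
  lra.
by move=> /qmin; rewrite ltnn.
Qed.

(** The greedy choice with boxes of relative height [1 / 2 ^+ e] around slits whose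
    generations are [K] apart leaves uncovered a proportion [1 / (1 + S)] of the
    cells, apart from [beta] and the shells, which are small for large [K] and [e].
    Here [S] is, up to a constant, the sum of the [r i ^+ m.+1] over a residue class
    of generations, hence as large as desired. *)
Lemma packing (R : realType) (m : nat) (r : nat -> R) (r01 : forall i, 0 <= r i < 1)
    (delta : R) :
  (\sum_(i <oo) ((r i) ^+ m.+1)%:E = +oo)%E -> 0 < delta ->
  exists (P : seq (plate R m)) (G : nat), [/\ plates_disjoint P,
    forall b, b \in P -> ph b <= delta /\ on_slit r b, (0 < G)%N,
    1 / 2 ^+ G <= delta &
    #|bad_cells P G|%:R <= delta * (2 ^+ G) ^+ m.+1].
Proof.
move=> roo d0; have d3 : 0 < delta / 3 by rewrite divr_gt0.
have p0 n : 0 < 2 ^+ n :> R by rewrite exprn_gt0.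
have M1 : 0 <= 2 * m.+1%:R :> R by rewrite mulr_ge0.
have M2 : 0 <= 4 * m.+1%:R :> R by rewrite mulr_ge0.
have [e1 He1] := exists_small M1 d3.
have [e2 He2] := exists_small ler01 d0.
have [K1 HK1] := exists_small M2 d3.
pose e := maxn e1 e2; pose K := K1.+1.
have qex i : exists q, 0 < r i -> [/\ (2 <= q)%N, 1 / 2 ^+ q <= r i / 2 & r i / 4 <= 1 / 2 ^+ q].
  have [ri|_] := ltP 0 (r i); last by exists 0%N.
  have /andP[_ r1] := r01 i.
  by have [|q Hq] := @dyadic_size R (r i); [rewrite ri|exists q].
have [Q HQ] := choice qex.
pose c : R := (1 / (4 * 2 ^+ e)) ^+ m.+1.
have c0 : 0 < c by rewrite exprn_gt0// divr_gt0// mulr_gt0.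
have rn0 i : 0 <= r i ^+ m.+1 by rewrite exprn_ge0//; have /andP[] := r01 i.
have [a [N HN]] := unbounded_residue (3 / delta / c) rn0 (ltn0Sn K1) roo.
pose g k := (a + K * k)%N; pose q k := Q (g k); pose act k := 0 < r (g k).
pose G := (\sum_(k < N) (g k + q k + e.*2) + e2).+1.
have gsum k : (k < N)%N -> (g k + q k + e.*2 <= G)%N.
  move=> kN; rewrite /G (bigD1 (Ordinal kN))//=; lia.
have g_le k : (k < N)%N -> (g k <= G)%N by move=> /gsum; lia.
have g_inc j k : (j < k)%N -> (k < N)%N -> (g j < g k)%N.
  by move=> jk _; rewrite ltn_add2l ltn_pmul2l.
have fits k : (k < N)%N -> act k -> (g k + q k + e.*2 <= G)%N by move=> /gsum.
have q_ge2 k : (k < N)%N -> act k -> (2 <= q k)%N by move=> _ /HQ[].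
have g_gap j k : (j < k)%N -> (k < N)%N -> (K * (k - j) <= g k - g j)%N.
  by move=> _ _; rewrite subnDl mulnBr.
exists (items G N e g q act), G; split => //.
- move=> b b' z /itemsP[k [w [kN ak wf ->]]] /itemsP[k' [w' [kN' ak' wf' ->]]].
  exact: (items_disjoint g_le fits q_ge2 (ltn0Sn K1) kN kN' ak ak' wf wf').
- move=> b /itemsP[k [w [kN ak wf ->]]]; split.
    rewrite /ph/=; apply: le_trans (He2 e (leq_maxr _ _)).
    by rewrite ler_pM2l// lef_pV2 ?posrE// ler_weXn2l ?ler1n// leq_addl.
  have lt i : (w i %/ side G g k < 2 ^ g k)%N.
    by rewrite ltn_divLR ?expn_gt0// -expnD subnKC ?g_le.
  exists (g k), [ffun i => Ordinal (lt i)]; split => // z zb z0; split => //.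
    by rewrite z0 /pc/= !mxE ffunE.
  move=> j j0; have [_ qr _] := HQ _ ak.
  have := item_near j zb; rewrite /thin (negbTE j0) addn0 => H.
  rewrite (_ : dyadic_center _ 0 j = box_center g k w 0 j); last first.
    by rewrite !mxE ffunE.
  apply: le_trans (ltW H) _; rewrite exprD.
  have -> : r (g k) / 2 ^+ g k / 2 = r (g k) / 2 / 2 ^+ g k by rewrite mulrAC.
  by rewrite mul1r invfM mulrC ler_wpM2r ?invr_ge0 ?(ltW (p0 _))// -[leLHS]mul1r.
- apply: He2; rewrite /G; lia.
have := @items_bad_card m G N e g q act g_le g_inc fits q_ge2 R K (ltn0Sn K1) g_gap.
have -> : #|[set: 'I_(2 ^ G) ^ m.+1]%SET|%:R = (2 ^+ G) ^+ m.+1 :> R.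
  by rewrite cardsT card_ffun !card_ord !natrX.
move/le_trans; apply; rewrite mulrC ler_wpM2r ?exprn_ge0 ?(ltW (p0 _))//.
set S := \sum_(j < N) _.
have S3 : 3 / delta <= S.
  rewrite -[leLHS](divfK (lt0r_neq0 c0)).
  apply: (@le_trans _ _ ((\sum_(j < N) r (a + K * j)%N ^+ m.+1) * c)).
    by rewrite ler_wpM2r// ltW.
  rewrite mulr_suml; apply: ler_sum => j _; rewrite -/(g j).
  case: ifPn => aj; last first.
    have -> : r (g j) = 0.
      apply/eqP; rewrite eq_le; have /andP[-> _] := r01 (g j).
      by rewrite andbT leNgt.
    by rewrite expr0n/= mul0r.
  have [_ _ rq] := HQ _ aj.
  rewrite /c -exprMn -[X in _ <= X / _](expr1n _ m.+1) -expr_div_n.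
  apply: lerXn2r; rewrite ?nnegrE ?divr_ge0 ?mulr_ge0 ?divr_ge0 ?(ltW (p0 _))//.
    by have /andP[] := r01 (g j).
  rewrite exprD; have -> : 1 / (2 ^+ q j * 2 ^+ e) = 1 / 2 ^+ q j * (1 / 2 ^+ e) :> R.
    by rewrite !mul1r invfM.
  have -> : r (g j) * (1 / (4 * 2 ^+ e)) = r (g j) / 4 * (1 / 2 ^+ e).
    by rewrite !mul1r invfM mulrA.
  by rewrite ler_wpM2r// divr_ge0// ltW.
have b1 : 1 / (1 + S) <= delta / 3.
  have S0 : 0 < 1 + S by apply: ltr_pwDl => //; apply: le_trans S3; rewrite divr_ge0// ltW.
  rewrite ler_pdivrMr//; apply: (@le_trans _ _ (delta / 3 * (3 / delta))).
    by rewrite mulrA divfK// divff// lt0r_neq0.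
  by rewrite ler_wpM2l ?(ltW d3)//; lra.
have b2 : m.+1%:R * (4 / 2 ^+ K) <= delta / 3.
  by rewrite mulrA [m.+1%:R * 4]mulrC; apply: HK1; rewrite /K.
have b3 : m.+1%:R * (2 / 2 ^+ e) <= delta / 3.
  by rewrite mulrA [m.+1%:R * 2]mulrC; apply: He1; rewrite leq_maxl.
lra.
Qed.

(** * Euclidean and inner distances *)

Section euclidean.
Context {R : realType} {n : nat}.
Implicit Types (x y z : 'rV[R]_n).

Lemma eucl_ge0 x y : (0 <= eucl x y)%E.
Proof. by rewrite lee_fin sqrtr_ge0. Qed.

Lemma eucl_coord x y i : (`|x 0 i - y 0 i|%:E <= eucl x y)%E.
Proof.
rewrite lee_fin -sqrtr_sqr ler_sqrt ?sumr_ge0//; last by move=> j _; exact: sqr_ge0.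
by rewrite (bigD1 i)//= lerDl sumr_ge0// => j _; exact: sqr_ge0.
Qed.

Lemma eucl_le x y (c : R) : 0 <= c -> (forall i, `|x 0 i - y 0 i| <= c) ->
  (eucl x y <= (n%:R * c)%:E)%E.
Proof.
move=> c0 H; have nc0 : 0 <= n%:R * c by rewrite mulr_ge0.
rewrite lee_fin -(ger0_norm nc0) -sqrtr_sqr ler_sqrt ?sqr_ge0//.
apply: (@le_trans _ _ (\sum_(i < n) c ^+ 2)).
  apply: ler_sum => i _; rewrite -real_normK ?num_real// lerXn2r ?nnegrE//.
rewrite sumr_const card_ord -[leLHS]mulr_natl exprMn ler_wpM2r ?sqr_ge0//.
by rewrite -natrX ler_nat; case: n => // k; rewrite leq_pmull.
Qed.

Lemma eucl_sym x y : eucl x y = eucl y x.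
Proof.
by rewrite /eucl; congr (Num.sqrt _)%:E; apply: eq_bigr => i _; rewrite -sqrrN opprB.
Qed.

Lemma euclxx x : eucl x x = 0%E.
Proof. by rewrite /eucl big1 ?sqrtr0// => i _; rewrite subrr expr0n. Qed.

Lemma cauchy_schwarz (a b : 'I_n -> R) :
  (\sum_i a i * b i) ^+ 2 <= (\sum_i a i ^+ 2) * (\sum_i b i ^+ 2).
Proof.
set A := \sum_i a i ^+ 2; set B := \sum_i b i ^+ 2; set C := \sum_i a i * b i.
have A0 : 0 <= A by rewrite sumr_ge0// => i _; exact: sqr_ge0.
have B0 : 0 <= B by rewrite sumr_ge0// => i _; exact: sqr_ge0.
have H (s t : R) : 0 <= s ^+ 2 * A - 2 * s * t * C + t ^+ 2 * B.
  have -> : s ^+ 2 * A - 2 * s * t * C + t ^+ 2 * B = \sum_i (s * a i - t * b i) ^+ 2.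
    rewrite /A /B /C !mulr_sumr -sumrB -big_split/=.
    by apply: eq_bigr => i _; ring.
  by rewrite sumr_ge0// => i _; exact: sqr_ge0.
move: B0; rewrite le_eqVlt => /predU1P[B0|B0].
  have := H C (A + 1); rewrite -B0 mulr0 addr0.
  have -> : C ^+ 2 * A - 2 * C * (A + 1) * C = - (C ^+ 2 * (A + 2)) by ring.
  rewrite mulr0 oppr_ge0 pmulr_lle0//; lra.
have := H B C.
have -> : B ^+ 2 * A - 2 * B * C * C + C ^+ 2 * B = B * (A * B - C ^+ 2) by ring.
by rewrite pmulr_rge0// subr_ge0.
Qed.

Lemma eucl_triangle x y z : (eucl x z <= eucl x y + eucl y z)%E.
Proof.
rewrite /eucl -EFinD lee_fin.
set A := \sum_i (x 0 i - y 0 i) ^+ 2; set B := \sum_i (y 0 i - z 0 i) ^+ 2.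
have A0 : 0 <= A by rewrite sumr_ge0// => i _; exact: sqr_ge0.
have B0 : 0 <= B by rewrite sumr_ge0// => i _; exact: sqr_ge0.
pose C := \sum_i (x 0 i - y 0 i) * (y 0 i - z 0 i).
have CS : C <= Num.sqrt A * Num.sqrt B.
  rewrite -sqrtrM//; apply: le_trans (ler_norm C) _.
  rewrite -sqrtr_sqr ler_sqrt ?mulr_ge0//.
  exact: (cauchy_schwarz (fun i => x 0 i - y 0 i) (fun i => y 0 i - z 0 i)).
have E : \sum_i (x 0 i - z 0 i) ^+ 2 = A + B + 2 * C.
  rewrite /A /B /C mulr_sumr -!big_split/=; apply: eq_bigr => i _; ring.
have s0 : 0 <= Num.sqrt A + Num.sqrt B by rewrite addr_ge0// sqrtr_ge0.
rewrite -(ger0_norm s0) -sqrtr_sqr ler_sqrt ?sqr_ge0// E.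
have := sqr_sqrtr A0; have := sqr_sqrtr B0; rewrite sqrrD; lra.
Qed.

Definition epath (gamma : R -> 'rV[R]_n) : Prop :=
  forall t e : R, 0 <= t <= 1 -> 0 < e -> exists2 del : R, 0 < del &
    forall t' : R, 0 <= t' <= 1 -> `|t - t'| < del -> (eucl (gamma t) (gamma t') < e%:E)%E.

Lemma eucl_ball_open x (e : R) : @open (mspace eucl) [set y | (eucl x y < e%:E)%E].
Proof.
apply: mspace_open => y /= xy; exists (e - fine (eucl x y)).
  by rewrite subr_gt0 -lte_fin fineK.
move=> z yz; apply: le_lt_trans (eucl_triangle x y z) _.
move: xy yz; rewrite /eucl -EFinD !lte_fin/=; lra.
Qed.

Lemma epathP (gamma : R -> 'rV[R]_n) :
  {within `[0, 1], continuous (gamma : R -> mspace eucl)} <-> epath gamma.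
Proof.
split=> [/subspace_continuousP cg t e t01 e0|eg].
  have U : nbhs (gamma t : mspace eucl) [set y | (eucl (gamma t) y < e%:E)%E].
    apply: (@open_nbhs_nbhs (mspace eucl)); split; first exact: eucl_ball_open.
    by rewrite /= euclxx.
  have t01' : `[0, 1]%classic t by rewrite /= in_itv.
  have /nbhs_ballP[del /= d0 Hd] := cg t t01' _ U.
  exists del => // t' t'01 tt; apply: Hd => //; by rewrite /= in_itv.
apply/subspace_continuousP => t; rewrite /= in_itv/= => t01 A.
rewrite nbhsE => -[B [oB Bt] BA].
have [e e0 He] : exists2 e : R, 0 < e & forall y, (eucl (gamma t) y < e%:E)%E -> B y.
  exact: oB.
have [del d0 Hd] := eg t e t01 e0.
apply/nbhs_ballP; exists del => //= t' tt; rewrite in_itv/= => t'01.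
by apply: BA; apply: He; exact: Hd.
Qed.

Lemma epath_econt (gamma : R -> 'rV[R]_n) i : epath gamma ->
  econt 0 1 (fun t => gamma t 0 i).
Proof.
move=> eg t e t01 e0; have [del d0 H] := eg t e t01 e0; exists del => // t' t'01 tt.
by rewrite -lte_fin; apply: le_lt_trans (eucl_coord _ _ i) (H _ t'01 tt).
Qed.

End euclidean.

Section inner_distance.
Context {R : realType} {n : nat} (A : set 'rV[R]_n.+1).
Implicit Types (x y z : 'rV[R]_n.+1).

Let id_coord x y (i : 'I_n.+1) : (`|id x 0 i - id y 0 i|%:E <= eucl x y)%E := eucl_coord x y i.

Lemma inner_dist_le (gamma : R -> 'rV[R]_n.+1) x y (l : \bar R) :
  epath gamma -> gamma 0 = x -> gamma 1 = y ->
  (forall t : R, 0 <= t <= 1 -> A (gamma t)) ->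
  (curve_length eucl gamma 0 1 <= l)%E -> (inner_dist A x y <= l)%E.
Proof.
move=> eg g0 g1 gA gl; apply: le_trans gl; apply: ereal_inf_lbound.
exists gamma => //; split => //; first exact/epathP.
by move=> _ [t + <-]; rewrite /= in_itv/=; exact: gA.
Qed.

Lemma inner_dist_ge x y (l : \bar R) :
  (forall gamma : R -> 'rV[R]_n.+1, epath gamma -> gamma 0 = x -> gamma 1 = y ->
     (forall t : R, 0 <= t <= 1 -> A (gamma t)) -> (l <= curve_length eucl gamma 0 1)%E) ->
  (l <= inner_dist A x y)%E.
Proof.
move=> H; apply: le_ereal_inf_tmp => _ [g [/epathP eg g0 g1 gA] <-]; apply: H => //.
by move=> t t01; apply: gA; exists t => //=; rewrite in_itv.
Qed.

Lemma inner_dist_ge0 x y : (0 <= inner_dist A x y)%E.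
Proof. by apply: inner_dist_ge => g *; exact: curve_length_ge0 eucl_ge0 _ _ ler01. Qed.

Lemma inner_dist_coord x y i : (`|x 0 i - y 0 i|%:E <= inner_dist A x y)%E.
Proof.
apply: inner_dist_ge => g _ <- <- _.
have := curve_length_append g eucl_ge0 (lexx (0 : R)) ltr01; apply: le_trans.
apply: le_trans (eucl_coord _ _ i) _.
by rewrite leeDr// curve_length_ge0//; exact: eucl_ge0.
Qed.

Lemma inner_dist_path x y (e : R) : 0 < e -> (inner_dist A x y < +oo)%E ->
  exists (gamma : R -> 'rV[R]_n.+1) (s : R -> R), [/\ epath gamma,
    [/\ gamma 0 = x, gamma 1 = y & (forall t : R, 0 <= t <= 1 -> A (gamma t))],
    (forall t t' : R, 0 <= t -> t <= t' -> t' <= 1 ->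
       (eucl (gamma t) (gamma t') <= (s t' - s t)%:E)%E), s 0 = 0 &
    ((s 1)%:E <= inner_dist A x y + e%:E)%E].
Proof.
move=> e0 fin.
have fn : inner_dist A x y \is a fin_num by rewrite ge0_fin_numE// inner_dist_ge0.
have /ereal_inf_lt[_ [g [/epathP eg g0 g1 gA] <-] gl] :
    (inner_dist A x y < inner_dist A x y + e%:E)%E.
  by rewrite lteDl// lte_fin.
have gfin : (curve_length eucl g 0 1 < +oo)%E.
  by apply: lt_trans gl _; rewrite -(fineK fn) -EFinD ltry.
exists g, (fun t => fine (curve_length eucl g 0 t)); split => //.
- split => // t t01; apply: gA; exists t => //=; by rewrite in_itv.
- move=> t t' t0; rewrite le_eqVlt => /predU1P[->|tt] t1.
    by rewrite subrr euclxx.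
  have := curve_length_append g eucl_ge0 t0 tt.
  have t01 : 0 <= t <= 1 by rewrite t0 (le_trans (ltW tt)).
  have t'01 : 0 <= t' <= 1 by rewrite t1 (le_trans t0 (ltW tt)).
  rewrite (arc_lengthE id_coord gfin t01) (arc_lengthE id_coord gfin t'01).
  by rewrite EFinB leeBrDl.
- exact: (arc_length_start id_coord g).
- have t1 : 0 <= (1 : R) <= 1 by rewrite ler01 lexx.
  by rewrite -(arc_lengthE id_coord gfin t1); exact: ltW.
Qed.

Lemma inner_dist_sym_le x y : (inner_dist A x y <= inner_dist A y x)%E.
Proof.
apply: inner_dist_ge => g eg g0 g1 gA.
have [fin|] := ltP (curve_length eucl g 0 1) +oo%E; last by rewrite leye_eq => /eqP ->; rewrite leey.
have f01 (t : R) : 0 <= t <= 1 -> 0 <= 1 - t <= 1 by move=> /andP[? ?]; apply/andP; split; lra.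
apply: (@inner_dist_le (fun t => g (1 - t))).
- move=> t e t01 e0; have [del d0 H] := eg (1 - t) e (f01 _ t01) e0.
  exists del => // t' t'01 tt; apply: H; first exact: f01.
  by rewrite opprB addrC addrA subrK distrC.
- by rewrite subr0.
- by rewrite subrr.
- by move=> t /f01; exact: gA.
pose s t := fine (curve_length eucl g 0 t).
apply: le_trans (curve_length_le_majorant (s := fun t => - s (1 - t)) ler01 _) _.
  move=> t t' t0 tt t1.
  have -> : - s (1 - t') - - s (1 - t) = s (1 - t) - s (1 - t') by ring.
  move: tt; rewrite le_eqVlt => /predU1P[->|tt]; first by rewrite subrr euclxx.
  have a0 : 0 <= 1 - t' by lra.
  have a1 : 1 - t' < 1 - t by lra.
  have := curve_length_append g eucl_ge0 a0 a1.
  have b1 : 0 <= 1 - t <= 1 by apply/andP; split; lra.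
  have b2 : 0 <= 1 - t' <= 1 by apply/andP; split; lra.
  rewrite (arc_lengthE id_coord fin b1) (arc_lengthE id_coord fin b2) eucl_sym.
  by rewrite EFinB leeBrDl.
rewrite subrr subr0 opprK addrC.
have t1 : 0 <= (1 : R) <= 1 by rewrite ler01 lexx.
have := arc_lengthE id_coord fin t1; rewrite -/(s 1) => ->.
rewrite lee_fin lerBlDr lerDl /s fine_ge0//.
exact: curve_length_ge0 eucl_ge0 _ _ (lexx 0).
Qed.

Lemma inner_dist_sym x y : inner_dist A x y = inner_dist A y x.
Proof. by apply/eqP; rewrite eq_le !inner_dist_sym_le. Qed.

Lemma inner_dist_triangle x y z :
  (inner_dist A x z <= inner_dist A x y + inner_dist A y z)%E.
Proof.
have [f1|] := ltP (inner_dist A x y) +oo%E; last first.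
  rewrite leye_eq => /eqP ->; rewrite addye ?leey//.
  by apply: contraTneq (inner_dist_ge0 y z) => ->.
have [f2|] := ltP (inner_dist A y z) +oo%E; last first.
  rewrite leye_eq => /eqP ->; rewrite addey ?leey//.
  by apply: contraTneq (inner_dist_ge0 x y) => ->.
apply/lee_addgt0Pr => e e0; have e2 : 0 < e / 2 by rewrite divr_gt0.
have [g1 [s1 [eg1 [g10 g11 gA1] gs1 s10 sl1]]] := inner_dist_path e2 f1.
have [g2 [s2 [eg2 [g20 g21 gA2] gs2 s20 sl2]]] := inner_dist_path e2 f2.
pose g (t : R) := if t <= 1 / 2 then g1 (2 * t) else g2 (2 * t - 1).
pose s (t : R) := if t <= 1 / 2 then s1 (2 * t) else s1 1 + s2 (2 * t - 1).
have lo (t : R) : 0 <= t -> t <= 1 / 2 -> 0 <= 2 * t <= 1 by move=> ? ?; apply/andP; split; lra.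
have hi (t : R) : 1 / 2 < t -> t <= 1 -> 0 <= 2 * t - 1 <= 1 by move=> ? ?; apply/andP; split; lra.
have i0 : 0 <= (0 : R) <= 1 by rewrite lexx ler01.
have i1 : 0 <= (1 : R) <= 1 by rewrite lexx ler01.
have y12 : g1 1 = g2 0 by rewrite g11 g20.
apply: (@le_trans _ _ (s 1 - s 0)%:E); last first.
  have n1 : (1 <= 1 / 2 :> R) = false by apply/negbTE; rewrite -ltNge; lra.
  have n2 : (0 <= 1 / 2 :> R) by lra.
  rewrite /s n1 n2.
  rewrite mulr0 s10 subr0 mulr1 (_ : 2 - 1 = 1); last by ring.
  rewrite EFinD; apply: le_trans (leeD sl1 sl2) _.
  by rewrite addeACA -EFinD -splitr.
apply: (@inner_dist_le g).
- move=> t eps /andP[t0 t1] eps0; have ep2 : 0 < eps / 2 by rewrite divr_gt0.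
  have eps_eps : ((eps / 2)%:E + (eps / 2)%:E = eps%:E)%E by rewrite -EFinD -splitr.
  have [th|th] := leP t (1 / 2).
    have [d1 d10 H1] := eg1 (2 * t) _ (lo _ t0 th) ep2.
    have [d2 d20 H2] := eg2 0 _ i0 ep2.
    exists (Num.min d1 d2 / 2); first by rewrite divr_gt0// lt_min d10.
    move=> t' /andP[t'0 t'1]; rewrite ltr_pdivlMr// lt_min => /andP[td1 td2].
    rewrite /g th; case: (leP t' (1 / 2)) => t'h.
      apply: lt_trans (H1 (2 * t') (lo _ t'0 t'h) _) _; last by rewrite lte_fin; lra.
      by rewrite -mulrBr normrM ger0_norm// mulrC.
    apply: le_lt_trans (eucl_triangle _ (g1 1) _) _; rewrite -eps_eps; apply: lteD.
      apply: H1 => //; move: td1; rewrite distrC (ger0_norm (x := t' - t)); last by lra.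
      rewrite distrC ger0_norm; lra.
    rewrite y12; apply: H2; first exact: hi.
    move: td2; rewrite distrC (ger0_norm (x := t' - t)); last by lra.
    rewrite distrC ger0_norm subr0; lra.
  have [d1 d10 H1] := eg2 (2 * t - 1) _ (hi _ th t1) ep2.
  have [d2 d20 H2] := eg1 1 _ i1 ep2.
  exists (Num.min d1 d2 / 2); first by rewrite divr_gt0// lt_min d10.
  move=> t' /andP[t'0 t'1]; rewrite ltr_pdivlMr// lt_min => /andP[td1 td2].
  rewrite /g (leNgt t) th/=; case: (leP t' (1 / 2)) => t'h.
    apply: le_lt_trans (eucl_triangle _ (g2 0) _) _; rewrite -eps_eps; apply: lteD.
      apply: H1 => //; move: td1; rewrite (ger0_norm (x := t - t')); last by lra.
      rewrite subr0 ger0_norm; lra.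
    rewrite -y12; apply: H2; first exact: lo.
    move: td2; rewrite (ger0_norm (x := t - t')); last by lra.
    rewrite ger0_norm; lra.
  apply: lt_trans (H1 (2 * t' - 1) (hi _ t'h t'1) _) _; last by rewrite lte_fin; lra.
  have -> : 2 * t - 1 - (2 * t' - 1) = 2 * (t - t') by ring.
  by rewrite normrM ger0_norm// mulrC.
- by rewrite /g mulr0 divr_ge0.
- have -> : g 1 = g2 (2 * 1 - 1) by rewrite /g (_ : (1 <= 1 / 2 :> R) = false)//; apply/negbTE; rewrite -ltNge; lra.
  by rewrite (_ : 2 * 1 - 1 = 1 :> R)//; ring.
- move=> t /andP[t0 t1]; rewrite /g; case: (leP t (1 / 2)) => th.
    by apply: gA1; exact: lo.
  by apply: gA2; exact: hi.
apply: curve_length_le_majorant => // t t' t0 tt t1; rewrite /g /s.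
case: (leP t (1 / 2)) => th; case: (leP t' (1 / 2)) => t'h.
- by apply: gs1; lra.
- apply: le_trans (eucl_triangle _ (g1 1) _) _.
  have -> : s1 1 + s2 (2 * t' - 1) - s1 (2 * t) = (s1 1 - s1 (2 * t)) + (s2 (2 * t' - 1) - s2 0).
    by rewrite s20; ring.
  rewrite EFinD; apply: leeD; first by apply: gs1; lra.
  by rewrite y12; apply: gs2; lra.
- by have := lt_le_trans th (le_trans tt t'h); rewrite ltxx.
- have -> : s1 1 + s2 (2 * t' - 1) - (s1 1 + s2 (2 * t - 1)) = s2 (2 * t' - 1) - s2 (2 * t - 1).
    by ring.
  by apply: gs2; lra.
Qed.

Lemma inner_dist_segment x y (c : R) : 0 <= c ->
  (forall i, `|x 0 i - y 0 i| <= c) ->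
  (forall t : R, 0 <= t <= 1 -> A (\row_i (x 0 i + t * (y 0 i - x 0 i)))) ->
  (inner_dist A x y <= (n.+1%:R * c)%:E)%E.
Proof.
move=> c0 xyc xyA.
pose g (t : R) : 'rV[R]_n.+1 := \row_i (x 0 i + t * (y 0 i - x 0 i)).
have gd t t' : (eucl (g t) (g t') <= (n.+1%:R * (`|t - t'| * c))%:E)%E.
  apply: eucl_le; first by rewrite mulr_ge0.
  move=> i; rewrite !mxE.
  have -> : x 0 i + t * (y 0 i - x 0 i) - (x 0 i + t' * (y 0 i - x 0 i)) =
    (t - t') * (y 0 i - x 0 i) by ring.
  by rewrite normrM ler_wpM2l// distrC.
apply: (@inner_dist_le g).
- move=> t e t01 e0; have M0 : 0 < n.+1%:R * c + 1 by rewrite ltr_wpDl// mulr_ge0.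
  exists (e / (n.+1%:R * c + 1)); first by rewrite divr_gt0.
  move=> t' t'01; rewrite ltr_pdivlMr// => tt.
  apply: le_lt_trans (gd t t') _; rewrite lte_fin; apply: le_lt_trans tt.
  rewrite mulrCA ler_wpM2l//; lra.
- by apply/rowP => i; rewrite mxE mul0r addr0.
- by apply/rowP => i; rewrite mxE mul1r addrC subrK.
- by move=> t t01; exact: xyA.
apply: le_trans (curve_length_le_majorant (s := fun t => n.+1%:R * (t * c)) ler01 _) _.
  move=> t t' t0 tt t1; apply: le_trans (gd t t') _; rewrite lee_fin.
  by rewrite distrC ger0_norm ?subr_ge0// mulrBl mulrBr.
by rewrite mul0r mulr0 subr0 mul1r.
Qed.

Lemma inner_distxx x : A x -> inner_dist A x x = 0%E.
Proof.
move=> Ax; apply/eqP; rewrite eq_le inner_dist_ge0 andbT.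
apply: le_trans (inner_dist_segment (lexx 0) _ _) _.
- by move=> i; rewrite subrr normr0.
- by move=> t _; rewrite (_ : \row_i _ = x)//; apply/rowP => i; rewrite mxE subrr mulr0 addr0.
by rewrite mulr0.
Qed.

End inner_distance.

(** Along a path in [A] the folded coordinate is a continuous selection of
    [z 0 0 + push P z] and [z 0 0 - push P z], to which [selection_speed] applies. *)
Lemma folded_inner_dist (R : realType) (m : nat) (A : set 'rV[R]_m.+1)
    (P : seq (plate R m)) x y : plates_disjoint P ->
  (forall z, A z -> off_plates P z) ->
  (`|folded P x - folded P y|%:E <= 2%:E * inner_dist A x y)%E.
Proof.
move=> dP AP.
have [fin|] := ltP (inner_dist A x y) +oo%E; last first.
  by rewrite leye_eq => /eqP ->; rewrite gt0_muley ?leey// lte_fin.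
apply/lee_addgt0Pr => e e0; have e2 : 0 < e / 2 by rewrite divr_gt0.
have [g [s [eg [g0 g1 gA] gs s0 sl]]] := inner_dist_path e2 fin.
have ce i : econt 0 1 (fun t => g t 0 i) by exact: epath_econt.
have cU : econt 0 1 (folded P \o g).
  by apply: folded_econt => // t t01; apply: AP; exact: gA.
have sp := selection_speed (X := fun t => g t 0 0) (s := s)
  (P := fun t => push P (g t)) (ce 0) cU (fun t _ => folded_dist P (g t)) _
  (lexx 0) ler01 (lexx 1).
have : `|folded P (g 1) - folded P (g 0)| <= 2 * (s 1 - s 0).
  apply: sp => t t' t0 tt t1.
  have H i : `|g t' 0 i - g t 0 i| <= s t' - s t.
    rewrite distrC -lee_fin; apply: le_trans (eucl_coord _ _ i) _; exact: gs.
  by split; [exact: H|exact: push_lip].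
rewrite g0 g1 s0 subr0 distrC -lee_fin => /le_trans; apply.
rewrite EFinM; apply: le_trans (lee_wpmul2l _ sl) _; first by rewrite lee_fin.
rewrite ge0_muleDr ?inner_dist_ge0//; last by rewrite lee_fin ltW.
by rewrite leeD2l// -EFinM lee_fin mulrCA divff// mulr1.
Qed.

(** * Points and distances of the slit space *)

Section limits.
Context {R : realType}.

Lemma real_cauchy_cvg (a : nat -> R) :
  (forall e : R, 0 < e -> exists N, forall k l, (N <= k)%N -> (N <= l)%N ->
     `|a k - a l| < e) -> cvgn a.
Proof.
move=> aC; apply/cauchy_cvgP/cauchy_exP => e e0; have [N HN] := aC e e0.
by exists (a N); exists N => // k /= Nk; exact: HN.
Qed.

Lemma cvgn_dist (a : nat -> R) : cvgn a -> forall e : R, 0 < e ->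
  exists N, forall k, (N <= k)%N -> `|a k - limn a| <= e.
Proof.
move=> ca e e0; have /cvgrPdist_le/(_ e e0)[N _ HN] := ca.
by exists N => k Nk; rewrite distrC; exact: HN.
Qed.

(** The differences of [a] may be undefined: in this form of the Cauchy
    condition a sequence that is eventually [+oo] is allowed. *)
Lemma limn_approx (a : nat -> \bar R) :
  (forall k, (0 <= a k)%E) ->
  (forall e : R, 0 < e -> exists N, forall k l, (N <= k)%N -> (N <= l)%N ->
     (a k <= a l + e%:E)%E) ->
  forall e : R, 0 < e -> exists N, forall k, (N <= k)%N ->
    (a k <= limn a + e%:E)%E /\ (limn a <= a k + e%:E)%E.
Proof.
move=> a0 aC; have ca : cvgn a.
  have [N HN] := aC 1 ltr01; have [aN|] := ltP (a N) +oo%E; last first.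
    rewrite leye_eq => /eqP aN; apply/cvg_ex; exists +oo%E.
    apply: cvg_near_cst; exists N => // k /= Nk.
    have := HN N k (leqnn N) Nk; rewrite aN leye_eq => /eqP.
    by case: (a k) (a0 k).
  have fin k : (N <= k)%N -> a k = (fine (a k))%:E.
    move=> Nk; rewrite fineK// ge0_fin_numE//.
    apply: le_lt_trans (HN k N Nk (leqnn N)) _.
    by rewrite -(fineK (x := a N)) ?ge0_fin_numE// -EFinD ltry.
  have /cvg_ex[l fl] : cvgn (fine \o a).
    apply: real_cauchy_cvg => e e0; have e2 : 0 < e / 2 by rewrite divr_gt0.
    have [M HM] := aC _ e2; exists (maxn N M) => k l.
    rewrite !geq_max => /andP[Nk Mk] /andP[Nl Ml].
    have := HM k l Mk Ml; have := HM l k Ml Mk.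
    rewrite (fin k Nk) (fin l Nl) -!EFinD !lee_fin/= => H1 H2.
    rewrite ltr_norml; apply/andP; split; lra.
  apply/cvg_ex; exists l%:E; apply/fine_cvgP; split=> //.
  by exists N => // k /= /fin ->.
move=> e e0; have [N HN] := aC e e0; exists N => k Nk; split.
  rewrite -leeBlDr//; apply: lime_ge => //; exists N => // l /= Nl.
  by rewrite EFinN leeBlDr//; exact: HN.
by apply: lime_le => //; exists N => // l /= Nl; exact: HN.
Qed.

Lemma lee_approx (x y : \bar R) (c : R) :
  (forall e : R, 0 < e -> (x <= y + (c * e)%:E)%E) -> 0 < c -> (x <= y)%E.
Proof.
move=> H c0; apply/lee_addgt0Pr => e e0.
have := H (e / c); rewrite mulrCA divff ?mulr1 ?lt0r_neq0//; apply; exact: divr_gt0.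
Qed.

End limits.

Section completion_distance.
Context {R : realType} {T : Type} (d : T -> T -> \bar R) (A : set T).
Hypothesis d_ge0 : forall x y, (0 <= d x y)%E.
Hypothesis d_tri : forall x y z, (d x z <= d x y + d y z)%E.
Hypothesis dxx : forall x, A x -> d x x = 0%E.
Implicit Types P Q : completion d A.

Lemma completion_rep_near P (e : R) : 0 < e -> exists N, forall k l,
  (N <= k)%N -> (N <= l)%N -> (d (completion_rep P k) (completion_rep P l) <= e%:E)%E.
Proof.
move=> e0; have [_ /(_ e e0)[N HN]] := completion_repP P.
by exists N => k l Nk Nl; exact/ltW/HN.
Qed.

Lemma completion_dist_approx P Q (e : R) : 0 < e -> exists N, forall k, (N <= k)%N ->
    (d (completion_rep P k) (completion_rep Q k) <= completion_dist P Q + e%:E)%E /\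
    (completion_dist P Q <= d (completion_rep P k) (completion_rep Q k) + e%:E)%E.
Proof.
move=> e0; apply: limn_approx e0 => // {}e e0; have e2 : 0 < e / 2 by rewrite divr_gt0.
have [N1 H1] := completion_rep_near P e2; have [N2 H2] := completion_rep_near Q e2.
exists (maxn N1 N2) => k l; rewrite !geq_max => /andP[k1 k2] /andP[l1 l2].
apply: le_trans (d_tri _ (completion_rep P l) _) _.
apply: le_trans (leeD (H1 _ _ k1 l1) (d_tri _ (completion_rep Q l) _)) _.
rewrite addeCA leeD2l// {2}[e]splitr EFinD leeD2l//.
exact: H2.
Qed.

Lemma completion_dist_ge0 P Q : (0 <= completion_dist P Q)%E.
Proof.
apply: (@lee_approx _ _ _ 1) ltr01 => e e0; rewrite mul1r.
have [N /(_ N (leqnn N))[+ _]] := completion_dist_approx P Q e0.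
exact: le_trans.
Qed.

Lemma completion_rep_class P : (sval P) (completion_rep P).
Proof.
rewrite (s2valP' (cid2 (svalP P))); split; first exact: completion_repP.
rewrite (_ : (fun k => _) = cst 0%E); first exact: cvg_cst.
by apply/funext => k; have [PA _] := completion_repP P; exact: dxx (PA k).
Qed.

End completion_distance.

Section slit_space.
Context {R : realType} {m : nat} (s : nat -> set 'rV[R]_m.+1).
Local Notation dom := (slit_domain s).
Local Notation dist i := (inner_dist (slit_domain s i)).
Local Notation rep p i := (completion_rep (sval p i)).
Implicit Types (p q : slit_space s) (z : 'rV[R]_m.+1).

Let Dge0 i z z' : (0 <= dist i z z')%E := inner_dist_ge0 _ _ _.
Let Dsym i z z' : dist i z z' = dist i z' z := inner_dist_sym _ _ _.
Let Dtri i x y z : (dist i x z <= dist i x y + dist i y z)%E := inner_dist_triangle _ _ _ _.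

Lemma rep_dom p i k : dom i (rep p i k).
Proof. by have [] := completion_repP (sval p i). Qed.

(** Sequences that represent the same point at different stages are equivalent
    for the coarser metric. *)
Lemma rep_tau p i j (e : R) : (i <= j)%N -> 0 < e -> exists N, forall k, (N <= k)%N ->
  (dist i (rep p j k) (rep p i k) <= e%:E)%E.
Proof.
move=> ij e0; have := completion_rep_class (@inner_distxx _ _ (dom i)) (sval p i).
rewrite -{1}(svalP p i j ij) => -[_ /fine_cvgP[[N1 _ H1]]].
move=> /cvgrPdist_le/(_ e e0)[N2 _ H2]; exists (maxn N1 N2) => k; rewrite geq_max => /andP[k1 k2].
rewrite -(fineK (H1 _ k1)) lee_fin; apply: le_trans (H2 _ k2).
by rewrite sub0r normrN ler_norm.
Qed.

(** The inner distance grows when slits are removed. *)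
Lemma slit_dist_homo p q i j : (i <= j)%N ->
  (completion_dist (sval p i) (sval q i) <= completion_dist (sval p j) (sval q j))%E.
Proof.
move=> ij; apply: (@lee_approx _ _ _ 4) => // e e0.
have [N1 H1] := completion_dist_approx (Dge0 i) (Dtri i) (sval p i) (sval q i) e0.
have [N2 H2] := completion_dist_approx (Dge0 j) (Dtri j) (sval p j) (sval q j) e0.
have [N3 H3] := rep_tau p ij e0; have [N4 H4] := rep_tau q ij e0.
pose k := maxn (maxn N1 N2) (maxn N3 N4).
have [_ {}H1] : _ := H1 k ltac:(lia); have [{}H2 _] : _ := H2 k ltac:(lia).
have {}H3 := H3 k ltac:(lia); have {}H4 := H4 k ltac:(lia).
apply: le_trans H1 _; rewrite (_ : 4 * e = e + e + e + e); last by ring.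
rewrite [in leRHS]EFinD addeA leeD2r//.
apply: le_trans (Dtri i _ (rep p j k) _) _; rewrite Dsym.
apply: le_trans (leeD H3 (Dtri i _ (rep q j k) _)) _.
rewrite (_ : (_ + (e + e + e)%:E)%E =
  e%:E + ((completion_dist (sval p j) (sval q j) + e%:E) + e%:E))%E; last first.
  by rewrite -[in RHS]addeA -EFinD addeCA -EFinD addrA.
rewrite leeD2l//; apply: leeD H4; apply: le_trans H2; exact/inner_dist_subset/slit_domain_subset.
Qed.

Lemma slit_distE p q : slit_dist s p q =
  ereal_sup (range (fun i => completion_dist (sval p i) (sval q i))).
Proof.
apply/cvg_lim => //; apply: ereal_nondecreasing_cvgn => i j; exact: slit_dist_homo.
Qed.

Lemma le_slit_dist p q i : (completion_dist (sval p i) (sval q i) <= slit_dist s p q)%E.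
Proof. by rewrite slit_distE; apply: ereal_sup_ubound; exists i. Qed.

Lemma slit_dist_le p q (B : \bar R) :
  (forall i (e : R) K, 0 < e -> exists2 k, (K <= k)%N &
     (dist i (rep p i k) (rep q i k) <= B + e%:E)%E) ->
  (slit_dist s p q <= B)%E.
Proof.
move=> H; rewrite slit_distE; apply: ge_ereal_sup => _ [i _ <-].
apply: (@lee_approx _ _ _ 2) => // e e0.
have [N HN] := completion_dist_approx (Dge0 i) (Dtri i) (sval p i) (sval q i) e0.
have [k Nk Hk] := H i e N e0; have [_ {}HN] := HN k Nk.
apply: le_trans HN _; rewrite (_ : 2 * e = e + e); last by ring.
by rewrite [in leRHS]EFinD addeA leeD2r.
Qed.

Lemma slit_dist_ge0 p q : (0 <= slit_dist s p q)%E.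
Proof.
by apply: le_trans (le_slit_dist p q 0); apply: completion_dist_ge0;
  [exact: Dge0|exact: Dtri].
Qed.

Section lifted.
Variables (f : 'rV[R]_m.+1 -> R) (K : R) (N : nat).
Hypothesis K0 : 0 <= K.
Hypothesis f_lip : forall x y, (`|f x - f y|%:E <= K%:E * dist N x y)%E.

(** The extension of [f] by continuity; a single stage [N] suffices. *)
Definition lifted p : R := limn (f \o rep p N).

Lemma lifted_near p (e : R) : 0 < e -> exists M, forall k, (M <= k)%N ->
  `|f (rep p N k) - lifted p| <= e.
Proof.
apply: cvgn_dist; apply: real_cauchy_cvg => {}e e0.
have Ke : 0 < e / (K + 1) by rewrite divr_gt0// ltr_wpDl.
have [M HM] := completion_rep_near (sval p N) Ke; exists M => k l Mk Ml.
rewrite -lte_fin; apply: le_lt_trans (f_lip _ _) _.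
apply: le_lt_trans (lee_wpmul2l _ (HM k l Mk Ml)) _; first by rewrite lee_fin.
by rewrite -EFinM lte_fin mulrA ltr_pdivrMr ?ltr_wpDl// mulrC ltr_pM2l// ltrDl.
Qed.

Lemma lifted_lip p q : (`|lifted p - lifted q|%:E <= K%:E * slit_dist s p q)%E.
Proof.
apply: (@lee_approx _ _ _ (2 + K)); last by rewrite ltr_wpDr.
move=> e e0; have [M1 H1] := lifted_near p e0; have [M2 H2] := lifted_near q e0.
have [M3 H3] := completion_dist_approx (Dge0 N) (Dtri N) (sval p N) (sval q N) e0.
pose k := maxn M1 (maxn M2 M3).
have {}H1 := H1 k ltac:(lia); have {}H2 := H2 k ltac:(lia).
have [{}H3 _] := H3 k ltac:(lia).
apply: (@le_trans _ _ (`|f (rep p N k) - f (rep q N k)| + 2 * e)%:E).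
  rewrite lee_fin; move: H1 H2.
  set a := f _; set b := f _; set a' := lifted _; set b' := lifted _.
  move=> H1 H2; rewrite (_ : a' - b' = (a - b) - (a - a') + (b - b')); last by ring.
  apply: le_trans (ler_normD _ _) _; apply: le_trans (lerD (ler_normB _ _) H2) _.
  lra.
rewrite (_ : (2 + K) * e = K * e + 2 * e); last by ring.
rewrite (EFinD (K * e)) EFinD addeA leeD2r//.
apply: le_trans (f_lip _ _) _; rewrite EFinM -muleDr//; last first.
  by rewrite ge0_adde_def// inE ?lee_fin ?(ltW e0)// slit_dist_ge0.
rewrite lee_wpmul2l ?lee_fin//; apply: le_trans H3 _.
by rewrite leeD2r// le_slit_dist.
Qed.

End lifted.

Lemma coordinate_inner_lip i j (x y : 'rV[R]_m.+1) :
  (`|x 0 j - y 0 j|%:E <= 1%:E * dist i x y)%E.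
Proof. by rewrite mul1e; exact: inner_dist_coord. Qed.

Lemma tau0_lifted p j : tau0 s p 0 j = lifted (fun z => z 0 j) 0 p.
Proof.
rewrite /tau0; pose l : 'rV[R]_m.+1 := \row_j lifted (fun z => z 0 j) 0 p.
suff cl : rep p 0 @ \oo --> l.
  by rewrite (cvg_lim (@norm_hausdorff _ _) cl) mxE.
apply/cvg_ballP => e e0; have e2 : 0 < e / 2 by rewrite divr_gt0.
have H i : \forall k \near \oo, ball (l 0 i) e (rep p 0 k 0 i).
  have [M HM] := lifted_near ler01 (fun x y => coordinate_inner_lip 0 i x y) p e2.
  exists M => // k /= Mk; rewrite /ball/= distrC mxE; apply: le_lt_trans (HM k Mk) _; lra.
have : \forall k \near \oo, forall i, ball (l 0 i) e (rep p 0 k 0 i) by exact: filter_forall.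
apply: filterS => k Hk; split=> // a b; rewrite ord1; exact: Hk.
Qed.

Lemma tau0_lip p q i : (`|tau0 s p 0 i - tau0 s q 0 i|%:E <= slit_dist s p q)%E.
Proof.
by rewrite !tau0_lifted -[leRHS]mul1e; apply: (lifted_lip ler01) => x y; exact: coordinate_inner_lip.
Qed.

Lemma rep_near_tau0 p i (e : R) : 0 < e -> exists N, forall k, (N <= k)%N ->
  coord_near e (rep p i k) (tau0 s p).
Proof.
move=> e0; have e2 : 0 < e / 3 by rewrite divr_gt0.
have [N1 H1] := rep_tau p (leq0n i) e2.
have H j : \forall k \near \oo, `|rep p 0 k 0 j - tau0 s p 0 j| <= e / 3.
  have [M HM] := lifted_near ler01 (fun x y => coordinate_inner_lip 0 j x y) p e2.
  by exists M => // k /= Mk; rewrite tau0_lifted; exact: HM.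
have [N2 _ H2] : \forall k \near \oo, forall j, `|rep p 0 k 0 j - tau0 s p 0 j| <= e / 3.
  exact: filter_forall.
exists (maxn N1 N2) => k; rewrite geq_max => /andP[k1 k2] j.
have := le_trans (inner_dist_coord _ _ _ j) (H1 k k1); rewrite lee_fin.
have := H2 k k2 j; rewrite !ler_norml ltr_norml => /andP[? ?] /andP[? ?]; apply/andP; split; lra.
Qed.

Lemma tau0_box p i : 0 <= tau0 s p 0 i <= 1.
Proof.
have H (e : R) : 0 < e -> - e <= tau0 s p 0 i <= 1 + e.
  move=> e0; have [N /(_ N (leqnn N) i)] := rep_near_tau0 p 0 e0.
  have [/(_ i)/andP[? ?] _] := rep_dom p 0 N.
  rewrite ltr_norml => /andP[? ?]; apply/andP; split; lra.
apply/andP; split; apply/ler_addgt0Pr => e e0; have /andP[] := H e e0; lra.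
Qed.

Section lifted_folded.
Variables (P : seq (plate R m)) (N : nat).
Hypothesis P_disjoint : plates_disjoint P.
Hypothesis P_avoided : forall z, dom N z -> off_plates P z.
Local Notation U := (lifted (folded P) N).

Let folded_lip x y : (`|folded P x - folded P y|%:E <= 2%:E * dist N x y)%E.
Proof. exact: folded_inner_dist. Qed.

Lemma lifted_folded_lip p q : (`|U p - U q|%:E <= 2%:E * slit_dist s p q)%E.
Proof. by apply: lifted_lip => // x y; exact: folded_lip. Qed.

Lemma lifted_folded_approx p (e : R) : 0 < e -> exists z,
  [/\ coord_near e z (tau0 s p), `|folded P z - U p| <= e & off_plates P z].
Proof.
move=> e0; have [M1 H1] := lifted_near (ler0n R 2) folded_lip p e0.
have [M2 H2] := rep_near_tau0 p N e0; exists (rep p N (maxn M1 M2)); split.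
- by apply: H2; rewrite leq_maxr.
- by apply: H1; rewrite leq_maxl.
- exact/P_avoided/rep_dom.
Qed.

Lemma lifted_folded_dist p : `|U p - tau0 s p 0 0| = push P (tau0 s p).
Proof.
have H (e : R) : 0 < e -> `| `|U p - tau0 s p 0 0| - push P (tau0 s p)| <= 3 * e.
  move=> e0; have [z [zp Uz _]] := lifted_folded_approx p e0.
  have B : `|push P z - push P (tau0 s p)| <= e by apply: push_lip => i; exact: ltW.
  have := folded_dist P z; move: B Uz (zp 0).
  move: (U p) (folded P z) (push P z) (push P (tau0 s p)) (tau0 s p 0 0) (z 0 0) => u f b b' t x.
  move=> + + + fb; rewrite -fb => H1 H2 H3.
  rewrite (_ : `|u - t| - b' = (`|u - t| - `|f - x|) + (`|f - x| - b')); last by ring.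
  apply: le_trans (ler_normD _ _) _.
  apply: (@le_trans _ _ (2 * e + e)); last by lra.
  apply: lerD H1; apply: le_trans (ler_dist_dist _ _) _.
  rewrite (_ : u - t - (f - x) = (x - t) - (f - u)); last by ring.
  apply: le_trans (ler_normB _ _) _; lra.
apply/eqP; rewrite -subr_eq0 -normr_le0; apply/ler_addgt0Pr => e e0; rewrite add0r.
have := H (e / 3); rewrite mulrCA divff ?mulr1//; apply; exact: divr_gt0.
Qed.

Lemma lifted_folded_core p b : b \in P -> core b (tau0 s p) ->
  `|U p - pc b 0 0| = ph b.
Proof.
move=> bP bc; have [e1 e10 He1] := core_open bc.
have H (e : R) : 0 < e -> `| `|U p - pc b 0 0| - ph b| <= e.
  move=> e0; have em0 : 0 < Num.min e e1 by rewrite lt_min e0.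
  have [z [zp Uz _]] := lifted_folded_approx p em0.
  have bz : core b z.
    by apply: He1 => i; rewrite distrC; apply: lt_le_trans (zp i) _; rewrite ge_min lexx orbT.
  rewrite -(folded_core P_disjoint bP bz).
  apply: le_trans (ler_dist_dist _ _) _.
  rewrite (_ : _ - _ - _ = - (folded P z - U p)); last by ring.
  by rewrite normrN; apply: le_trans Uz _; rewrite ge_min lexx.
apply/eqP; rewrite -subr_eq0 -normr_le0; apply/ler_addgt0Pr => e e0; rewrite add0r.
exact: H.
Qed.

End lifted_folded.

End slit_space.

(** The slits under the finitely many plates are all among the first [N]. *)
Lemma slit_domain_off_plates (R : realType) (m : nat) (r : nat -> R)
    (s : nat -> set 'rV[R]_m.+1) (P : seq (plate R m)) :
  set_surj [set: nat] (dyadic_slits m r) s ->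
  (forall b, b \in P -> on_slit r b) ->
  exists N, forall z, slit_domain s N z -> off_plates P z.
Proof.
move=> sS; elim: P => [|b P IH] bP; first by exists 0%N => z _ b.
have [N HN] := IH (fun b' b'P => bP b' (@mem_behead _ (b :: P) b' b'P)).
have [i [k [ri bk]]] := bP b (mem_head b P).
have [|j _ sj] := sS (dyadic_slit r k).
  split; last by exists i, k.
  exists (dyadic_center k); split=> // j _; rewrite subrr normr0.
  by rewrite !divr_ge0// ltW.
exists (maxn N j.+1) => z zN b'; rewrite inE => /predU1P[->|b'P] b'z.
  apply/eqP => z0; have [_ []] := zN; exists j; last by rewrite sj; exact: bk.
  by rewrite /= leq_max ltnSn orbT.
have oP := HN z (slit_domain_subset s (leq_maxl N j.+1) z zN); exact: oP.
Qed.

(** * Covers by dyadic cells *)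

Lemma unit_interval_cell (R : realType) (G : nat) (x : R) : 0 <= x <= 1 ->
  exists k : 'I_(2 ^ G), k%:R / 2 ^+ G <= x <= (k%:R + 1) / 2 ^+ G.
Proof.
move=> /andP[x0 x1]; have p0 : 0 < 2 ^+ G :> R by rewrite exprn_gt0.
have y0 : 0 <= x * 2 ^+ G by rewrite mulr_ge0// ltW.
have [lt|] := ltP (x * 2 ^+ G) (2 ^+ G).
  have H : (Num.truncn (x * 2 ^+ G) < 2 ^ G)%N by rewrite truncn_lt_nat// natrX.
  exists (Ordinal H); rewrite /= ler_pdivrMr// ler_pdivlMr// natr1.
  by have /andP[-> /ltW] := truncn_itv y0.
rewrite ler_pMl// => x1'; have {x1 x1'} -> : x = 1 by apply/eqP; rewrite eq_le x1.
have H : ((2 ^ G).-1 < 2 ^ G)%N by rewrite prednK ?expn_gt0.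
exists (Ordinal H) => /=; rewrite natr1 prednK ?expn_gt0// natrX divff ?lexx ?andbT ?gt_eqF//.
by rewrite ler_pdivrMr// mul1r -natrX ler_nat leq_pred.
Qed.

Lemma closed_box_cell (R : realType) (m G : nat) (z : 'rV[R]_m.+1) :
  (forall i, 0 <= z 0 i <= 1) -> exists w : 'I_(2 ^ G) ^ m.+1, cell w z.
Proof.
move=> z01; have [w Hw] := choice (fun i => unit_interval_cell G (z01 i)).
by exists [ffun i => w i] => i; rewrite ffunE; exact: Hw.
Qed.

Lemma cell_dist (R : realType) (m G : nat) (w : 'I_(2 ^ G) ^ m.+1) (z z' : 'rV[R]_m.+1) :
  cell w z -> cell w z' -> forall i, `|z 0 i - z' 0 i| <= 1 / 2 ^+ G.
Proof.
move=> cz cz' i; have := cz i; have := cz' i.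
rewrite !mulrDl ler_norml => /andP[? ?] /andP[? ?]; apply/andP; split; lra.
Qed.

(** A finite set does not separate [x] from the points close to it; at an end of the
    interval these are taken on the inner side. *)
Lemma unseparated_point (R : realType) (F : seq R) (a b x : R) : a < b -> a <= x <= b ->
  exists2 y, a < y < b & y != x /\ forall c t, c \in F -> 0 <= t <= 1 ->
    x + t * (y - x) = c -> c = x.
Proof.
have right (G : seq R) (x' b' : R) : x' < b' -> exists2 y, x' < y < b' & forall c, c \in G -> x' < c -> y < c.
  move=> xb; elim: G => [|c G [y /andP[xy yb] Hy]].
    by exists ((x' + b') / 2) => //; apply/andP; split; lra.
  have [cx|xc] := leP c x'.
    by exists y; [rewrite xy yb|move=> c'; rewrite inE => /predU1P[->|/Hy//]; rewrite ltNge cx].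
  have [yc|cy] := ltP y c.
    by exists y; [rewrite xy yb|move=> c'; rewrite inE => /predU1P[->|/Hy//]].
  exists ((x' + c) / 2); first by apply/andP; split; lra.
  move=> c'; rewrite inE => /predU1P[->|/Hy H xc']; first by lra.
  by have := H xc'; lra.
move=> ab /andP[ax xb]; have [lt|xb'] := ltP x b.
  have [y /andP[xy yb] Hy] := right F x b lt; exists y; first by rewrite (le_lt_trans ax).
  split=> [|c t cF /andP[t0 t1] E]; first by rewrite gt_eqF.
  have [xc|xc] := ltP x c; last first.
    by apply/eqP; rewrite eq_le xc -E lerDl mulr_ge0// subr_ge0 ltW.
  have := Hy c cF xc; have : t * (y - x) <= 1 * (y - x) by rewrite ler_wpM2r// subr_ge0 ltW.
  lra.
have ax' : - x < - a by rewrite ltrN2; exact: lt_le_trans ab xb'.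
have [y /andP[xy yb] Hy] := right (map -%R F) (- x) (- a) ax'; exists (- y).
  by apply/andP; split; lra.
split=> [|c t cF /andP[t0 t1] E]; first by rewrite lt_eqF// ltrNl.
have E' : (- x) + t * (y - (- x)) = - c by rewrite -E; ring.
have [xc|xc] := ltP c x; last first.
  apply/eqP; rewrite eq_le xc andbT; have : 0 <= t * (y - - x) by rewrite mulr_ge0// subr_ge0 ltW.
  lra.
have Hc : y < - c by apply: Hy; [exact: map_f|rewrite ltrN2].
have : t * (y - - x) <= 1 * (y - - x) by rewrite ler_wpM2r// subr_ge0 ltW.
lra.
Qed.

Lemma dyadic_slit_coord (R : realType) (m : nat) (r : nat -> R) g (k : 'I_(2 ^ g) ^ m.+1)
  (z : 'rV[R]_m.+1) : dyadic_slit r k z -> z 0 0 = ((k 0)%:R + 2^-1) / 2 ^+ g.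
Proof. by move=> [_ -> _]; rewrite mxE. Qed.

(** The slit of a cube of an earlier generation lies in a hyperplane of the grid of
    generation [G], as the centre of the cube is a vertex of this grid. *)
Lemma coarse_slit (R : realType) (m : nat) (r : nat -> R) (G g : nat) (k : 'I_(2 ^ g) ^ m.+1)
    (z : 'rV[R]_m.+1) (a : nat) : (g < G)%N -> dyadic_slit r k z ->
  a%:R / 2 ^+ G < z 0 0 < (a%:R + 1) / 2 ^+ G -> False.
Proof.
move=> gG /dyadic_slit_coord ->.
have p0 n : 0 < 2 ^+ n :> R by rewrite exprn_gt0.
have -> : (k 0)%:R + 2^-1 = ((k 0).*2.+1)%:R / 2 :> R.
  have -> : ((k 0).*2.+1)%:R = 2 * (k 0)%:R + 1 :> R by rewrite -mul2n -natr1 natrM.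
  lra.
rewrite -mulrA -invfM -exprS.
have -> : ((k 0).*2.+1)%:R / 2 ^+ g.+1 = ((k 0).*2.+1 * 2 ^ (G - g.+1))%:R / 2 ^+ G :> R.
  rewrite natrM natrX -{2}(subnK gG) exprD invfM mulrA mulfK// gt_eqF//.
rewrite natr1 !ltr_pM2r ?invr_gt0// !ltr_nat; lia.
Qed.

(** The centre of the cube is in the middle between two hyperplanes of the grid of
    its own generation, and its slit does not reach them as [r g < 1]. *)
Lemma fine_slit (R : realType) (m : nat) (r : nat -> R) (G g : nat) (k : 'I_(2 ^ g) ^ m.+1)
    (z : 'rV[R]_m.+1) (j : 'I_m.+1) (a : nat) : (forall i, 0 <= r i < 1) -> (G <= g)%N ->
  j != 0 -> z 0 j = a%:R / 2 ^+ G -> ~ dyadic_slit r k z.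
Proof.
move=> r01 Gg j0 zj [_ _ /(_ j j0)]; rewrite zj mxE.
have p0 n : 0 < 2 ^+ n :> R by rewrite exprn_gt0.
have -> : a%:R / 2 ^+ G = (a * 2 ^ (g - G))%:R / 2 ^+ g :> R.
  by rewrite natrM natrX -{2}(subnK Gg) exprD invfM mulrA mulfK// gt_eqF.
move: (a * _)%N => c; rewrite -mulrBl normrM [X in _ * X]ger0_norm ?invr_ge0 ?(ltW (p0 _))//.
have /andP[_ r1] := r01 g; rewrite leNgt => /negP; apply; rewrite [ltLHS]mulrAC ltr_pM2r ?invr_gt0//.
apply: (@lt_le_trans _ _ (2^-1)); first by lra.
have [ck|ck] := leqP c (k j).
  rewrite ler_normr; apply/orP; right; have : c%:R <= (k j)%:R :> R by rewrite ler_nat.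
  lra.
rewrite ler_normr; apply/orP; left; have : ((k j).+1)%:R <= c%:R :> R by rewrite ler_nat.
rewrite -natr1; lra.
Qed.

Section cells.
Context {R : realType} {m : nat} (r : nat -> R) (s : nat -> set 'rV[R]_m.+1).
Hypothesis m_gt0 : (0 < m)%N.
Hypothesis r01 : forall i, 0 <= r i < 1.
Hypothesis s_slit : forall i, dyadic_slits m r (s i).
Local Notation dom := (slit_domain s).
Local Notation dist i := (inner_dist (slit_domain s i)).
Local Notation rep p i := (completion_rep (sval p i)).
Implicit Types (p q : slit_space s) (z : 'rV[R]_m.+1).

Lemma convex_between (a b x y t : R) : 0 <= t <= 1 -> a < x < b -> a < y < b ->
  a < x + t * (y - x) < b.
Proof.
move=> /andP[t0 t1] /andP[ax xb] /andP[ay yb].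
have [yx|xy] := leP y x.
  have : t * (x - y) <= 1 * (x - y) by rewrite ler_wpM2r// subr_ge0.
  have : 0 <= t * (x - y) by rewrite mulr_ge0// subr_ge0.
  by move=> ? ?; apply/andP; split; lra.
have : t * (y - x) <= 1 * (y - x) by rewrite ler_wpM2r// subr_ge0 ltW.
have : 0 <= t * (y - x) by rewrite mulr_ge0// subr_ge0 ltW.
by move=> ? ?; apply/andP; split; lra.
Qed.

Lemma segment_inner_dist i z z' (c : R) : box R m.+1 z -> box R m.+1 z' -> 0 <= c ->
  (forall j, `|z 0 j - z' 0 j| <= c) ->
  (forall j (t : R), (j < i)%N -> 0 <= t <= 1 -> ~ s j (\row_l (z 0 l + t * (z' 0 l - z 0 l)))) ->
  (dist i z z' <= (m.+1%:R * c)%:E)%E.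
Proof.
move=> zI z'I c0 zz H; apply: inner_dist_segment => // t /andP[t0 t1]; split.
  move=> l; rewrite mxE; have /andP[a0 a1] := zI l; have /andP[b0 b1] := z'I l.
  by apply: convex_between; rewrite ?t0 ?a0 ?b0.
by move=> [j ji]; apply: H => //; rewrite t0.
Qed.

Definition with_first z (x : R) : 'rV[R]_m.+1 := \row_l (if l == 0 then x else z 0 l).

Lemma with_firstE z x : with_first z x 0 0 = x.
Proof. by rewrite mxE. Qed.

Lemma with_first_other z x l : l != 0 -> with_first z x 0 l = z 0 l.
Proof. by move=> l0; rewrite mxE (negbTE l0). Qed.

Lemma with_first_box G (k : 'I_(2 ^ G)) z (x : R) :
  k%:R / 2 ^+ G < x < (k%:R + 1) / 2 ^+ G -> box R m.+1 z -> box R m.+1 (with_first z x).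
Proof.
move=> /andP[x0 x1] zI l; rewrite mxE; case: eqP => _; last exact: zI.
have p0 : 0 < 2 ^+ G :> R by rewrite exprn_gt0.
rewrite (le_lt_trans _ x0) ?divr_ge0// ?(ltW p0)//=.
by apply: lt_le_trans x1 _; rewrite ler_pdivrMr// mul1r natr1 -natrX ler_nat.
Qed.

(** Leave [z] parallel to the first axis without meeting a slit, to a hyperplane
    that contains no slit; this hyperplane may be explored freely. *)
Lemma leave_hyperplane i G (w : 'I_(2 ^ G) ^ m.+1) z : cell w z -> dom i z ->
  exists x, [/\ (w 0)%:R / 2 ^+ G < x < ((w 0)%:R + 1) / 2 ^+ G &
    forall v, cell w v -> box R m.+1 v ->
      (dist i z (with_first v x) <= (2 * m.+1%:R / 2 ^+ G)%:E)%E].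
Proof.
move=> cz [zI zs]; have p0 n : 0 < 2 ^+ n :> R by rewrite exprn_gt0.
have /choice[c Hc] : forall j, exists c : R, forall z', s j z' -> z' 0 0 = c.
  move=> j; have [_ [g [k ->]]] := s_slit j.
  by exists (((k 0)%:R + 2^-1) / 2 ^+ g) => z'; exact: dyadic_slit_coord.
have wlt : (w 0)%:R / 2 ^+ G < ((w 0)%:R + 1) / 2 ^+ G :> R by rewrite ltr_pM2r ?invr_gt0// ltrDl.
have [x xw [xz Hx]] := unseparated_point [seq c j | j <- iota 0 i] wlt (cz 0).
have {}Hx j t : (j < i)%N -> 0 <= t <= 1 -> z 0 0 + t * (x - z 0 0) = c j -> c j = z 0 0.
  by move=> ji; apply: Hx; apply: map_f; rewrite mem_iota.
have cx v : cell w v -> cell w (with_first v x).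
  move=> cv l; rewrite mxE; case: eqP => [->|_]; last exact: cv.
  by have /andP[/ltW-> /ltW->] := xw.
have Ix v : box R m.+1 v -> box R m.+1 (with_first v x) by move=> vI; exact: (with_first_box xw vI).
have c0 : 0 <= 1 / 2 ^+ G :> R by rewrite divr_ge0// ltW.
exists x; split=> // v cv vI.
apply: le_trans (inner_dist_triangle _ _ (with_first z x) _) _.
rewrite (_ : 2 * m.+1%:R / 2 ^+ G = m.+1%:R * (1 / 2 ^+ G) + m.+1%:R * (1 / 2 ^+ G)); last by ring.
rewrite EFinD; apply: leeD; apply: segment_inner_dist => //.
- exact: Ix.
- by apply: (cell_dist cz); exact: cx.
- move=> j t ji t01 sj; have := Hx j t ji t01; have := Hc j _ sj; rewrite mxE with_firstE.
  move=> E /(_ E) E'; apply: zs; exists j => //.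
  move: E; rewrite E' => /eqP; rewrite -subr_eq0 addrAC subrr add0r mulf_eq0 subr_eq0 (negbTE xz) orbF => /eqP t0.
  move: sj; rewrite t0 (_ : \row_l _ = z)//.
  by apply/rowP => l; rewrite mxE mul0r addr0.
- exact: Ix.
- exact: Ix.
- by apply: (@cell_dist _ _ _ w); exact: cx.
- move=> j t ji t01 /Hc; rewrite mxE !with_firstE subrr mulr0 addr0 => E.
  have := Hx j 1 ji; rewrite ler01 lexx mul1r addrC subrK -E => /(_ isT erefl) xz'.
  by rewrite xz' eqxx in xz.
Qed.

(** From both points one moves first to the vertex [v], up to the first coordinate. The
    remaining segment, parallel to the first axis, meets no slit: it lies in a face
    of the grid of generation [G] orthogonal to another axis, which no slit of
    generation [G] or later meets, and in the interior of the cell with respect to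
    the first coordinate, where there is no earlier slit. *)
Lemma cell_inner_dist i G (w : 'I_(2 ^ G) ^ m.+1) z z' : (0 < G)%N ->
  cell w z -> cell w z' -> dom i z -> dom i z' ->
  (dist i z z' <= (5 * m.+1%:R / 2 ^+ G)%:E)%E.
Proof.
move=> G0 cz cz' dz dz'; have p0 n : 0 < 2 ^+ n :> R by rewrite exprn_gt0.
have [x [xw Hx]] := leave_hyperplane cz dz.
have [x' [x'w Hx']] := leave_hyperplane cz' dz'.
(* A vertex of the cell that is interior to the unit cube. *)
pose a l : nat := if w l == 0%N :> nat then 1%N else w l.
have aw l : (w l <= a l <= (w l).+1)%N by rewrite /a; case: eqP => [->|_]; lia.
have a01 l : (0 < a l < 2 ^ G)%N.
  rewrite /a; case: eqP => [_|w0]; last by rewrite ltn_ord andbT lt0n; apply/eqP.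
  by rewrite /= (leq_ltn_trans G0)// ltn_expl.
pose v : 'rV[R]_m.+1 := \row_l ((a l)%:R / 2 ^+ G).
have cv : cell w v.
  move=> l; have /andP[lo hi] := aw l.
  by rewrite mxE natr1 !ler_pM2r ?invr_gt0// !ler_nat lo.
have vI : box R m.+1 v.
  move=> l; have /andP[lo hi] := a01 l.
  by rewrite mxE divr_gt0 ?ltr0n//= ltr_pdivrMr// mul1r -natrX ltr_nat.
apply: le_trans (inner_dist_triangle _ _ (with_first v x) _) _.
apply: le_trans (leeD (Hx v cv vI) (inner_dist_triangle _ _ (with_first v x') _)) _.
rewrite (_ : 5 * m.+1%:R / 2 ^+ G = 2 * m.+1%:R / 2 ^+ G + (m.+1%:R * (1 / 2 ^+ G) + 2 * m.+1%:R / 2 ^+ G)); last by ring.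
rewrite EFinD leeD2l// EFinD; apply: leeD; last by rewrite inner_dist_sym; exact: Hx'.
apply: segment_inner_dist.
- exact: (with_first_box xw vI).
- exact: (with_first_box x'w vI).
- by rewrite divr_ge0// ltW.
- move=> l; rewrite !mxE; case: eqP => _; last by rewrite subrr normr0 divr_ge0// ltW.
  move: xw x'w; rewrite !mulrDl => /andP[? ?] /andP[? ?].
  by rewrite ler_norml; apply/andP; split; lra.
move=> j t ji /andP[t0 t1]; have [_ [g [k ->]]] := s_slit j.
have [gG|Gg] := ltnP g G.
  move=> /(@coarse_slit _ _ _ _ _ _ _ (w 0) gG); apply; rewrite !mxE eqxx.
  by apply: convex_between; rewrite ?t0.
have l0 : lift ord0 (Ordinal m_gt0) != 0 :> 'I_m.+1 by [].
apply: (fine_slit r01 Gg l0 (a := a (lift ord0 (Ordinal m_gt0)))).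
by rewrite mxE !with_first_other// subrr mulr0 addr0 mxE.
Qed.

(** A substitute for the closure of the part of the slit space over [B], expressed by
    the representatives at each stage because distances are limits over these. *)
Definition lift_of (B : set 'rV[R]_m.+1) : set (slit_space s) :=
  [set p | forall i (e : R), 0 < e -> exists N, forall k, (N <= k)%N ->
     exists z, [/\ B z, dom i z & (dist i (rep p i k) z <= e%:E)%E]].

Lemma lift_of_cell_diam G (w : 'I_(2 ^ G) ^ m.+1) : (0 < G)%N ->
  (set_diam (slit_dist s) (lift_of (cell w)) <= (5 * m.+1%:R / 2 ^+ G)%:E)%E.
Proof.
move=> G0; apply: set_diam_le => [|p q pw qw].
  by rewrite lee_fin divr_ge0// ?mulr_ge0// exprn_ge0.
apply: slit_dist_le => i e K e0; have e2 : 0 < e / 2 by rewrite divr_gt0.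
have [N1 H1] := pw i _ e2; have [N2 H2] := qw i _ e2.
exists (maxn K (maxn N1 N2)); first exact: leq_maxl.
move: (maxn K _) (leq_maxr K (maxn N1 N2)) => k; rewrite geq_max => /andP[/H1 + /H2].
move=> [z [cz dz pz]] [z' [cz' dz' qz']].
apply: le_trans (inner_dist_triangle _ _ z _) _.
apply: le_trans (leeD pz (inner_dist_triangle _ _ z' _)) _.
rewrite inner_dist_sym in qz'.
apply: le_trans (leeD (lexx _) (leeD (cell_inner_dist G0 cz cz' dz dz') qz')) _.
by rewrite -!EFinD lee_fin; lra.
Qed.

Lemma lift_of_cell_tau0 G (w : 'I_(2 ^ G) ^ m.+1) p :
  lift_of (cell w) p -> cell w (tau0 s p).
Proof.
move=> pw i; suff H (e : R) : 0 < e ->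
    (w i)%:R / 2 ^+ G - 2 * e <= tau0 s p 0 i <= ((w i)%:R + 1) / 2 ^+ G + 2 * e.
  by apply/andP; split; apply/ler_addgt0Pr => e e0;
    have /andP[] := H (e / 2) (divr_gt0 e0 (ltr0n R 2)); lra.
move=> e0; have [N1 H1] := pw 0%N e e0; have [N2 H2] := rep_near_tau0 p 0 e0.
have [z [/(_ i)/andP[z1 z2] _ pz]] := H1 _ (leq_maxl N1 N2).
have := H2 _ (leq_maxr N1 N2) i.
have := le_trans (inner_dist_coord _ _ _ i) pz; rewrite lee_fin.
by rewrite ler_norml ltr_norml => /andP[? ?] /andP[? ?]; apply/andP; split; lra.
Qed.

(** A late enough representative at a late enough stage selects a cell. *)
Lemma lift_of_cell_cover G p : exists w : 'I_(2 ^ G) ^ m.+1, lift_of (cell w) p.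
Proof.
apply: contrapT => /forallNP H.
have /choice[x Hx] : forall w : 'I_(2 ^ G) ^ m.+1, exists x : nat * R, 0 < x.2 /\
    forall N, exists2 l, (N <= l)%N & forall z, cell w z -> dom x.1 z ->
      ~ (dist x.1 (rep p x.1 l) z <= x.2%:E)%E.
  move=> w; apply: contrapT => C; apply: (H w) => i e e0.
  apply: contrapT => /forallNP D; apply: C; exists (i, e); split=> // N.
  apply: contrapT => /forall2NP F; apply: (D N) => k Nk.
  have [//|/existsNP[z /not_implyP[cz /not_implyP[dz /contrapT zk]]]] := F k.
  by exists z.
pose i := \max_w (x w).1.
have ix w : ((x w).1 <= i)%N by exact: leq_bigmax.
have /choice[M HM] : forall w, exists M, forall k l, (M <= k)%N -> (M <= l)%N ->
    (dist (x w).1 (rep p (x w).1 l) (rep p i k) <= (x w).2%:E)%E.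
  move=> w; have [x0 _] := Hx w; have x2 : 0 < (x w).2 / 2 by rewrite divr_gt0.
  have [M1 H1] := completion_rep_near (sval p (x w).1) x2.
  have [M2 H2] := rep_tau p (ix w) x2; exists (maxn M1 M2) => k l.
  rewrite !geq_max => /andP[k1 k2] /andP[l1 l2].
  apply: le_trans (inner_dist_triangle _ _ (rep p (x w).1 k) _) _.
  rewrite [(x w).2]splitr EFinD; apply: leeD; first exact: H1.
  by rewrite inner_dist_sym; exact: H2.
pose k := \max_w M w.
have [w cw] : exists w : 'I_(2 ^ G) ^ m.+1, cell w (rep p i k).
  apply: closed_box_cell => l; have [/(_ l)/andP[a b] _] := rep_dom p i k.
  by rewrite !ltW.
have [_ /(_ (M w))[l Ml /(_ _ cw)]] := Hx w; apply.
  exact: slit_domain_subset (ix w) _ (rep_dom p i k).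
by apply: HM => //; exact: leq_bigmax.
Qed.

End cells.

(** * The double *)

Section double.
Context {R : realType} {m : nat} (s : nat -> set 'rV[R]_m.+1).
Implicit Types x y : slit_double s.

(** A detour through the outer boundary is a sum of two distances in the slit
    space. *)
Lemma double_dist_lip (f : slit_space s -> R) (K : R) : 0 < K ->
  (forall p q, (`|f p - f q|%:E <= K%:E * slit_dist s p q)%E) ->
  forall x y, (`|f (sval x).2 - f (sval y).2|%:E <= K%:E * double_dist s x y)%E.
Proof.
move=> K0 fK x y; rewrite /double_dist; case: ifP => _; first exact: fK.
rewrite -lee_pdivrMl//; apply: le_ereal_inf_tmp => _ [z _ <-]; rewrite lee_pdivrMl//.
rewrite ge0_muleDr ?slit_dist_ge0//; apply: le_trans (leeD (fK _ _) (fK _ _)).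
by rewrite -EFinD lee_fin; exact: ler_distD.
Qed.

Lemma double_tau0_lip x y i :
  (`|double_tau0 s x 0 i - double_tau0 s y 0 i|%:E <= double_dist s x y)%E.
Proof.
rewrite -[leRHS]mul1e; apply: (double_dist_lip (f := fun p => tau0 s p 0 i)) => // p q.
by rewrite mul1e; exact: tau0_lip.
Qed.

Lemma double_copy_diam (b : bool) (B : set (slit_space s)) (c : \bar R) :
  (set_diam (slit_dist s) B <= c)%E ->
  (set_diam (double_dist s) [set x | (sval x).1 = b /\ B (sval x).2] <= c)%E.
Proof.
move=> Bc; apply: le_trans Bc; apply: set_diam_le; first exact: set_diam_ge0.
move=> x y [xb Bx] [yb By]; rewrite /double_dist xb yb eqxx.
by apply: ereal_sup_ubound; right; exists (sval x).2 => //; exists (sval y).2.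
Qed.

End double.

(** * Curves and their first coordinate *)

Section curves.
Context {R : realType} {T : Type} (d : T -> T -> \bar R) {m : nat} (t0 : T -> 'rV[R]_m.+1).
Hypothesis d_coord : forall x y i, (`|t0 x 0 i - t0 y 0 i|%:E <= d x y)%E.

(** The closure of the trace of a vertical curve lies in one hyperplane, which
    cannot join the two opposite faces. *)
Lemma connects_nonvertical (E F : set T) (gamma : R -> T) :
  E !=set0 -> F !=set0 -> (forall x, E x -> t0 x 0 0 = 0) -> (forall x, F x -> t0 x 0 0 = 1) ->
  connects d E F gamma -> ~ vertical t0 gamma.
Proof.
move=> [x0 Ex0] [x1 Fx1] E0 F1 cEF [c Hc].
have below (b : R) : @open (mspace d) (t0 @^-1` [set z : 'rV[R]_m.+1 | z 0 0 < b]).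
  apply: (coordinate_open_mspace d_coord) => z zb; exists (b - z 0 0); first by rewrite subr_gt0.
  by move=> z' /(_ 0); rewrite /= ltr_norml => /andP[? ?]; lra.
have beyond (b : R) : @open (mspace d) (t0 @^-1` [set z : 'rV[R]_m.+1 | b < z 0 0]).
  apply: (coordinate_open_mspace d_coord) => z zb; exists (z 0 0 - b); first by rewrite subr_gt0.
  by move=> z' /(_ 0); rewrite /= ltr_norml => /andP[? ?]; lra.
have cl x : @closure (mspace d) (trace gamma) x -> t0 x 0 0 = c.
  move=> clx; have tr y : trace gamma y -> t0 y 0 0 = c by move=> [t /Hc tc <-].
  have [lt|gt|//] := ltgtP (t0 x 0 0) c.
    have [y [/tr yc yb]] := clx _ (open_nbhs_nbhs (conj (below c) lt)).
    by move: yb; rewrite /= yc ltxx.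
  have [y [/tr yc yb]] := clx _ (open_nbhs_nbhs (conj (beyond c) gt)).
  by move: yb; rewrite /= yc ltxx.
have [b [b01 bc]] : exists b : R, 0 < b < 1 /\ b != c.
  have [->|n] := eqVneq c (1 / 2).
    by exists (1 / 4); split; [apply/andP; split; lra|rewrite lt_eqF//; lra].
  by exists (1 / 2); split; [apply/andP; split; lra|rewrite eq_sym].
have /andP[b0 b1] := b01.
pose X := E `|` F `|` @closure (mspace d) (trace gamma).
have Xb x : X x -> t0 x 0 0 != b.
  move=> [[/E0 ->|/F1 ->]|/cl ->]; [by rewrite lt_eqF|by rewrite gt_eqF|by rewrite eq_sym].
have XE : X `&` (t0 @^-1` [set z : 'rV[R]_m.+1 | z 0 0 < b]) = X.
  apply: cEF.
  - by exists x0; split; [left; left|rewrite /= E0].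
  - by exists (t0 @^-1` [set z : 'rV[R]_m.+1 | z 0 0 < b]) => //; exact: below.
  exists (~` (t0 @^-1` [set z : 'rV[R]_m.+1 | b < z 0 0])).
    exact/(@open_closedC (mspace d))/beyond.
  apply/seteqP; split=> x [Xx xb]; split => //; rewrite /preimage/= in xb *.
    by move=> /(lt_trans xb); rewrite ltxx.
  by rewrite lt_neqAle Xb//= leNgt; apply/negP.
have : X x1 by left; right.
by rewrite -XE => -[_]; rewrite /= F1// => /(lt_trans b1); rewrite ltxx.
Qed.

Lemma eucl_curve (gamma : R -> T) : is_curve d gamma -> is_curve eucl (t0 \o gamma).
Proof.
move=> cg t t01 A; rewrite nbhsE => -[B [oB Bt] BA].
have [e e0 He] : exists2 e : R, 0 < e & forall y, (eucl (t0 (gamma t)) y < e%:E)%E -> B y.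
  exact: oB.
pose c : R := e / (m.+1%:R * 2).
have c0 : 0 < c by rewrite divr_gt0// mulr_gt0.
have oC : @open (mspace d) (t0 @^-1` [set z : 'rV[R]_m.+1 | coord_near c (t0 (gamma t)) z]).
  apply: (coordinate_open_mspace d_coord) => z zc.
  have : \forall r \near (0 : R)^'+, forall i, r <= c - `|t0 (gamma t) 0 i - z 0 i|.
    apply: filter_forall => i; near=> r; apply/ltW; near: r; apply: nbhs_right_lt.
    by rewrite subr_gt0; exact: zc.
  move=> H; near (0 : R)^'+ => r; exists r => // z' zz i.
  have Hr : r <= c - `|t0 (gamma t) 0 i - z 0 i| by move: i; near: r.
  apply: le_lt_trans (ler_distD (z 0 i) _ _) _; have := zz i; lra.
have /(cg t t01) : nbhs (gamma t : mspace d) (t0 @^-1` [set z : 'rV[R]_m.+1 | coord_near c (t0 (gamma t)) z]).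
  apply: (@open_nbhs_nbhs (mspace d)); split=> // i.
  by rewrite subrr normr0.
apply: (@filterS _ (nbhs t)) => t' /= Ht; apply: BA; apply: He.
apply: le_lt_trans (eucl_le (ltW c0) (fun i => ltW (Ht i))) _.
rewrite lte_fin /c invfM mulrCA mulVKf//; lra.
Unshelve. all: by end_near.
Qed.

Section lifted_coordinate.
Variables (P : seq (plate R m)) (U : T -> R).
Hypothesis t0_box : forall x i, 0 <= t0 x 0 i <= 1.
Hypothesis U_lip : forall x y, (`|U x - U y|%:E <= 2%:E * d x y)%E.
Hypothesis U_dist : forall x, `|U x - t0 x 0 0| = push P (t0 x).
Hypothesis U_core : forall x b, b \in P -> core b (t0 x) -> `|U x - pc b 0 0| = ph b.

Lemma curve_detected (gamma : R -> T) (a b : R) : is_curve d gamma -> 0 < a -> b < 1 ->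
  detected (t0 \o gamma) (push P) (uncovered P) a b.
Proof.
move=> cg a0 b1; apply: (detectedI (U := U \o gamma)).
- have half x y : (`|U x / 2 - U y / 2|%:E <= d x y)%E.
    rewrite -mulrBl normrM mulrC (ger0_norm (x := 2^-1))// EFinM lee_pdivrMl//; exact: U_lip.
  have H := econtD (curve_econt half cg a0 b1) (curve_econt half cg a0 b1).
  rewrite (_ : U \o gamma = (fun t => U (gamma t) / 2) \+ (fun t => U (gamma t) / 2))//.
  by apply/funext => t /=; rewrite -splitr.
- by move=> t _ i; exact: t0_box.
- by move=> t _; exact: U_dist.
- by move=> t c _; exact: U_core.
Qed.

End lifted_coordinate.

End curves.

(** * Points over the faces *)

Section boundary_points.
Context {R : realType} {m : nat} (r : nat -> R) (s : nat -> set 'rV[R]_m.+1).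
Hypothesis m_gt0 : (0 < m)%N.
Hypothesis r01 : forall i, 0 <= r i < 1.
Hypothesis s_slit : forall i, dyadic_slits m r (s i).
Local Notation dom := (slit_domain s).
Local Notation dist i := (inner_dist (slit_domain s i)).
Local Notation rep p i := (completion_rep (sval p i)).

Lemma cauchy_class_eq (d : 'rV[R]_m.+1 -> 'rV[R]_m.+1 -> \bar R) (A : set 'rV[R]_m.+1)
    (u v : nat -> 'rV[R]_m.+1) :
  (forall x y, (0 <= d x y)%E) -> (forall x y, d x y = d y x) ->
  (forall x y z, (d x z <= d x y + d y z)%E) ->
  (fun k => d (u k) (v k)) @ \oo --> (0%E : \bar R) -> cauchy_class d A u = cauchy_class d A v.
Proof.
move=> d0 dC dt; have half u' v' : (fun k => d (u' k) (v' k)) @ \oo --> (0%E : \bar R) ->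
    cauchy_class d A u' `<=` cauchy_class d A v'.
  move=> uv w [cw uw]; split=> //; apply: (squeeze_cvge (f := cst 0%E) (h :=
    (fun k => (d (u' k) (v' k) + d (u' k) (w k))%E))).
  - by apply: nearW => k; rewrite /= d0/= (dC (u' k) (v' k)) dt.
  - exact: cvg_cst.
  - by rewrite -[0%E]adde0; apply: cvgeD.
move=> uv; apply/seteqP; split; apply: half => //.
by rewrite (_ : (fun k => _) = fun k => d (u k) (v k))//; apply/funext => k.
Qed.

Lemma slit_point (u : nat -> 'rV[R]_m.+1) (l : 'rV[R]_m.+1) :
  (forall i, cauchy_in (dist i) (dom i) u) ->
  (forall j (e : R), 0 < e -> exists N, forall k, (N <= k)%N -> `|u k 0 j - l 0 j| <= e) ->
  exists p, tau0 s p = l.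
Proof.
move=> uC ul; pose p i : Mbar s i := completion_point (uC i).
have rp i : (fun k => dist i (u k) (completion_rep (p i) k)) @ \oo --> (0%E : \bar R).
  by have [] := completion_rep_class (@inner_distxx _ _ (dom i)) (p i).
have pt i j (ij : (i <= j)%N) : tau s ij (p j) = p i.
  have H : cauchy_class (dist i) (dom i) (completion_rep (p j)) =
      cauchy_class (dist i) (dom i) u.
    apply: cauchy_class_eq; [exact: inner_dist_ge0|exact: inner_dist_sym|exact: inner_dist_triangle|].
    apply: (squeeze_cvge (f := cst 0%E) (h := (fun k => dist j (u k) (completion_rep (p j) k)))).
    - apply: nearW => k; rewrite inner_dist_ge0/= inner_dist_sym.
      exact/inner_dist_subset/slit_domain_subset.
    - exact: cvg_cst.
    - exact: rp.
  exact: eq_exist.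
pose q : slit_space s := exist _ p pt; exists q; apply/rowP => j.
apply/eqP; rewrite -subr_eq0 -normr_le0; apply/ler_addgt0Pr => e e0; rewrite add0r.
have e3 : 0 < e / 3 by rewrite divr_gt0.
have [N1 H1] := ul j _ e3; have [N2 H2] := rep_near_tau0 q 0 e3.
have /fine_cvgP[[N3 _ H3] /cvgrPdist_le/(_ _ e3)[N4 _ H4]] := rp 0%N.
pose k := maxn (maxn N1 N2) (maxn N3 N4).
have {}H1 := H1 k ltac:(lia); have {}H2 := H2 k ltac:(lia) j.
have {}H3 := H3 k ltac:(rewrite /=; lia); have {}H4 := H4 k ltac:(rewrite /=; lia).
have : `|u k 0 j - rep q 0 k 0 j| <= e / 3.
  rewrite -lee_fin; apply: le_trans (inner_dist_coord (dom 0) _ _ j) _.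
  rewrite -(fineK H3) lee_fin; move: H4; rewrite sub0r normrN; exact/le_trans/ler_norm.
move: H1 H2; rewrite !ler_norml ltr_norml => /andP[? ?] /andP[? ?] /andP[? ?].
by apply/andP; split; lra.
Qed.

(** The slit of the whole cube is the only one that meets its axis, so that points
    over the face centres are limits along the axis. *)
Lemma axis_point (x : nat -> R) (l : R) : x @ \oo --> l ->
  (forall k, 0 < x k < 1) -> (forall k k' t, 0 <= t <= 1 -> x k + t * (x k' - x k) != 1 / 2) ->
  exists p, tau0 s p = \row_j (if j == 0 then l else 1 / 2).
Proof.
move=> xl x01 xh; pose pt (y : R) : 'rV[R]_m.+1 := \row_j (if j == 0 then y else 1 / 2).
have l0 : lift ord0 (Ordinal m_gt0) != 0 :> 'I_m.+1 by [].
have off j y : y != 1 / 2 -> ~ s j (pt y).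
  move=> yh; have [_ [g [k ->]]] := s_slit j.
  have [g0|g1] := leqP g 0.
    move=> /dyadic_slit_coord; move: g0; rewrite leqn0 => /eqP g0; subst g.
    rewrite mxE eqxx expr0 divr1 (_ : (k 0)%:R = 0); last first.
      by move: (ltn_ord (k 0)); case: (nat_of_ord (k 0)).
    by move=> E; move: yh; rewrite E add0r div1r eqxx.
  apply: (fine_slit r01 g1 l0 (a := 1)); by rewrite mxE (negbTE l0) expr1.
have ptI y : 0 < y < 1 -> box R m.+1 (pt y).
  by move=> y01 j; rewrite mxE; case: eqP => // _; apply/andP; split; lra.
have xh0 k : x k != 1 / 2 by have := xh k k 0; rewrite mul0r addr0; apply; rewrite lexx ler01.
apply: (@slit_point (fun k => pt (x k))).
  move=> i; split=> [k|e e0]; first by split; [exact: ptI|move=> [j _]; exact: off].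
  have [c c0 ce] : exists2 c : R, 0 < c & m.+1%:R * (c * 2) < e.
    exists (e / (m.+1%:R * 3)); first by rewrite divr_gt0// mulr_gt0.
    rewrite invfM [X in X * 2]mulrCA -mulrA mulVKf//; lra.
  have /cvgrPdist_le/(_ _ c0)[N _ HN] := xl; exists N => k k' Nk Nk'.
  have c2 : 0 <= c * 2 by rewrite mulr_ge0// ltW.
  apply: le_lt_trans (segment_inner_dist (ptI _ (x01 k)) (ptI _ (x01 k')) c2 _ _) _.
  - move=> j; rewrite !mxE; case: eqP => _; last by rewrite subrr normr0.
    have := HN k Nk; have := HN k' Nk'; rewrite !ler_norml => /andP[? ?] /andP[? ?].
    by apply/andP; split; lra.
  - move=> j t _ t01; rewrite (_ : \row_l0 _ = pt (x k + t * (x k' - x k))).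
      exact/off/xh.
    by apply/rowP => j'; rewrite !mxE; case: eqP => // _; rewrite subrr mulr0 addr0.
  by rewrite lte_fin.
move=> j e e0; have /cvgrPdist_le/(_ _ e0)[N _ HN] := xl; exists N => k Nk.
by rewrite !mxE; case: eqP => _; [rewrite distrC; exact: HN|rewrite subrr normr0 ltW].
Qed.

Let h3 (k : nat) : R := (k.+3%:R)^-1.

Let h3_cvg : h3 @ \oo --> (0 : R).
Proof.
have := @cvg_harmonic R; rewrite -(cvg_shiftn 2) => H.
by rewrite (_ : h3 = (fun k => harmonic (k + 2)%N : R))//; apply/funext => k; rewrite /harmonic/= addn2.
Qed.

Let h3_small k : 0 < h3 k < 1 / 2.
Proof.
by rewrite /h3 invr_gt0 ltr0n/= div1r ltf_pV2 ?posrE ?ltr0n// ltr_nat.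
Qed.

Lemma left_point : exists p, box_left R m (tau0 s p).
Proof.
have [||k k' t /andP[t0 t1]|p Hp] := @axis_point h3 0.
- exact: h3_cvg.
- by move=> k; have /andP[? ?] := h3_small k; apply/andP; split; lra.
- have /andP[? ?] : - 1 < h3 k + t * (h3 k' - h3 k) < 1 / 2.
    apply: convex_between; rewrite ?t0//; have /andP[? ?] := h3_small k;
    have /andP[? ?] := h3_small k'; apply/andP; split; lra.
  by rewrite lt_eqF.
exists p; rewrite Hp; split; first by rewrite mxE.
by move=> i i0; rewrite mxE (negbTE i0); apply/andP; split; lra.
Qed.

Lemma right_point : exists p, box_right R m (tau0 s p).
Proof.
have [||k k' t /andP[t0 t1]|p Hp] := @axis_point (fun k => 1 - h3 k) 1.
- rewrite -[X in _ --> X]subr0; apply: cvgB; [exact: cvg_cst|exact: h3_cvg].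
- by move=> k; have /andP[? ?] := h3_small k; apply/andP; split; lra.
- have /andP[? ?] : 1 / 2 < 1 - h3 k + t * (1 - h3 k' - (1 - h3 k)) < 2.
    apply: convex_between; rewrite ?t0//; have /andP[? ?] := h3_small k;
    have /andP[? ?] := h3_small k'; apply/andP; split; lra.
  by rewrite gt_eqF.
exists p; rewrite Hp; split; first by rewrite mxE.
by move=> i i0; rewrite mxE (negbTE i0); apply/andP; split; lra.
Qed.

End boundary_points.

(** * The modulus vanishes *)

(** [modulus_null_of_detected] for a sequence of families of plates whose heights
    [1 / 4 ^+ k] bound the distance between folded and first coordinates. *)
Lemma modulus_null (R : realType) (m : nat) (P : nat -> seq (plate R m)) (G : nat -> nat)
    (T : Type) (d : T -> T -> \bar R) (t0 : T -> 'rV[R]_m.+1)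
    (C : R) (N : nat) (L : forall G, 'I_(2 ^ G) ^ m.+1 -> seq (set T))
    (p : R) (Gamma : set (R -> T)) :
  (forall k b, b \in P k -> ph b <= 1 / 4 ^+ k) ->
  (forall k, (0 < G k)%N) -> (forall k, 1 / 2 ^+ G k <= 1 / 4 ^+ k :> R) ->
  (forall k, #|bad_cells (P k) (G k)|%:R <= 1 / 4 ^+ k * (2 ^+ G k) ^+ m.+1 :> R) ->
  (forall x y i, (`|t0 x 0 i - t0 y 0 i|%:E <= d x y)%E) ->
  0 <= C -> (forall G w, (size (@L G w) <= N)%N) ->
  (forall G w B, B \in @L G w -> (0 < G)%N -> (set_diam d B <= (C / 2 ^+ G)%:E)%E) ->
  (forall x G, (0 < G)%N -> (forall i, 0 <= t0 x 0 i <= 1) ->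
     exists w B, [/\ B \in @L G w, B x & cell w (t0 x)]) ->
  0 < p ->
  (forall gamma, Gamma gamma -> [/\ is_curve d gamma, ~ vertical t0 gamma &
     forall k (a b : R), 0 < a -> a <= b -> b < 1 ->
       detected (t0 \o gamma) (push (P k)) (uncovered (P k)) a b]) ->
  modulus d (hausdorff_measure d m.+1) p Gamma = 0%E.
Proof.
move=> Ph G0 Gs bads dc C0 Ls Ld Lc; apply: (@modulus_null_of_detected _ _ _ _ _ dc _ _ _ (fun k => 1 / 4 ^+ k)).
- by move=> k; exact: uncovered_closed.
- by move=> k; exact: push_lip.
- by move=> k z; apply: push_sup_le; [rewrite divr_ge0// exprn_ge0|exact: Ph].
- rewrite (_ : (fun k => _) = (fun k => (4^-1 : R) ^+ k)); last first.
    by apply/funext => k; rewrite div1r exprVn.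
  apply: cvg_expr; rewrite ger0_norm//; lra.
exact: (limsup_uncovered_null C0 Ls Ld Lc G0 Gs bads).
Qed.

Unset Implicit Arguments.

(* The dimension is n = m.+1. *)
Theorem lemma5p7 (R : realType) (m : nat) (n2 : (2 <= m.+1)%N)
    (r : nat -> R) (r01 : forall i, 0 <= r i < 1)
    (r_notin_ln : (\sum_(i <oo) ((r i) ^+ m.+1)%:E = +oo)%E)
    (s : nat -> set 'rV[R]_m.+1)
    (s_enum : set_bij [set: nat] (dyadic_slits m r) s)
    (s_assum : slit_assumptions s)
    (p : R) (p1 : 1 <= p) :
  [/\ modulus eucl (hausdorff_measure eucl m.+1) p
        (slit_avoiding_curves s) = 0%E,
      modulus eucl (hausdorff_measure eucl m.+1) p
        (projected_curves s) = 0%E,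
      modulus (slit_dist s)
        (hausdorff_measure (slit_dist s) m.+1) p
        (nonvertical_curves (slit_dist s) (tau0 s)) = 0%E &
      modulus (double_dist s)
        (hausdorff_measure (double_dist s) m.+1) p
        (nonvertical_curves (double_dist s) (double_tau0 s)) = 0%E].
Proof.
have [s_fun _ s_surj] := s_enum.
have s_slit i : dyadic_slits m r (s i) by exact: s_fun.
have p0 : 0 < p by exact: lt_le_trans p1.
have q0 k : 0 < 1 / 4 ^+ k :> R by rewrite divr_gt0// exprn_gt0.
have /choice[PG HPG] : forall k, exists PG : seq (plate R m) * nat,
    [/\ plates_disjoint PG.1, forall b, b \in PG.1 -> ph b <= 1 / 4 ^+ k /\ on_slit r b,
      (0 < PG.2)%N, 1 / 2 ^+ PG.2 <= 1 / 4 ^+ k :> R &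
      #|bad_cells PG.1 PG.2|%:R <= 1 / 4 ^+ k * (2 ^+ PG.2) ^+ m.+1 :> R].
  by move=> k; have [P [G H]] := packing r01 r_notin_ln (q0 k); exists (P, G).
pose P k := (PG k).1; pose G k := (PG k).2.
have Pd k : plates_disjoint (P k) by have [] := HPG k.
have Ph k b : b \in P k -> ph b <= 1 / 4 ^+ k by have [_ H _ _ _] := HPG k; move=> /H[].
have Ps k b : b \in P k -> on_slit r b by have [_ H _ _ _] := HPG k; move=> /H[].
have G0 k : (0 < G k)%N by have [] := HPG k.
have Gs k : 1 / 2 ^+ G k <= 1 / 4 ^+ k :> R by have [] := HPG k.
have bads k : #|bad_cells (P k) (G k)|%:R <= 1 / 4 ^+ k * (2 ^+ G k) ^+ m.+1 :> R.
  by have [] := HPG k.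
(* From stage [N k] on, the slits under the plates of [P k] are removed. *)
have /choice[N HN] k := slit_domain_off_plates s_surj (Ps k).
pose U k := lifted (folded (P k)) (N k) : slit_space s -> R.
have Ulip k x y : (`|U k x - U k y|%:E <= 2%:E * slit_dist s x y)%E.
  exact: lifted_folded_lip (Pd k) (HN k) x y.
have Udist k x : `|U k x - tau0 s x 0 0| = push (P k) (tau0 s x).
  exact: lifted_folded_dist (Pd k) (HN k) x.
have Ucore k x b : b \in P k -> core b (tau0 s x) -> `|U k x - pc b 0 0| = ph b.
  by move=> bP bc; exact: (lifted_folded_core (Pd k) (HN k) bP bc).
have C5 : 0 <= 5 * m.+1%:R :> R by rewrite mulr_ge0.
have lift_cover x G' := lift_of_cell_cover (s := s) G' x.
have slit_detected gamma k (a b : R) : is_curve (slit_dist s) gamma -> 0 < a -> a <= b -> b < 1 ->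
    detected (tau0 s \o gamma) (push (P k)) (uncovered (P k)) a b.
  move=> cg a0 _ b1; exact: (curve_detected (tau0_box (s := s))
    (Ulip k) (Udist k) (Ucore k) cg a0 b1).
have left_ne : tau0 s @^-1` box_left R m !=set0 by exact: left_point n2 r01 s_slit.
have right_ne : tau0 s @^-1` box_right R m !=set0 by exact: right_point n2 r01 s_slit.
have eucl_lip (x y : 'rV[R]_m.+1) i : (`|id x 0 i - id y 0 i|%:E <= eucl x y)%E.
  exact: eucl_coord.
have cell_diam G' (w : 'I_(2 ^ G') ^ m.+1) (B : set 'rV[R]_m.+1) : B \in [:: cell w] -> (0 < G')%N ->
    (set_diam eucl B <= (m.+1%:R / 2 ^+ G')%:E)%E.
  have e0 : 0 <= 1 / 2 ^+ G' :> R by rewrite divr_ge0// exprn_ge0.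
  rewrite inE => /eqP -> _; apply: set_diam_le; first by rewrite lee_fin divr_ge0// exprn_ge0.
  by move=> x y wx wy; have := eucl_le e0 (cell_dist wx wy); rewrite mul1r.
have cell_cover (x : 'rV[R]_m.+1) G' : (0 < G')%N -> (forall i, 0 <= id x 0 i <= 1) ->
    exists (w : 'I_(2 ^ G') ^ m.+1) B, [/\ B \in [:: cell w], B x & cell w (id x)].
  by move=> _ x01; have [w wx] := closed_box_cell G' x01; exists w, (cell w); rewrite inE.
have eucl_null Gamma := @modulus_null _ _ P G _ eucl id m.+1%:R 1
  (fun G w => [:: cell w]) p Gamma Ph G0 Gs bads eucl_lip (ler0n R m.+1)
  (fun _ _ => leqnn 1) cell_diam cell_cover p0.
split.
- apply: eucl_null => gamma [cg tg cLR].
  split=> //.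
    apply: (connects_nonvertical eucl_lip _ _ _ _ cLR).
    * by have [q Lq] := left_ne; exists (tau0 s q).
    * by have [q Rq] := right_ne; exists (tau0 s q).
    * by move=> x [].
    * by move=> x [].
  move=> k a b a0 ab b1; have inside t : a <= t <= b -> (box R m.+1 `\` \bigcup_i s i) (gamma t).
    move=> /andP[at_ tb]; apply: tg; exists t => //=.
    by rewrite in_itv/= (lt_le_trans a0 at_) (le_lt_trans tb b1).
  apply: (detectedI (U := folded (P k) \o gamma)).
  + apply: folded_econt => // [i|t /inside[tI ts]].
      exact: (curve_econt (fun x y => eucl_coord x y i) cg a0 b1).
    by apply: HN; split=> // -[j _ sj]; apply: ts; exists j.
  + by move=> t /inside[tI _] i; have /andP[/ltW-> /ltW->] := tI i.
  + by move=> t _; exact: folded_dist.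
  + by move=> t c _ cP; exact: folded_core.
- apply: eucl_null => _ [gamma [cg cLR] <-].
  (* The projected curve may touch the slits: its folded coordinate is that of the
     curve in the slit space. *)
  split; first exact: eucl_curve (tau0_lip (s := s)) _ cg.
    apply: (connects_nonvertical (tau0_lip (s := s)) left_ne right_ne _ _ cLR).
    * by move=> x [].
    * by move=> x [].
  by move=> k a b; exact: slit_detected.
- apply: (@modulus_null _ _ P G _ _ _ (5 * m.+1%:R) 1 (fun G w => [:: lift_of (cell w)])) => //.
  + exact: tau0_lip.
  + move=> G' w B; rewrite inE => /eqP -> G'0; exact: lift_of_cell_diam.
  + move=> x G' _ _; have [w xw] := lift_cover x G'.
    by exists w, (lift_of (cell w)); split; [rewrite inE|exact: xw|exact: lift_of_cell_tau0].
  by move=> gamma [cg nv]; split=> // k a b; exact: slit_detected.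
apply: (@modulus_null _ _ P G _ _ _ (5 * m.+1%:R) 2
  (fun G w => [seq [set x : slit_double s | (sval x).1 = b /\ lift_of (cell w) (sval x).2] | b <- [:: false; true]])) => //.
- exact: double_tau0_lip.
- move=> G' w B /mapP[b _ ->] G'0; apply: double_copy_diam; exact: lift_of_cell_diam.
- move=> x G' _ _; have [w xw] := lift_cover (sval x).2 G'.
  exists w, [set y : slit_double s | (sval y).1 = (sval x).1 /\ lift_of (cell w) (sval y).2].
  split=> //; last exact: lift_of_cell_tau0.
  by apply/mapP; exists (sval x).1 => //; case: (sval x).1.
move=> gamma [cg nv]; split=> // k a b a0 _ b1.
have Ulip' := double_dist_lip (ltr0n R 2) (Ulip k).
by apply: (curve_detected _ Ulip' _ _ cg a0 b1) => x *;
  [exact: tau0_box|exact: Udist|exact: Ucore].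
Qed.
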